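(* Let $m$ be a positive integer, let $K\in C^{[m]}(I^2)$ be independent of $\kappa$ and let $f\in\tilde H^m_{\kappa,0}(I)$. Suppose that for every $\kappa>1$ the equation $y(s)-\int_IK(s,t)e^{i\kappa|s-t|}y(t)\,dt=f(s)$, $s\in I$, has a unique solution $y=y_\kappa\in C(I)$. Then $y\in\tilde H^m_{\kappa,0}(I)$.
   Context: $I=[-1,1]$; $\kappa\in(1,\infty)$; functions are complex-valued; a $\kappa$-parameterized function is a family indexed by $\kappa>1$; ''independent of $\kappa$'' means a fixed function. $C^{[m]}(I^2)$: functions on $I^2$ with continuous $\partial_s^\alpha\partial_t^\beta$ derivatives, $\alpha,\beta\le m$. $H^m(I)$ is the Sobolev space with $\|u\|_{H^m}=(\sum_{j=0}^m\|u^{(j)}\|_{L^2(I)}^2)^{1/2}$. $H^m_{\kappa,0}(I)$: $\kappa$-parameterized $u$ with $u\in H^m(I)$ for every $\kappa$ and positive constants $c,\kappa_0$ with $\|u\|_{H^m}\le c$ for all $\kappa\ge\kappa_0$. $\tilde H^m_{\kappa,0}(I)=\{u_0+u_1e^{i\kappa t}+u_2e^{-i\kappa t}:u_0,u_1,u_2\in H^m_{\kappa,0}(I)\}$. *)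

(* Defs.v *)
From HB Require Import structures.
From mathcomp Require Import all_boot all_order all_algebra.
From mathcomp Require Import all_classical all_reals all_analysis.
From mathcomp Require Import complex.
Export Order.TTheory GRing.Theory Num.Theory.
Export numFieldNormedType.Exports.

Set Implicit Arguments.
Unset Strict Implicit.
Unset Printing Implicit Defensive.

Local Open Scope classical_set_scope.
Local Open Scope ring_scope.

Definition Iset (R : realType) : set R := `[(-1)%R, 1%R].
Definition Ioset (R : realType) : set R := `](-1)%R, 1%R[.

Arguments Iset R : clear implicits.
Arguments Ioset R : clear implicits.

Definition cexpi (R : realType) (x : R) : R[i] := (cos x +i* sin x)%C.

Definition sqmod (R : realType) (z : R[i]) : R := complex.Re z ^+ 2 + complex.Im z ^+ 2.

Definition CintI (R : realType) (g : R -> R[i]) : R[i] :=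
  (Rintegral (@lebesgue_measure R) (Iset R) (fun t => complex.Re (g t))
   +i* Rintegral (@lebesgue_measure R) (Iset R) (fun t => complex.Im (g t)))%C.

Definition L2I (R : realType) (u : R -> R[i]) : Prop :=
  measurable_fun (Iset R) (fun t => complex.Re (u t)) /\
  measurable_fun (Iset R) (fun t => complex.Im (u t)) /\
  (@lebesgue_measure R).-integrable (Iset R) (fun t => (sqmod (u t))%:E).

Definition test_fun (R : realType) (phi : R -> R) : Prop :=
  (forall (n : nat) (x : R), derivable (derive1n n phi) x 1) /\
  exists a b : R, (-1 < a) /\ (b < 1) /\
    forall x : R, (x < a \/ b < x) -> phi x = 0.

Definition weak_deriv (R : realType) (u g : R -> R[i]) : Prop :=
  forall phi : R -> R, test_fun phi ->
    Rintegral (@lebesgue_measure R) (Iset R) (fun t => complex.Re (u t) * derive1 phi t)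
      = - Rintegral (@lebesgue_measure R) (Iset R) (fun t => complex.Re (g t) * phi t) /\
    Rintegral (@lebesgue_measure R) (Iset R) (fun t => complex.Im (u t) * derive1 phi t)
      = - Rintegral (@lebesgue_measure R) (Iset R) (fun t => complex.Im (g t) * phi t).

(* u \in H^m(I) and ||u||_{H^m} <= c, where g j is the j-th weak derivative
   of u (weak derivatives are unique a.e., so this pins down the norm). *)
Definition Hm_bound (R : realType) (m : nat) (u : R -> R[i]) (c : R) : Prop :=
  exists g : nat -> R -> R[i],
    g 0%N = u /\
    (forall j : nat, (j <= m)%N -> L2I (g j)) /\
    (forall j : nat, (j < m)%N -> weak_deriv (g j) (g j.+1)) /\
    Num.sqrt (\sum_(0 <= j < m.+1)
                Rintegral (@lebesgue_measure R) (Iset R) (fun t => sqmod (g j t)))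
      <= c.

Definition inHm (R : realType) (m : nat) (u : R -> R[i]) : Prop :=
  exists c : R, Hm_bound m u c.

(* kappa-parameterized functions are maps kappa |-> (s |-> u kappa s),
   only their values for kappa > 1 matter. *)
Definition Hk0 (R : realType) (m : nat) (u : R -> R -> R[i]) : Prop :=
  (forall k : R, 1 < k -> inHm m (u k)) /\
  exists c k0 : R, 0 < c /\ 0 < k0 /\
    forall k : R, 1 < k -> k0 <= k -> Hm_bound m (u k) c.

(* tilde H^m_{kappa,0}(I); the identity u = u0 + u1 e^{i k t} + u2 e^{-i k t}
   is an identity in L^2(I), i.e. a.e. on I. *)
Definition tHk0 (R : realType) (m : nat) (u : R -> R -> R[i]) : Prop :=
  exists u0 u1 u2 : R -> R -> R[i],
    Hk0 m u0 /\ Hk0 m u1 /\ Hk0 m u2 /\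
    forall k : R, 1 < k ->
      {ae (@lebesgue_measure R), forall t : R, Iset R t ->
         u k t = u0 k t + u1 k t * cexpi (k * t) + u2 k t * cexpi (- (k * t))}.

(* K \in C^{[m]}(I^2): there are functions Kd a b (standing for
   d_s^a d_t^b K), a, b <= m, continuous on I^2, with Kd 0 0 = K on I^2,
   Kd 0 (b+1) = d_t (Kd 0 b) and Kd (a+1) b = d_s (Kd a b); the derivatives
   are taken at interior points of I in the differentiated variable (at the
   endpoints the derivative is the continuous extension). *)
Definition Cm_sq (R : realType) (m : nat) (K : R -> R -> R[i]) : Prop :=
  exists Kd : nat -> nat -> R -> R -> R[i],
    (forall s t : R, Iset R s -> Iset R t -> Kd 0%N 0%N s t = K s t) /\
    (forall a b : nat, (a <= m)%N -> (b <= m)%N ->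
       {within Iset R `*` Iset R, continuous (fun p : (R * R)%type => complex.Re (Kd a b p.1 p.2))} /\
       {within Iset R `*` Iset R, continuous (fun p : (R * R)%type => complex.Im (Kd a b p.1 p.2))}) /\
    (forall b : nat, (b < m)%N -> forall s t : R, Iset R s -> Ioset R t ->
       is_derive t 1 (fun t' => complex.Re (Kd 0%N b s t')) (complex.Re (Kd 0%N b.+1 s t)) /\
       is_derive t 1 (fun t' => complex.Im (Kd 0%N b s t')) (complex.Im (Kd 0%N b.+1 s t))) /\
    (forall a b : nat, (a < m)%N -> (b <= m)%N -> forall s t : R, Ioset R s -> Iset R t ->
       is_derive s 1 (fun s' => complex.Re (Kd a b s' t)) (complex.Re (Kd a.+1 b s t)) /\
       is_derive s 1 (fun s' => complex.Im (Kd a b s' t)) (complex.Im (Kd a.+1 b s t))).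

Definition contI (R : realType) (y : R -> R[i]) : Prop :=
  {within Iset R, continuous (fun t => complex.Re (y t))} /\
  {within Iset R, continuous (fun t => complex.Im (y t))}.

Definition solves (R : realType) (K : R -> R -> R[i]) (k : R)
    (f y : R -> R[i]) : Prop :=
  forall s : R, Iset R s ->
    y s - CintI (fun t => K s t * cexpi (k * `|s - t|) * y t) = f s.

(* Main.v *)
(** Split the operator as V + W, integrating over t < s and over t > s. Conjugated by
    e^(i k s), resp. e^(-i k s), V and W become Volterra operators with the fixed
    kernel K, whereas the phases of V W do not cancel: one integration by parts gives
    V W = O(1/k). Hence (I - V)(I - W) y = f + V W y, and two Gronwall estimates bound
    y in L^1 uniformly for large k.

    Regularity is then bootstrapped one derivative at a time. If u = e^(-iks) y is a
    combination of 1, e^(-iks), e^(-2iks) with coefficients bounded in H^n, then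
    V0 u (s) = int_(-1)^s K(s,t) u(t) dt has derivative K(s,s) u + int K_s(s,t) u(t) dt,
    so everything reduces to the fact that integration sends such a combination to one
    with coefficients bounded in H^(n+1). For U in H^n and |x| = w >= 1 this means
    int e^(ixt) U = e^(ixs) P + Q with P, Q bounded in H^(n+1). Integrating by parts
    would lose derivatives; instead, one applies repeatedly the damped inverse
    N = (d/dt + w)^(-1), for which J g = c N g + (d/dt + ix)(c' N J g) with constants
    c, c'. The terms (d/dt + ix)(...) integrate to P exactly, and after n steps the
    remainder N^n g satisfies |(d/dt + ix)^j N^n g| <= C |g| in L^2 for j <= n, since
    w N is a contraction of L^2, so that it can be integrated directly into Q. *)
Require Import Defs.
From HB Require Import structures.
From mathcomp Require Import all_boot all_order all_algebra.
From mathcomp Require Import all_classical all_reals all_analysis.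
From mathcomp Require Import complex.
From mathcomp Require Import measurable_realfun ring lra.

Set Implicit Arguments.
Unset Strict Implicit.
Unset Printing Implicit Defensive.

Local Open Scope classical_set_scope.
Local Open Scope ring_scope.

(** * Integrals over I *)

Section RealIntegral.
Context {R : realType}.
Notation mu := (@lebesgue_measure R).
Implicit Types (u v w a : R -> R) (s t c : R).

(** Two extremes force the form of int e^(ixt) U. If U varies slowly, integration by parts leaves
    e^(ixs) times a smooth function; if U = w^(-n) e^(-ixt), which is still bounded in H^n, the
    phase cancels and the integral w^(-n) (s + 1) does not oscillate. So P has to absorb the part of
    U that is slow compared with w, and Q the fast part. Up to a constant factor the remainder N^n
    U^(n) is U with the symbol (i xi / (i xi + w))^n, which suppresses the slow part; and N, being
    built from a primitive from -1, works on an interval, where no Fourier transform is at hand.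
    Regularity is expressed through primitives: [u = d + J a], with [J] the primitive from -1,
    stands for u' = a, u(-1) = d, and the product rule [JRM] is a case of Fubini. Weak derivatives
    enter only in the translation from and to Sobolev norms, by the lemma of du Bois-Reymond.
    Uniformity in kappa comes from stating the Sobolev bounds for families over an arbitrary index
    type: a single point for one frequency, all large frequencies at once for the uniform bound. *)

Definition intI u : R := Rintegral mu (Iset R) u.
Definition MF u := measurable_fun (Iset R) u.
Definition L1 u := mu.-integrable (Iset R) (EFin \o u).
Definition aeI (P : R -> Prop) := {ae mu, forall t, Iset R t -> P t}.

Lemma IsetE s : Iset R s <-> -1 <= s <= 1.
Proof. by rewrite /Iset /= in_itv. Qed.

Lemma Iset_le s : Iset R s -> -1 <= s.
Proof. by move/IsetE/andP => []. Qed.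

Lemma Iset_ge s : Iset R s -> s <= 1.
Proof. by move/IsetE/andP => []. Qed.

Lemma IsetN1 : Iset R (-1).
Proof. by apply/IsetE; rewrite lexx; lra. Qed.

Lemma Iset1 : Iset R 1.
Proof. by apply/IsetE; rewrite lexx; lra. Qed.

Lemma mI : @measurable _ (measurableTypeR R) (Iset R).
Proof. exact: measurable_itv. Qed.

Lemma muI : mu (Iset R) = 2%:E.
Proof.
by rewrite /Iset lebesgue_measure_itv /= lte_fin ifT ?EFinN; [congr EFin|]; lra.
Qed.

Lemma muI_lty : (mu (Iset R) < +oo)%E.
Proof. by rewrite muI ltry. Qed.

Lemma L1_MF u : L1 u -> MF u.
Proof. by move=> /measurable_int /measurable_EFinP. Qed.

Lemma L1D u v : L1 u -> L1 v -> L1 (fun t => u t + v t).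
Proof. by move=> hu hv; exact: (integrableD mI hu hv). Qed.

Lemma L1Z c u : L1 u -> L1 (fun t => c * u t).
Proof. by move=> hu; exact: (integrableZl mI c hu). Qed.

Lemma L1N u : L1 u -> L1 (fun t => - u t).
Proof. by move=> hu; exact: (integrableN hu). Qed.

Lemma L1B u v : L1 u -> L1 v -> L1 (fun t => u t - v t).
Proof. by move=> hu hv; apply: L1D => //; exact: L1N. Qed.

Lemma L1_le u v : MF u -> L1 v -> (forall t, Iset R t -> `|u t| <= v t) -> L1 u.
Proof.
move=> mu_ iv uv; apply: le_integrable iv => //; first exact: mI.
  exact/measurable_EFinP.
move=> x Ix /=; rewrite lee_fin; apply: le_trans (uv _ Ix) _; exact: ler_norm.
Qed.

Lemma L1abs u : L1 u -> L1 (fun t => `|u t|).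
Proof. exact: integrable_norm. Qed.

Lemma L1cst c : L1 (fun=> c).
Proof.
apply: measurable_bounded_integrable; first exact: mI.
- exact: muI_lty.
- exact: measurable_cst.
- by exists `|c|; split => // x ltx t It /=; exact: ltW.
Qed.

Lemma L1_bdd u c : MF u -> (forall t, Iset R t -> `|u t| <= c) -> L1 u.
Proof. by move=> mu_ uc; apply: (L1_le mu_ (L1cst c)). Qed.

Lemma L1M a u c : MF a -> (forall t, Iset R t -> `|a t| <= c) -> L1 u ->
  L1 (fun t => a t * u t).
Proof.
move=> ma ac iu; apply: (@L1_le _ (fun t => c * `|u t|)).
- by apply: measurable_funM => //; exact: L1_MF.
- by apply: L1Z; exact: L1abs.
- by move=> t It; rewrite normrM ler_wpM2r// ac.
Qed.

Lemma intID u v : L1 u -> L1 v -> intI (fun t => u t + v t) = intI u + intI v.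
Proof. by move=> hu hv; exact: (RintegralD mI hu hv). Qed.

Lemma intIB u v : L1 u -> L1 v -> intI (fun t => u t - v t) = intI u - intI v.
Proof. by move=> hu hv; exact: (RintegralB mI hu hv). Qed.

Lemma intIZ c u : L1 u -> intI (fun t => c * u t) = c * intI u.
Proof. by move=> hu; exact: (RintegralZl c mI hu). Qed.

Lemma intI_le u v : L1 u -> L1 v -> (forall t, Iset R t -> u t <= v t) ->
  intI u <= intI v.
Proof. by move=> hu hv; exact: (le_Rintegral mI hu hv). Qed.

Lemma intI_ge0 u : (forall t, Iset R t -> 0 <= u t) -> 0 <= intI u.
Proof. by move=> h; exact: (@Rintegral_ge0 _ _ _ mu). Qed.

Lemma intI_abs u : L1 u -> `|intI u| <= intI (fun t => `|u t|).
Proof. by move=> hu; exact: (le_normr_Rintegral mI hu). Qed.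

Lemma eq_intI u v : (forall t, Iset R t -> u t = v t) -> intI u = intI v.
Proof. by move=> uv; apply: eq_Rintegral => t /[!inE]; exact: uv. Qed.

Lemma intI_cst c : intI (fun=> c) = 2 * c.
Proof.
have h : intI (fun=> c) = c * fine (mu (Iset R)) by exact: (Rintegral_cst mu mI).
by rewrite h muI mulrC.
Qed.

Lemma eq_L1 u v : (forall t, Iset R t -> u t = v t) -> L1 u -> L1 v.
Proof.
move=> uv; apply: (eq_integrable mI (EFin \o u)).
by move=> t /[!inE] It /=; rewrite uv.
Qed.

Lemma eq_MF u v : (forall t, Iset R t -> u t = v t) -> MF u -> MF v.
Proof. by move=> uv; apply: eq_measurable_fun => t /[!inE]; exact: uv. Qed.

Lemma aeIW (P : R -> Prop) : (forall t, Iset R t -> P t) -> aeI P.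
Proof. by move=> h; exact: (@filterE _ _ (ae_filter_ringOfSetsType mu)). Qed.

Lemma aeI_mp (P Q : R -> Prop) : (forall t, Iset R t -> P t -> Q t) ->
  aeI P -> aeI Q.
Proof.
move=> PQ; apply: (@filterS _ _ (ae_filter_ringOfSetsType mu)) => t Pt It.
exact: PQ (Pt It).
Qed.

Lemma aeI_and (P Q : R -> Prop) : aeI P -> aeI Q -> aeI (fun t => P t /\ Q t).
Proof.
move=> hP hQ; have := @filterI _ _ (ae_filter_ringOfSetsType mu) _ _ hP hQ.
by apply: (@filterS _ _ (ae_filter_ringOfSetsType mu)) => t [a b] It; split; [exact: a|exact: b].
Qed.

Lemma ae_eq_intI u v : MF u -> MF v -> aeI (fun t => u t = v t) -> intI u = intI v.
Proof.
move=> hu hv uv; congr fine; apply: ae_eq_integral => //.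
- exact: mI.
- exact/measurable_EFinP.
- exact/measurable_EFinP.
- by apply: (aeI_mp _ uv) => t It /= ->.
Qed.

Lemma ae_eq_L1 u v : MF v -> aeI (fun t => u t = v t) -> L1 u -> L1 v.
Proof.
move=> mv uv iu; apply/integrableP; split; first exact/measurable_EFinP.
have/integrableP[mu_ ltoo] := iu.
rewrite (_ : (\int[mu]_(x in Iset R) _)%E = (\int[mu]_(x in Iset R) `|(EFin \o u) x|)%E)//.
apply: ae_eq_integral => //.
- exact: mI.
- by apply: measurableT_comp => //; exact/measurable_EFinP.
- by apply: measurableT_comp.
- by apply: (aeI_mp _ uv) => t It /= ->.
Qed.

Lemma ae_pt s : aeI (fun t => t != s).
Proof.
exists [set s]; split; [exact: measurable_set1|by rewrite lebesgue_measure_set1|].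
move=> t /= h; apply/eqP/negbNE/negP => ts; apply: h => _; exact: ts.
Qed.

Lemma intI0_ae u : L1 u -> (forall t, Iset R t -> 0 <= u t) -> intI u = 0 ->
  aeI (fun t => u t = 0).
Proof.
move=> iu u0 u00.
have : (\int[mu]_(x in Iset R) `|(EFin \o u) x| = 0)%E.
  transitivity (\int[mu]_(x in Iset R) (EFin \o u) x)%E.
    by apply: eq_integral => x /[!inE] Ix /=; rewrite ger0_norm// u0.
  by rewrite -(fineK (integrable_fin_num mI iu)) -[fine _]/(intI u) u00.
have /measurable_EFinP mu_ := L1_MF iu.
by move/(ae_eq_integral_abs mu mI mu_); apply: aeI_mp => t It /= [].
Qed.
End RealIntegral.

(** * Fubini *)

Section RealFubini.
Context {R : realType}.
Notation mu := (@lebesgue_measure R).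
Implicit Types (u v w a : R -> R) (s t c : R) (k : R -> R -> R).

(** Measurability is asked on the whole plane, and so are the bounds on kernels; [clamp] later
    extends the kernels beyond I x I in such a way that both hold. *)
Definition MF2 k := @measurable_fun _ _ (measurableTypeR R * measurableTypeR R)%type R
  setT (fun p => k p.1 p.2).

Lemma EFin_intI u : L1 u -> (\int[mu]_x ((u \_ (Iset R)) x)%:E)%E = (intI u)%:E.
Proof.
move=> iu.
have <- : (\int[mu]_(x in Iset R) (u x)%:E)%E = (intI u)%:E.
  by rewrite -(fineK (integrable_fin_num mI iu)).
rewrite [RHS]integral_mkcond; by apply: eq_integral => x _; rewrite !patchE; case: ifP.
Qed.

Lemma MF_restrict u : MF u ->
  @measurable_fun _ _ (measurableTypeR R) R setT (u \_ (Iset R)).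
Proof. by move=> hu; apply/(measurable_restrictT _ mI). Qed.

Lemma MF2_section k : MF2 k -> forall r, MF (k r).
Proof.
move=> hk r; apply: (@measurable_funS _ _ _ _ setT) => //.
exact: (measurableT_comp hk (pair1_measurable r)).
Qed.

Lemma MF2_swap k : MF2 k -> MF2 (fun r t => k t r).
Proof.
move=> hk.
have h : @measurable_fun _ _ (measurableTypeR R * measurableTypeR R)%type
    (measurableTypeR R * measurableTypeR R)%type setT (fun p => (p.2, p.1)).
  by apply: measurable_fun_pair; [exact: measurable_snd|exact: measurable_fst].
exact: (measurableT_comp hk h).
Qed.

Variables (k : R -> R -> R) (M : R) (u w : R -> R).
Hypotheses (mk : MF2 k) (kM : forall r t, `|k r t| <= M) (iu : L1 u) (iw : L1 w).

Let F (p : measurableTypeR R * measurableTypeR R) : \bar R :=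
  ((w \_ (Iset R)) p.1 * k p.1 p.2 * (u \_ (Iset R)) p.2)%:E.

Let mF : measurable_fun setT F.
Proof.
apply/measurable_EFinP; apply: measurable_funM.
  apply: measurable_funM => //.
  exact: (measurableT_comp (MF_restrict (L1_MF iw)) measurable_fst).
exact: (measurableT_comp (MF_restrict (L1_MF iu)) measurable_snd).
Qed.

Let M0 : 0 <= M.
Proof. exact: le_trans (normr_ge0 _) (kM 0 0). Qed.

Let L1ku r : L1 (fun t => k r t * u t).
Proof. by apply: (L1M (c := M)) => //; exact: MF2_section. Qed.

Let L1kw t : L1 (fun r => k r t * w r).
Proof. by apply: (L1M (c := M)) => //; exact: (MF2_section (MF2_swap mk)). Qed.

Let iF : (mu \x mu)%E.-integrable setT F.
Proof.
apply/integrable12ltyP => //.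
(* Tonelli: [h], extended by zero, dominates the inner integral of |F| because |k| <= M. *)
pose h r := (M * intI (fun t => `|u t|)) * `|w r|.
have ih : L1 h by apply: L1Z; exact: L1abs.
apply: (@le_lt_trans _ _ (\int[mu]_x ((h \_ (Iset R)) x)%:E)%E); last first.
  by rewrite EFin_intI// ltry.
apply: ge0_le_integral => //.
- by move=> x _; exact: integral_ge0.
- apply: (measurable_fun_fubini_tonelli_F (abse \o F)) => //.
    exact: measurableT_comp.
  by move=> z; exact: abse_ge0.
- by apply/measurable_EFinP; apply: MF_restrict; exact: L1_MF.
move=> x _.
pose wx := (w \_ (Iset R)) x.
have iku : L1 (fun t => `|wx| * `|k x t * u t|) by apply: L1Z; exact: L1abs.
rewrite (_ : (\int[mu]_y _)%E =
    (\int[mu]_y (((fun t => `|wx| * `|k x t * u t|) \_ (Iset R)) y)%:E)%E); last first.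
  apply: eq_integral => y _; rewrite /F /= -/wx patchE [in RHS]patchE.
  by case: ifP => _; rewrite ?mulr0 ?normr0// -mulrA normrM.
rewrite EFin_intI// lee_fin intIZ; last exact: L1abs.
have -> : (h \_ (Iset R)) x = (M * intI (fun t => `|u t|)) * `|wx|.
  by rewrite /wx !patchE; case: ifP => _; rewrite ?normr0 ?mulr0.
rewrite mulrC ler_wpM2r// -intIZ; last exact: L1abs.
apply: intI_le => [||t It]; [exact: L1abs|by apply: L1Z; exact: L1abs|].
by rewrite normrM ler_wpM2r.
Qed.

Let innerE r : (\int[mu]_y F (r, y))%E =
  (((fun r => w r * intI (fun t => k r t * u t)) \_ (Iset R)) r)%:E.
Proof.
pose wr := (w \_ (Iset R)) r.
rewrite (_ : (\int[mu]_y _)%E =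
    (\int[mu]_y (((fun t => wr * (k r t * u t)) \_ (Iset R)) y)%:E)%E); last first.
  apply: eq_integral => y _; rewrite /F /= -/wr patchE [in RHS]patchE.
  by case: ifP => _; rewrite ?mulr0// -mulrA.
rewrite EFin_intI; last exact: L1Z.
by rewrite intIZ// /wr !patchE; case: ifP => _; rewrite ?mul0r.
Qed.

Let innerE' t : (\int[mu]_x F (x, t))%E =
  (((fun t => u t * intI (fun r => k r t * w r)) \_ (Iset R)) t)%:E.
Proof.
pose ut := (u \_ (Iset R)) t.
rewrite (_ : (\int[mu]_x _)%E =
    (\int[mu]_x (((fun r => ut * (k r t * w r)) \_ (Iset R)) x)%:E)%E); last first.
  apply: eq_integral => x _; rewrite /F /= -/ut patchE [in RHS]patchE.
  by case: ifP => _; [congr (_%:E); ring|rewrite !mul0r].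
rewrite EFin_intI; last exact: L1Z.
by rewrite intIZ// /ut !patchE; case: ifP => _; rewrite ?mul0r.
Qed.

(** With [w = 1] this is also the source of the measurability of integrals in their parameter
    [r]. *)
Lemma L1_inner : L1 (fun r => w r * intI (fun t => k r t * u t)).
Proof.
apply/(integrable_mkcond _ mI); have := integrable_fubini_F iF.
apply: (eq_integrable measurableT) => r _; rewrite /fubini_F innerE.
by rewrite !patchE; case: ifP.
Qed.

Lemma intI_fubini : intI (fun r => w r * intI (fun t => k r t * u t)) =
  intI (fun t => u t * intI (fun r => k r t * w r)).
Proof.
have := Fubini iF.
under eq_integral do rewrite innerE.
under [in RHS]eq_integral do rewrite innerE'.
rewrite /intI => h; congr fine; rewrite [LHS]integral_mkcond [RHS]integral_mkcond.
rewrite (_ : (\int[_]_x _)%E = (\int[mu]_x (((fun r => w r * intI (fun t => k r t * u t)) \_ (Iset R)) x)%:E)%E); last first.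
  by apply: eq_integral => x _; rewrite !patchE; case: ifP.
by rewrite h; apply: eq_integral => x _; rewrite !patchE; case: ifP.
Qed.
End RealFubini.

(** * Primitives from -1 *)

Section RealPrimitive.
Context {R : realType}.
Notation mu := (@lebesgue_measure R).
Implicit Types (u v w a : R -> R) (s t c M : R) (k : R -> R -> R).

(** The primitive is an integral over all of I against a bounded kernel, so that Fubini applies to
    it unchanged. To the left of I, [JR u] is 0, and to the right it is constant. *)
Definition ind s t : R := (t <= s)%R%:R.
Definition JR u s : R := intI (fun t => ind s t * u t).

Lemma ind_le1 s t : `|ind s t| <= 1.
Proof. by rewrite /ind; case: (t <= s); rewrite ?normr1 ?normr0. Qed.

Lemma MF2_ind : MF2 ind.
Proof.
have h : @measurable_fun _ _ (measurableTypeR R * measurableTypeR R)%type bool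
    setT (fun p => p.2 <= p.1 :> R).
  by apply: measurable_fun_ler; [exact: measurable_snd|exact: measurable_fst].
rewrite /MF2 (_ : (fun p => _) = (fun p => if p.2 <= p.1 :> R then 1 else 0)); last first.
  by apply/funext => p; rewrite /ind; case: (p.2 <= p.1).
by apply: measurable_fun_ifT.
Qed.

Lemma MF_ind s : MF (ind s).
Proof. exact: (MF2_section MF2_ind). Qed.

Lemma MF2M k k' : MF2 k -> MF2 k' -> MF2 (fun r t => k r t * k' r t).
Proof. by move=> h h'; exact: measurable_funM. Qed.

Lemma L1_ind s u : L1 u -> L1 (fun t => ind s t * u t).
Proof. by apply: (L1M (c := 1)) => [|t _]; [exact: MF_ind|exact: ind_le1]. Qed.

Lemma eq_JR u v s : (forall t, Iset R t -> u t = v t) -> JR u s = JR v s.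
Proof. by move=> uv; apply: eq_intI => t It; rewrite uv. Qed.

Lemma ae_eq_JR u v s : MF u -> MF v -> aeI (fun t => u t = v t) -> JR u s = JR v s.
Proof.
move=> hu hv uv; apply: ae_eq_intI.
- by apply: measurable_funM => //; exact: MF_ind.
- by apply: measurable_funM => //; exact: MF_ind.
- by apply: (aeI_mp _ uv) => t It ->.
Qed.

Lemma JRD u v s : L1 u -> L1 v -> JR (fun t => u t + v t) s = JR u s + JR v s.
Proof.
move=> hu hv; rewrite /JR -intID; [|exact: L1_ind|exact: L1_ind].
by apply: eq_intI => t _; rewrite mulrDr.
Qed.

Lemma JRZ c u s : L1 u -> JR (fun t => c * u t) s = c * JR u s.
Proof.
move=> hu; rewrite /JR -intIZ; last exact: L1_ind.
by apply: eq_intI => t _; rewrite mulrCA.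
Qed.

Lemma JRN u s : L1 u -> JR (fun t => - u t) s = - JR u s.
Proof. by move=> hu; rewrite -mulN1r -JRZ//; apply: eq_JR => t _; rewrite mulN1r. Qed.

Lemma JRB u v s : L1 u -> L1 v -> JR (fun t => u t - v t) s = JR u s - JR v s.
Proof. by move=> hu hv; rewrite JRD//; [rewrite JRN|exact: L1N]. Qed.

Lemma JR_N1 u : L1 u -> JR u (-1) = 0.
Proof.
move=> hu; rewrite /JR (@ae_eq_intI _ _ (fun=> 0)); first by rewrite intI_cst mulr0.
- by apply: L1_MF; exact: L1_ind.
- exact: measurable_cst.
- apply: (aeI_mp _ (ae_pt (-1))) => t /Iset_le t1 tN1.
  by rewrite /ind leNgt lt_neqAle eq_sym tN1 t1 mul0r.
Qed.

Lemma JR_1 u : JR u 1 = intI u.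
Proof. by apply: eq_intI => t /Iset_ge t1; rewrite /ind t1 mul1r. Qed.

Lemma JR_le u v s : L1 u -> L1 v -> (forall t, Iset R t -> u t <= v t) ->
  JR u s <= JR v s.
Proof.
move=> hu hv uv; apply: intI_le; [exact: L1_ind|exact: L1_ind|move=> t It].
by rewrite ler_wpM2l ?uv// ler0n.
Qed.

Lemma JR_ge0 u s : (forall t, Iset R t -> 0 <= u t) -> 0 <= JR u s.
Proof. by move=> u0; apply: intI_ge0 => t It; rewrite mulr_ge0 ?u0// ler0n. Qed.

Lemma JR_abs u s : L1 u -> `|JR u s| <= JR (fun t => `|u t|) s.
Proof.
move=> hu; apply: le_trans (intI_abs _) _; first exact: L1_ind.
rewrite le_eqVlt; apply/orP; left; apply/eqP/eq_intI => t _.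
by rewrite normrM [`|ind _ _|]ger0_norm// ler0n.
Qed.

Lemma JR_le_intI u s : L1 u -> (forall t, Iset R t -> 0 <= u t) -> JR u s <= intI u.
Proof.
move=> hu u0; apply: intI_le => //; first exact: L1_ind.
move=> t It; rewrite /ind; case: (t <= s); rewrite ?mul1r ?mul0r//; exact: u0.
Qed.

Lemma JR_abs_le u s : L1 u -> `|JR u s| <= intI (fun t => `|u t|).
Proof.
move=> hu; apply: le_trans (JR_abs _ hu) _; apply: JR_le_intI => //.
exact: L1abs.
Qed.

Lemma MF_inner k M u : MF2 k -> (forall r t, `|k r t| <= M) -> L1 u ->
  MF (fun r => intI (fun t => k r t * u t)).
Proof.
move=> mk kM hu; apply: L1_MF.
apply: eq_L1 (L1_inner mk kM hu (L1cst 1)) => r _; exact: mul1r.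
Qed.

Lemma MF_JR u : L1 u -> MF (JR u).
Proof. by move=> hu; exact: (MF_inner MF2_ind ind_le1 hu). Qed.

Lemma L1_JR u : L1 u -> L1 (JR u).
Proof.
by move=> hu; apply: L1_bdd; [exact: MF_JR|move=> t _; exact: JR_abs_le].
Qed.

Lemma JR_cst c s : Iset R s -> JR (fun=> c) s = c * (s + 1).
Proof.
move=> Is.
have h : JR (fun=> 1) s = s + 1.
  rewrite /JR (@eq_intI _ _ (\1_`[-1, s] : R -> R)); last first.
    move=> t It; rewrite mulr1 /ind indicE mem_setE in_itv /=.
    by rewrite (Iset_le It).
  rewrite /intI /Rintegral integral_indic; [|exact: mI|exact: measurable_itv].
  have sI : `[-1, s] `<=` Iset R.
    move=> t /=; rewrite in_itv /= => /andP[t1 ts]; apply/IsetE.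
    by rewrite t1 (le_trans ts)// Iset_ge.
  rewrite (setIidl sI) (_ : fine _ = fine (mu `[-1, s]))//.
  rewrite lebesgue_measure_itv /= lte_fin.
  have := Iset_le Is; rewrite le_eqVlt => /predU1P[<-|->].
    by rewrite ltxx /=; lra.
  by rewrite -EFinB /= opprK.
rewrite -h -JRZ; last exact: L1cst.
by apply: eq_JR => t _; rewrite mulr1.
Qed.

(** Either side integrates [g] from t to s if t <= s and vanishes otherwise; the integrands differ
    at r = t only, a null set. *)
Lemma intI_ind_ind g s t : L1 g -> 
  intI (fun r => ind r t * (ind s r * g r)) = ind s t * (JR g s - JR g t).
Proof.
move=> hg; rewrite /JR -intIB; [|exact: L1_ind|exact: L1_ind].
rewrite -intIZ; last by apply: L1B; exact: L1_ind.
have hm : MF (fun r => ind r t) by exact: (MF2_section (MF2_swap MF2_ind)).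
apply: ae_eq_intI.
- apply: measurable_funM => //; apply: L1_MF; exact: L1_ind.
- by apply: L1_MF; apply: L1Z; apply: L1B; exact: L1_ind.
apply: (aeI_mp _ (ae_pt t)) => r Ir; rewrite -mulrBl mulrA [in RHS]mulrA => rt.
congr (_ * _); rewrite /ind.
case: (ltgtP r t) rt => // rt _; case: (lerP r s) => rs; case: (lerP t s) => ts;
  rewrite ?(mulr0, mul0r, mulr1, mul1r, subr0, subrr)//; lra.
Qed.

(** Integration by parts without derivatives: the square [-1, s]^2 is cut along its diagonal, and
    Fubini exchanges the order of integration over one of the two triangles. *)
Lemma JRM u v s : L1 u -> L1 v ->
  JR u s * JR v s = JR (fun t => u t * JR v t + JR u t * v t) s.
Proof.
move=> hu hv.
have huv : L1 (fun t => u t * JR v t).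
  apply: (eq_L1 (u := fun t => JR v t * u t)) => [t _|]; first exact: mulrC.
  apply: L1M (MF_JR hv) _ hu => t _; exact: JR_abs_le.
have hvu : L1 (fun t => JR u t * v t).
  by apply: L1M (MF_JR hu) _ hv => t _; exact: JR_abs_le.
rewrite JRD//; suff -> : JR (fun t => u t * JR v t) s =
    JR u s * JR v s - JR (fun t => JR u t * v t) s by ring.
have := intI_fubini MF2_ind ind_le1 hv (L1_ind s hu).
rewrite (_ : intI _ = JR (fun t => u t * JR v t) s); last first.
  by apply: eq_intI => t _; rewrite mulrA.
move=> ->; rewrite -JRZ// -JRB//; last exact: L1Z.
apply: eq_intI => t _; rewrite intI_ind_ind//; ring.
Qed.

(** * Differentiation of integral operators in the outer variable *)

Section Kernels.
Variables (k k' : R -> R -> R) (M : R).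
Hypotheses (mk : MF2 k) (mk' : MF2 k').
Hypotheses (kM : forall r t, `|k r t| <= M) (k'M : forall r t, `|k' r t| <= M).
Hypothesis kk' : forall s t, Iset R s -> Iset R t ->
  k s t = k (-1) t + JR (fun r => k' r t) s.

Let L1k' t : L1 (fun r => k' r t).
Proof. by apply: L1_bdd => //; exact: (MF2_section (MF2_swap mk')). Qed.

Let L1k s u : L1 u -> L1 (fun t => k s t * u t).
Proof. by apply: (L1M (c := M)) => //; exact: MF2_section. Qed.

Lemma fredholm_primitive u s : L1 u -> Iset R s ->
  intI (fun t => k s t * u t) =
  intI (fun t => k (-1) t * u t) + JR (fun r => intI (fun t => k' r t * u t)) s.
Proof.
move=> hu Is.
rewrite /JR (intI_fubini mk' k'M hu (L1_bdd (MF_ind s) (fun t _ => ind_le1 s t))).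
rewrite (@eq_intI _ (fun t => u t * _) (fun t => k s t * u t - k (-1) t * u t)).
  by rewrite intIB; [ring|exact: L1k|exact: L1k].
move=> t It; rewrite kk'// (_ : intI _ = JR (fun r => k' r t) s); first by ring.
by apply: eq_intI => r _; rewrite mulrC.
Qed.

Let indk'M r t : `|ind r t * k' r t| <= M.
Proof.
by rewrite normrM -[leRHS]mul1r ler_pM// ind_le1.
Qed.

Lemma MF_diag : MF (fun r => k r r).
Proof.
have h : @measurable_fun _ _ (measurableTypeR R)
    (measurableTypeR R * measurableTypeR R)%type setT (fun p => (p, p)).
  by apply: measurable_fun_pair; exact: measurable_id.
apply: (@measurable_funS _ _ _ _ setT) => //.
exact: (measurableT_comp mk h).
Qed.

Lemma MF_volterra u : L1 u -> MF (fun r => intI (fun t => ind r t * k' r t * u t)).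
Proof.
exact: (MF_inner (MF2M MF2_ind mk') indk'M).
Qed.

Lemma volterra_bdd u s : L1 u ->
  `|intI (fun t => ind s t * k' s t * u t)| <= M * intI (fun t => `|u t|).
Proof.
move=> hu.
have hk : L1 (fun t => ind s t * k' s t * u t).
  by apply: (L1M (c := M)) => //; exact: (MF2_section (MF2M MF2_ind mk')).
apply: le_trans (intI_abs hk) _; rewrite -intIZ; last exact: L1abs.
apply: intI_le => [||t It]; [exact: L1abs|by apply: L1Z; exact: L1abs|].
by rewrite normrM ler_wpM2r.
Qed.

(** Leibniz' rule in integrated form. By Fubini the primitive of the inner Volterra integral is the
    integral of u(t) (k(s,t) - k(t,t)) over t <= s, and the diagonal term, due to the moving end
    point, restores k(s,t). *)
Lemma volterra_primitive u s : L1 u -> Iset R s ->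
  intI (fun t => ind s t * k s t * u t) =
  JR (fun r => k r r * u r + intI (fun t => ind r t * k' r t * u t)) s.
Proof.
move=> hu Is.
have hd : L1 (fun r => k r r * u r) by apply: (L1M (c := M)) => //; exact: MF_diag.
rewrite JRD//; last first.
  apply: L1_bdd; first exact: MF_volterra.
  by move=> t _; exact: volterra_bdd.
rewrite [X in _ = _ + X]/JR (intI_fubini (MF2M MF2_ind mk') indk'M hu
  (L1_bdd (MF_ind s) (fun t _ => ind_le1 s t))).
rewrite (@eq_intI _ (fun t => u t * _) (fun t => ind s t * k s t * u t - ind s t * (k t t * u t))).
  rewrite intIB; [by rewrite /JR; ring| |exact: L1_ind].
  apply: (eq_L1 (u := fun t => ind s t * (k s t * u t))); first by move=> *; ring.
  by apply: L1_ind; exact: L1k.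
move=> t It; rewrite (@eq_intI _ _ (fun r => ind r t * (ind s r * k' r t))); last first.
  by move=> r _; ring.
rewrite intI_ind_ind// (kk' Is It) (kk' It It); ring.
Qed.
End Kernels.
End RealPrimitive.

(** * Complex-valued functions *)

Section ComplexIntegral.
Context {R : realType}.
Local Notation Re := complex.Re.
Local Notation Im := complex.Im.
Implicit Types (u v w a g : R -> R[i]) (s t c M : R) (z : R[i]) (k : R -> R -> R[i]).

Lemma ReD z1 z2 : Re (z1 + z2 : R[i]) = Re z1 + Re z2. Proof. by case: z1 z2 => ? ? []. Qed.
Lemma ImD z1 z2 : Im (z1 + z2 : R[i]) = Im z1 + Im z2. Proof. by case: z1 z2 => ? ? []. Qed.
Lemma ReN z : Re (- z : R[i]) = - Re z. Proof. by case: z. Qed.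
Lemma ImN z : Im (- z : R[i]) = - Im z. Proof. by case: z. Qed.
Lemma ReM z1 z2 : Re (z1 * z2 : R[i]) = Re z1 * Re z2 - Im z1 * Im z2.
Proof. by case: z1 z2 => ? ? []. Qed.
Lemma ImM z1 z2 : Im (z1 * z2 : R[i]) = Re z1 * Im z2 + Im z1 * Re z2.
Proof. by case: z1 z2 => ? ? []. Qed.
Definition ReIm := (ReD, ImD, ReN, ImN, ReM, ImM).

Lemma complex_ext z1 z2 : Re z1 = Re z2 -> Im z1 = Im z2 -> z1 = z2 :> R[i].
Proof. by case: z1 z2 => ? ? [? ?] /= -> ->. Qed.

(** This norm is still submultiplicative, and its bounds reduce to real absolute values of the two
    components. The price is that a phase has norm at most 2 instead of 1, which is the origin of
    many constants below. *)
Definition n1 z : R := `|Re z| + `|Im z|.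

Lemma n1_ge0 z : 0 <= n1 z. Proof. by rewrite addr_ge0. Qed.
Lemma n1N z : n1 (- z) = n1 z. Proof. by rewrite /n1 !ReIm !normrN. Qed.
Lemma n1D z1 z2 : n1 (z1 + z2) <= n1 z1 + n1 z2.
Proof. by rewrite /n1 !ReIm addrACA lerD// ler_normD. Qed.
Lemma n1B z1 z2 : n1 (z1 - z2) <= n1 z1 + n1 z2.
Proof. by rewrite -[n1 z2]n1N n1D. Qed.
Lemma n1M z1 z2 : n1 (z1 * z2) <= n1 z1 * n1 z2.
Proof.
rewrite /n1 !ReIm; apply: le_trans (lerD (ler_normB _ _) (ler_normD _ _)) _.
by rewrite !normrM; lra.
Qed.
Lemma Re_n1 z : `|Re z| <= n1 z. Proof. by rewrite lerDl. Qed.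
Lemma Im_n1 z : `|Im z| <= n1 z. Proof. by rewrite lerDr. Qed.
Lemma n1_real (x : R) : n1 x%:C%C = `|x|.
Proof. by rewrite /n1 /= normr0 addr0. Qed.

Lemma sqmodM z1 z2 : sqmod (z1 * z2) = sqmod z1 * sqmod z2.
Proof. by rewrite /sqmod !ReIm; ring. Qed.
Lemma sqmod_ge0 z : 0 <= sqmod z.
Proof. by rewrite addr_ge0// sqr_ge0. Qed.
Lemma sqmodD z1 z2 : sqmod (z1 + z2) <= 2 * sqmod z1 + 2 * sqmod z2.
Proof.
rewrite /sqmod !ReIm -subr_ge0.
rewrite (_ : _ - _ = (Re z1 - Re z2) ^+ 2 + (Im z1 - Im z2) ^+ 2); last by ring.
by rewrite addr_ge0// sqr_ge0.
Qed.
Lemma sqmod_n1 z : sqmod z <= n1 z ^+ 2.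
Proof.
rewrite /sqmod /n1 sqrrD !real_normK ?num_real//.
by rewrite lerD2r lerDl mulrn_wge0// mulr_ge0.
Qed.
(** From x <= x^2 + 1/4 for each component. It replaces the Cauchy-Schwarz inequality in passing
    from L^2 to L^1 on the bounded interval. *)
Lemma n1_sqmod z : n1 z <= 1 + sqmod z.
Proof.
rewrite /sqmod /n1 -(real_normK (num_real (Re z))) -(real_normK (num_real (Im z))).
set x := `|_|; set y := `|_|.
have := sqr_ge0 (x - 2^-1); have := sqr_ge0 (y - 2^-1); lra.
Qed.

Lemma cexpiD s t : cexpi (s + t) = cexpi s * cexpi t :> R[i].
Proof. by apply: complex_ext; rewrite !ReIm /= ?cosD ?sinD; ring. Qed.
Lemma cexpi0 : cexpi 0 = 1 :> R[i].
Proof. by rewrite /cexpi cos0 sin0. Qed.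
Lemma cexpiN s : cexpi s * cexpi (- s) = 1 :> R[i].
Proof. by rewrite -cexpiD subrr cexpi0. Qed.
Lemma n1_cexpi s : n1 (cexpi s) <= 2.
Proof. by rewrite /n1 /= (_ : 2 = 1 + 1)// lerD// ler_norml ?cos_geN1 ?cos_le1 ?sin_geN1 ?sin_le1. Qed.

Definition CMF u := MF (fun t => Re (u t)) /\ MF (fun t => Im (u t)).
Definition CL1 u := L1 (fun t => Re (u t)) /\ L1 (fun t => Im (u t)).
Definition J u s : R[i] := (JR (fun t => Re (u t)) s +i* JR (fun t => Im (u t)) s)%C.
Definition nI u : R := intI (fun t => n1 (u t)).

Lemma CL1_CMF u : CL1 u -> CMF u.
Proof. by move=> [h1 h2]; split; exact: L1_MF. Qed.

Lemma CMFD u v : CMF u -> CMF v -> CMF (fun t => u t + v t).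
Proof.
move=> [u1 u2] [v1 v2]; split; under eq_fun do rewrite !ReIm; exact: measurable_funD.
Qed.

Lemma CMFM u v : CMF u -> CMF v -> CMF (fun t => u t * v t).
Proof.
move=> [u1 u2] [v1 v2]; split; under eq_fun do rewrite !ReIm.
  by apply: measurable_funB; exact: measurable_funM.
by apply: measurable_funD; exact: measurable_funM.
Qed.

Lemma CMF_cst z : CMF (fun=> z).
Proof. by split; exact: measurable_cst. Qed.

Lemma CMF_cexpi c : CMF (fun t => cexpi (c * t)).
Proof.
have h : MF (fun t => c * t) by apply: measurable_funM => //; exact: measurable_id.
by split; apply: (measurableT_comp _ h); apply: continuous_measurable_fun;
  [exact: continuous_cos|exact: continuous_sin].
Qed.

Lemma MF_n1 u : CMF u -> MF (fun t => n1 (u t)).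
Proof. by move=> [h1 h2]; apply: measurable_funD; exact: measurableT_comp. Qed.

Lemma MF_sqmod u : CMF u -> MF (fun t => sqmod (u t)).
Proof. by move=> [h1 h2]; apply: measurable_funD; exact: measurable_funX. Qed.

Lemma L1_n1 u : CL1 u -> L1 (fun t => n1 (u t)).
Proof. by move=> [h1 h2]; apply: L1D; exact: L1abs. Qed.

Lemma CL1_le u (v : R -> R) : CMF u -> L1 v -> (forall t, Iset R t -> n1 (u t) <= v t) -> CL1 u.
Proof.
move=> [u1 u2] hv uv; split; apply: L1_le hv _ => // t It;
  apply: le_trans (uv t It); [exact: Re_n1|exact: Im_n1].
Qed.

Lemma CL1_bdd u c : CMF u -> (forall t, Iset R t -> n1 (u t) <= c) -> CL1 u.
Proof. by move=> hu; exact: CL1_le (L1cst c). Qed.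

Lemma CL1D u v : CL1 u -> CL1 v -> CL1 (fun t => u t + v t).
Proof. by move=> [u1 u2] [v1 v2]; split; under eq_fun do rewrite !ReIm; exact: L1D. Qed.

Lemma CL1N u : CL1 u -> CL1 (fun t => - u t).
Proof. by move=> [u1 u2]; split; under eq_fun do rewrite !ReIm; exact: L1N. Qed.

Lemma CL1B u v : CL1 u -> CL1 v -> CL1 (fun t => u t - v t).
Proof. by move=> hu hv; apply: CL1D => //; exact: CL1N. Qed.

Lemma CL1M a u c : CMF a -> (forall t, Iset R t -> n1 (a t) <= c) -> CL1 u ->
  CL1 (fun t => a t * u t).
Proof.
move=> ha ac hu; apply: (@CL1_le _ (fun t => c * n1 (u t))).
- by apply: CMFM => //; exact: CL1_CMF.
- by apply: L1Z; exact: L1_n1.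
- by move=> t It; apply: le_trans (n1M _ _) _; rewrite ler_wpM2r ?n1_ge0 ?ac.
Qed.

Lemma CL1Z z u : CL1 u -> CL1 (fun t => z * u t).
Proof. by apply: (CL1M (c := n1 z)) => //; exact: CMF_cst. Qed.

Lemma CL1_cexpi c u : CL1 u -> CL1 (fun t => cexpi (c * t) * u t).
Proof. by apply: (CL1M (c := 2)) => [|t _]; [exact: CMF_cexpi|exact: n1_cexpi]. Qed.

Lemma nI_ge0 u : 0 <= nI u.
Proof. by apply: intI_ge0 => t _; exact: n1_ge0. Qed.

Lemma nI_le u v c : CL1 u -> CL1 v -> (forall t, Iset R t -> n1 (u t) <= c * n1 (v t)) ->
  nI u <= c * nI v.
Proof.
move=> hu hv uv; rewrite /nI -intIZ; last exact: L1_n1.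
by apply: intI_le => //; [exact: L1_n1|apply: L1Z; exact: L1_n1].
Qed.

Lemma nID u v : CL1 u -> CL1 v -> nI (fun t => u t + v t) <= nI u + nI v.
Proof.
move=> hu hv; rewrite /nI -intID; [|exact: L1_n1|exact: L1_n1].
apply: intI_le => [||t It]; [by apply: L1_n1; exact: CL1D| |exact: n1D].
by apply: L1D; exact: L1_n1.
Qed.

Lemma eq_CintI u v : (forall t, Iset R t -> u t = v t) -> CintI u = CintI v.
Proof. by move=> uv; apply: complex_ext; apply: eq_intI => t It; rewrite uv. Qed.

Lemma CintID u v : CL1 u -> CL1 v -> CintI (fun t => u t + v t) = CintI u + CintI v.
Proof.
move=> [u1 u2] [v1 v2]; apply: complex_ext; rewrite !ReIm /= -intID//;
  by apply: eq_intI => t _; rewrite !ReIm.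
Qed.

Lemma CintIZ z u : CL1 u -> CintI (fun t => z * u t) = z * CintI u.
Proof.
move=> [u1 u2]; apply: complex_ext; rewrite !ReIm /= -!intIZ//.
  by rewrite -intIB; [|exact: L1Z|exact: L1Z]; apply: eq_intI => t _; rewrite !ReIm.
by rewrite -intID; [|exact: L1Z|exact: L1Z]; apply: eq_intI => t _; rewrite !ReIm.
Qed.

Lemma n1_CintI u : CL1 u -> n1 (CintI u) <= nI u.
Proof.
move=> [u1 u2]; rewrite /nI /n1 intID; [|exact: L1abs|exact: L1abs].
by apply: lerD; exact: intI_abs.
Qed.

Lemma J_CintI u s : J u s = CintI (fun t => (ind s t)%:C%C * u t).
Proof.
by apply: complex_ext; apply: eq_intI => t _; rewrite !ReIm /=; ring.
Qed.

Lemma eq_J u v s : (forall t, Iset R t -> u t = v t) -> J u s = J v s.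
Proof. by move=> uv; apply: complex_ext; apply: eq_JR => t It; rewrite uv. Qed.

Lemma ae_eq_J u v s : CMF u -> CMF v -> aeI (fun t => u t = v t) -> J u s = J v s.
Proof.
move=> [u1 u2] [v1 v2] uv; apply: complex_ext; apply: ae_eq_JR => //;
  by apply: (aeI_mp _ uv) => t It ->.
Qed.

Lemma JD u v s : CL1 u -> CL1 v -> J (fun t => u t + v t) s = J u s + J v s.
Proof.
move=> [u1 u2] [v1 v2]; apply: complex_ext; rewrite !ReIm /= -JRD//;
  by apply: eq_JR => t _; rewrite !ReIm.
Qed.

Lemma JZ z u s : CL1 u -> J (fun t => z * u t) s = z * J u s.
Proof.
move=> [u1 u2]; apply: complex_ext; rewrite !ReIm /= -!JRZ//.
  by rewrite -JRB; [|exact: L1Z|exact: L1Z]; apply: eq_JR => t _; rewrite !ReIm.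
by rewrite -JRD; [|exact: L1Z|exact: L1Z]; apply: eq_JR => t _; rewrite !ReIm.
Qed.

Lemma JN u s : CL1 u -> J (fun t => - u t) s = - J u s.
Proof. by move=> hu; rewrite -mulN1r -JZ//; apply: eq_J => t _; rewrite mulN1r. Qed.

Lemma JB u v s : CL1 u -> CL1 v -> J (fun t => u t - v t) s = J u s - J v s.
Proof. by move=> hu hv; rewrite JD//; [rewrite JN|exact: CL1N]. Qed.

Lemma J_N1 u : CL1 u -> J u (-1) = 0.
Proof. by move=> [u1 u2]; rewrite /J !JR_N1. Qed.

Lemma J_cst z s : Iset R s -> J (fun=> z) s = z * (s + 1)%:C%C.
Proof. by move=> Is; rewrite /J !JR_cst//; apply: complex_ext; rewrite !ReIm /=; ring. Qed.

Lemma n1_J u s : CL1 u -> n1 (J u s) <= JR (fun t => n1 (u t)) s.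
Proof.
move=> [u1 u2]; rewrite /n1 JRD; [|exact: L1abs|exact: L1abs].
by apply: lerD; exact: JR_abs.
Qed.

Lemma n1_J_nI u s : CL1 u -> n1 (J u s) <= nI u.
Proof.
move=> hu; apply: le_trans (n1_J s hu) _; apply: JR_le_intI; first exact: L1_n1.
by move=> t _; exact: n1_ge0.
Qed.

Lemma CMF_J u : CL1 u -> CMF (J u).
Proof. by move=> [u1 u2]; split; exact: MF_JR. Qed.

Lemma CL1_J u : CL1 u -> CL1 (J u).
Proof. by move=> [u1 u2]; split; exact: L1_JR. Qed.

Lemma CL1_MJ u v : CL1 u -> CL1 v -> CL1 (fun t => u t * J v t).
Proof.
move=> hu hv; rewrite (_ : (fun t => _) = (fun t => J v t * u t)); last first.
  by apply/funext => t; rewrite mulrC.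
by apply: CL1M (CMF_J hv) _ hu => t _; exact: n1_J_nI.
Qed.

Lemma JM u v s : CL1 u -> CL1 v ->
  J u s * J v s = J (fun t => u t * J v t + J u t * v t) s.
Proof.
move=> hu hv; have [u1 u2] := hu; have [v1 v2] := hv.
have rM (x y : R -> R) : L1 x -> L1 y -> L1 (fun t => x t * JR y t + JR x t * y t).
  move=> hx hy; apply: L1D.
    apply: (eq_L1 (u := fun t => JR y t * x t)) => [t _|]; first exact: mulrC.
    by apply: L1M (MF_JR hy) _ hx => t _; exact: JR_abs_le.
  by apply: L1M (MF_JR hx) _ hy => t _; exact: JR_abs_le.
apply: complex_ext; rewrite !ReIm /= !JRM//.
  rewrite -JRB; [|exact: rM|exact: rM].
  by apply: eq_JR => t _; rewrite !ReIm /=; ring.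
rewrite -JRD; [|exact: rM|exact: rM].
by apply: eq_JR => t _; rewrite !ReIm /=; ring.
Qed.

(* [L2I] and boundedness give integrability on the bounded interval. *)
Lemma CL1_L2I u : L2I u -> CL1 u.
Proof.
move=> [u1 [u2 u3]]; apply: (@CL1_le _ (fun t => 1 + sqmod (u t))) => //.
  by apply: L1D => //; exact: L1cst.
by move=> t _; exact: n1_sqmod.
Qed.

Lemma nI_sqmod u : L2I u -> nI u <= 2 + intI (fun t => sqmod (u t)).
Proof.
move=> hu; have [u1 [u2 u3]] := hu.
rewrite (_ : 2 = intI (fun=> 1)); last by rewrite intI_cst mulr1.
rewrite -intID//; last exact: L1cst.
apply: intI_le => [||t _]; [by apply: L1_n1; exact: CL1_L2I| |exact: n1_sqmod].
by apply: L1D => //; exact: L1cst.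
Qed.

Lemma L2I_bdd u c : CMF u -> (forall t, Iset R t -> n1 (u t) <= c) -> L2I u.
Proof.
move=> hu uc; have [u1 u2] := hu; split => //; split => //.
apply: (@L1_bdd _ _ (c ^+ 2)); first exact: MF_sqmod.
move=> t It; rewrite ger0_norm ?sqmod_ge0//; apply: le_trans (sqmod_n1 _) _.
by rewrite lerXn2r// ?nnegrE ?n1_ge0// ?uc//; apply: le_trans (uc _ It); exact: n1_ge0.
Qed.

Lemma L2I_le u (v : R -> R) : CMF u -> L1 v ->
  (forall t, Iset R t -> sqmod (u t) <= v t) -> L2I u.
Proof.
move=> hu hv uv; have [u1 u2] := hu; split => //; split => //.
apply: (L1_le (MF_sqmod hu) hv) => t It.
by rewrite ger0_norm ?uv// sqmod_ge0.
Qed.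

Lemma L2I_CMF u : L2I u -> CMF u.
Proof. by move=> [h1 [h2 _]]. Qed.

Lemma L2I_L1 u : L2I u -> L1 (fun t => sqmod (u t)).
Proof. by move=> [_ [_ h]]. Qed.

Section Kernels.
Variables (k k' : R -> R -> R[i]) (M : R).
Definition CMF2 k := MF2 (fun r t => Re (k r t)) /\ MF2 (fun r t => Im (k r t)).
Hypotheses (mk : CMF2 k) (mk' : CMF2 k').
Hypotheses (kM : forall r t, n1 (k r t) <= M) (k'M : forall r t, n1 (k' r t) <= M).

Definition volt k u s : R[i] := CintI (fun t => (ind s t)%:C%C * k s t * u t).
Definition fred k u s : R[i] := CintI (fun t => k s t * u t).

Lemma CMF2_section r : CMF (k r).
Proof. by case: mk => m1 m2; split; [exact: (MF2_section m1)|exact: (MF2_section m2)]. Qed.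

Lemma CMF2_section' t : CMF (fun r => k r t).
Proof. by case: mk => m1 m2; split; [exact: (MF2_section (MF2_swap m1) t)|exact: (MF2_section (MF2_swap m2) t)]. Qed.

Lemma CMF_diag : CMF (fun r => k r r).
Proof. by case: mk => m1 m2; split; [exact: (MF_diag m1)|exact: (MF_diag m2)]. Qed.

Lemma CL1_fred s u : CL1 u -> CL1 (fun t => k s t * u t).
Proof. by apply: (CL1M (c := M)) => [|t _]; [exact: CMF2_section|exact: kM]. Qed.

Lemma CL1_volt s u : CL1 u -> CL1 (fun t => (ind s t)%:C%C * k s t * u t).
Proof.
move=> hu; under eq_fun do rewrite -mulrA.
apply: (CL1M (c := 1)) (CL1_fred s hu) => [|t _]; last by rewrite n1_real ind_le1.
by split; [exact: MF_ind|exact: measurable_cst].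
Qed.

Lemma n1_fred s u : CL1 u -> n1 (fred k u s) <= M * nI u.
Proof.
move=> hu; apply: le_trans (n1_CintI (CL1_fred s hu)) _.
apply: nI_le => //; first exact: CL1_fred.
by move=> t _; apply: le_trans (n1M _ _) _; rewrite ler_wpM2r ?n1_ge0.
Qed.

Lemma n1_volt_J s u : CL1 u -> n1 (volt k u s) <= M * JR (fun t => n1 (u t)) s.
Proof.
move=> hu; apply: le_trans (n1_CintI (CL1_volt s hu)) _.
rewrite /nI -JRZ; last exact: L1_n1.
apply: intI_le => [||t It].
- by apply: L1_n1; exact: CL1_volt.
- by apply: L1_ind; apply: L1Z; exact: L1_n1.
rewrite -mulrA; apply: le_trans (n1M _ _) _; rewrite n1_real ger0_norm ?ler0n//.
rewrite ler_wpM2l ?ler0n//; apply: le_trans (n1M _ _) _.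
by rewrite ler_wpM2r ?n1_ge0.
Qed.

Lemma n1_volt s u : CL1 u -> n1 (volt k u s) <= M * nI u.
Proof.
move=> hu; apply: le_trans (n1_volt_J s hu) _.
rewrite ler_wpM2l//; first exact: le_trans (n1_ge0 _) (kM 0 0).
by apply: JR_le_intI => [|t _]; [exact: L1_n1|exact: n1_ge0].
Qed.

Let Rek r t : `|Re (k r t)| <= M. Proof. exact: le_trans (Re_n1 _) (kM r t). Qed.
Let Imk r t : `|Im (k r t)| <= M. Proof. exact: le_trans (Im_n1 _) (kM r t). Qed.
Let Rek' r t : `|Re (k' r t)| <= M. Proof. exact: le_trans (Re_n1 _) (k'M r t). Qed.
Let Imk' r t : `|Im (k' r t)| <= M. Proof. exact: le_trans (Im_n1 _) (k'M r t). Qed.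

Lemma L1_kernel (h : R -> R -> R) (u : R -> R) r : MF2 h -> (forall r t, `|h r t| <= M) -> L1 u ->
  L1 (fun t => h r t * u t).
Proof. by move=> mh hM; apply: (L1M (c := M)) => //; exact: MF2_section. Qed.

Lemma CMF_fred u : CL1 u -> CMF (fred k u).
Proof.
case: mk => m1 m2 [u1 u2]; split.
  rewrite (_ : (fun t => _) = (fun r => intI (fun t => Re (k r t) * Re (u t))
    - intI (fun t => Im (k r t) * Im (u t)))).
    by apply: measurable_funB; apply: (MF_inner (M := M)).
  apply/funext => r; rewrite -intIB; [|exact: (L1_kernel r m1 Rek u1)|exact: (L1_kernel r m2 Imk u2)].
  by apply: eq_intI => t _; rewrite !ReIm.
rewrite (_ : (fun t => _) = (fun r => intI (fun t => Re (k r t) * Im (u t))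
  + intI (fun t => Im (k r t) * Re (u t)))).
  by apply: measurable_funD; apply: (MF_inner (M := M)).
apply/funext => r; rewrite -intID; [|exact: (L1_kernel r m1 Rek u2)|exact: (L1_kernel r m2 Imk u1)].
by apply: eq_intI => t _; rewrite !ReIm.
Qed.
End Kernels.

Lemma CMF2_ind k : CMF2 k -> CMF2 (fun r t => (ind r t)%:C%C * k r t).
Proof.
case=> m1 m2; split.
  rewrite (_ : (fun r t => _) = (fun r t => ind r t * Re (k r t))).
    by apply: (MF2M MF2_ind).
  by apply/funext => r; apply/funext => t; rewrite !ReIm /=; ring.
rewrite (_ : (fun r t => _) = (fun r t => ind r t * Im (k r t))).
  by apply: (MF2M MF2_ind).
by apply/funext => r; apply/funext => t; rewrite !ReIm /=; ring.
Qed.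

Lemma n1_ind k M : (forall r t, n1 (k r t) <= M) ->
  forall r t, n1 ((ind r t)%:C%C * k r t) <= M.
Proof.
move=> kM r t; apply: le_trans (n1M _ _) _; rewrite n1_real -[leRHS]mul1r.
by apply: ler_pM => //; [exact: n1_ge0|exact: ind_le1].
Qed.

Lemma CMF_volt k M u : CMF2 k -> (forall r t, n1 (k r t) <= M) -> CL1 u -> CMF (volt k u).
Proof. by move=> mk kM; exact: (CMF_fred (CMF2_ind mk) (n1_ind kM)). Qed.

Section Kernels.
Variables (k k' : R -> R -> R[i]) (M : R).
Hypotheses (mk : CMF2 k) (mk' : CMF2 k').
Hypotheses (kM : forall r t, n1 (k r t) <= M) (k'M : forall r t, n1 (k' r t) <= M).
Hypothesis kk' : forall s t, Iset R s -> Iset R t ->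
  k s t = k (-1) t + J (fun r => k' r t) s.

Let Rek r t : `|Re (k r t)| <= M. Proof. exact: le_trans (Re_n1 _) (kM r t). Qed.
Let Imk r t : `|Im (k r t)| <= M. Proof. exact: le_trans (Im_n1 _) (kM r t). Qed.
Let Rek' r t : `|Re (k' r t)| <= M. Proof. exact: le_trans (Re_n1 _) (k'M r t). Qed.
Let Imk' r t : `|Im (k' r t)| <= M. Proof. exact: le_trans (Im_n1 _) (k'M r t). Qed.

Let Rekk' s t : Iset R s -> Iset R t ->
  Re (k s t) = Re (k (-1) t) + JR (fun r => Re (k' r t)) s.
Proof. by move=> Is It; rewrite kk'// !ReIm. Qed.
Let Imkk' s t : Iset R s -> Iset R t ->
  Im (k s t) = Im (k (-1) t) + JR (fun r => Im (k' r t)) s.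
Proof. by move=> Is It; rewrite kk'// !ReIm. Qed.

Lemma fred_primitive u s : CL1 u -> Iset R s ->
  fred k u s = fred k u (-1) + J (fred k' u) s.
Proof.
case: mk mk' => m1 m2 [m1' m2'] hu Is; have [u1 u2] := hu.
have fE (h : R -> R -> R[i]) r : CMF2 h -> (forall r t, n1 (h r t) <= M) ->
   fred h u r = ((intI (fun t => Re (h r t) * Re (u t)) - intI (fun t => Im (h r t) * Im (u t)))
   +i* (intI (fun t => Re (h r t) * Im (u t)) + intI (fun t => Im (h r t) * Re (u t))))%C.
  case=> h1 h2 hM.
  have hM1 x y : `|Re (h x y)| <= M by exact: le_trans (Re_n1 _) (hM x y).
  have hM2 x y : `|Im (h x y)| <= M by exact: le_trans (Im_n1 _) (hM x y).
  apply: complex_ext => /=.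
    by rewrite -intIB; [|exact: (L1_kernel r h1 hM1 u1)|exact: (L1_kernel r h2 hM2 u2)]; apply: eq_intI => t _; rewrite !ReIm.
  by rewrite -intID; [|exact: (L1_kernel r h1 hM1 u2)|exact: (L1_kernel r h2 hM2 u1)]; apply: eq_intI => t _; rewrite !ReIm.
rewrite !fE//.
have iL (h : R -> R -> R) (v : R -> R) : MF2 h -> (forall r t, `|h r t| <= M) -> L1 v ->
    L1 (fun r => intI (fun t => h r t * v t)).
  move=> mh hM hv; apply: eq_L1 (L1_inner mh hM hv (L1cst 1)) => r _; exact: mul1r.
apply: complex_ext; rewrite !ReIm /=.
  rewrite (@eq_JR _ (fun r => Re (fred k' u r)) (fun r => intI (fun t => Re (k' r t) * Re (u t)) -
    intI (fun t => Im (k' r t) * Im (u t)))); last by move=> r _; rewrite fE.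
  rewrite JRB; [|exact: (iL _ _ m1' Rek' u1)|exact: (iL _ _ m2' Imk' u2)].
  rewrite (fredholm_primitive m1 m1' Rek Rek' Rekk' u1 Is).
  by rewrite (fredholm_primitive m2 m2' Imk Imk' Imkk' u2 Is) opprD addrACA.
rewrite (@eq_JR _ (fun r => Im (fred k' u r)) (fun r => intI (fun t => Re (k' r t) * Im (u t)) +
  intI (fun t => Im (k' r t) * Re (u t)))); last by move=> r _; rewrite fE.
rewrite JRD; [|exact: (iL _ _ m1' Rek' u2)|exact: (iL _ _ m2' Imk' u1)].
rewrite (fredholm_primitive m1 m1' Rek Rek' Rekk' u2 Is).
by rewrite (fredholm_primitive m2 m2' Imk Imk' Imkk' u1 Is) addrACA.
Qed.

Lemma volt_primitive u s : CL1 u -> Iset R s ->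
  volt k u s = J (fun r => k r r * u r + volt k' u r) s.
Proof.
case: mk mk' => m1 m2 [m1' m2'] hu Is; have [u1 u2] := hu.
have iM (h : R -> R -> R) x y : `|h x y| <= M -> `|ind x y * h x y| <= M.
  by move=> hM; rewrite normrM -[leRHS]mul1r ler_pM// ind_le1.
have fE (h : R -> R -> R[i]) r : CMF2 h -> (forall r t, n1 (h r t) <= M) ->
   volt h u r = ((intI (fun t => ind r t * Re (h r t) * Re (u t)) - intI (fun t => ind r t * Im (h r t) * Im (u t)))
   +i* (intI (fun t => ind r t * Re (h r t) * Im (u t)) + intI (fun t => ind r t * Im (h r t) * Re (u t))))%C.
  case=> h1 h2 hM.
  have hM1 x y : `|ind x y * Re (h x y)| <= M by apply: (iM (fun x y => Re (h x y))); exact: le_trans (Re_n1 _) (hM x y).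
  have hM2 x y : `|ind x y * Im (h x y)| <= M by apply: (iM (fun x y => Im (h x y))); exact: le_trans (Im_n1 _) (hM x y).
  have g1 := MF2M MF2_ind h1; have g2 := MF2M MF2_ind h2.
  apply: complex_ext => /=.
    rewrite -intIB; [|exact: (L1_kernel _ g1 hM1 u1)|exact: (L1_kernel _ g2 hM2 u2)].
    by apply: eq_intI => t _; rewrite !ReIm /=; ring.
  rewrite -intID; [|exact: (L1_kernel _ g1 hM1 u2)|exact: (L1_kernel _ g2 hM2 u1)].
  by apply: eq_intI => t _; rewrite !ReIm /=; ring.
have dL (h h' : R -> R -> R) (v : R -> R) : MF2 h -> MF2 h' -> (forall r t, `|h r t| <= M) ->
    (forall r t, `|h' r t| <= M) -> L1 v ->
    L1 (fun r => h r r * v r + intI (fun t => ind r t * h' r t * v t)).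
  move=> mh mh' hM h'M hv; apply: L1D.
    by apply: (L1M (c := M)) => //; exact: MF_diag.
  apply: L1_bdd; first exact: (MF_volterra mh' h'M).
  by move=> t _; exact: volterra_bdd.
rewrite fE//; apply: complex_ext; rewrite /=.
  rewrite (volterra_primitive m1 m1' Rek Rek' Rekk' u1 Is).
  rewrite (volterra_primitive m2 m2' Imk Imk' Imkk' u2 Is).
  rewrite -JRB; [|exact: (dL _ _ _ m1 m1' Rek Rek' u1)|exact: (dL _ _ _ m2 m2' Imk Imk' u2)].
  by apply: eq_JR => r _; rewrite ?ReIm fE// ?ReIm /=; ring.
rewrite (volterra_primitive m1 m1' Rek Rek' Rekk' u2 Is).
rewrite (volterra_primitive m2 m2' Imk Imk' Imkk' u1 Is).
rewrite -JRD; [|exact: (dL _ _ _ m1 m1' Rek Rek' u2)|exact: (dL _ _ _ m2 m2' Imk Imk' u1)].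
by apply: eq_JR => r _; rewrite ?ReIm fE// ?ReIm /=; ring.
Qed.
End Kernels.

End ComplexIntegral.

(** * Fundamental theorem of calculus and the damped primitive *)

Section Primitives.
Context {R : realType}.
Notation mu := (@lebesgue_measure R).
Local Notation Re := complex.Re.
Local Notation Im := complex.Im.

Lemma L1_continuous (f : R -> R) : {within Iset R, continuous f} -> L1 f.
Proof. by move=> cf; apply: continuous_compact_integrable => //; exact: segment_compact. Qed.

Lemma JR_itv (f : R -> R) s : Iset R s ->
  JR f s = Rintegral mu `[-1, s] f.
Proof.
move=> Is; rewrite /JR /intI [LHS]Rintegral_mkcond [RHS]Rintegral_mkcond.
congr Rintegral; apply/funext => t; rewrite !patchE /ind /Iset !mem_setE !in_itv /=.
have s1 := Iset_ge Is.
by case: (lerP (-1) t) => // t1; case: (lerP t s) => ts /=;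
  case: (lerP t 1) => t1'; rewrite ?mul1r ?mul0r//; lra.
Qed.

Lemma JR_FTC (F f : R -> R) : {within Iset R, continuous F} ->
  {within Iset R, continuous f} ->
  (forall x, Ioset R x -> is_derive x 1 F (f x)) ->
  forall s, Iset R s -> F s = F (-1) + JR f s.
Proof.
move=> cF cf dF s Is; rewrite JR_itv//.
have := Iset_le Is; rewrite le_eqVlt => /predU1P[<-|s1].
  by rewrite set_itv1 Rintegral_set1 addr0.
have sub : `[-1, s] `<=` Iset R.
  move=> t /=; rewrite in_itv /= => /andP[t1 ts]; apply/IsetE.
  by rewrite t1 (le_trans ts)// Iset_ge.
have ooI x : x \in `]-1, s[ -> Ioset R x.
  rewrite /Ioset /= !in_itv /= => /andP[-> /lt_le_trans]; apply; exact: Iset_ge.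
have cf' : {within `[-1, s], continuous f} by exact: continuous_subspaceW cf.
have cF' : {within `[-1, s], continuous F} by exact: continuous_subspaceW cF.
have dF' : derivable_oo_LRcontinuous F (-1) s.
  have [_ h1 h2] := (continuous_within_itvP _ s1).1 cF'.
  by split => // x xs; have [] := dF x (ooI _ xs).
have F'f : {in `]-1, s[, derive1 F =1 f}.
  by move=> x xs; rewrite derive1E; have [_ ->] := dF x (ooI _ xs).
rewrite /Rintegral (continuous_FTC2 s1 cf' dF' F'f) /=; ring.
Qed.

(** The product rule (u v)' = a v + u b for absolutely continuous functions given by their value at
    -1 and their derivative; it reduces to [JM] by expanding the constants. *)
Lemma prim_mul (a b u v : R -> R[i]) (d e : R[i]) : CL1 a -> CL1 b ->
  (forall s, Iset R s -> u s = d + J a s) -> (forall s, Iset R s -> v s = e + J b s) ->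
  forall s, Iset R s -> u s * v s = d * e + J (fun t => a t * v t + u t * b t) s.
Proof.
move=> ha hb hu hv s Is.
rewrite (@eq_J _ _ (fun t => e * a t + (d * b t + (a t * J b t + J a t * b t)))); last first.
  by move=> t It; rewrite hu// hv//; ring.
have h1 : CL1 (fun t => a t * J b t) by exact: CL1_MJ.
have h2 : CL1 (fun t => J a t * b t).
  by rewrite (_ : (fun t => _) = (fun t => b t * J a t)); [exact: CL1_MJ|apply/funext => t; rewrite mulrC].
rewrite JD; [|exact: CL1Z|by apply: CL1D; [exact: CL1Z|exact: CL1D]].
rewrite JD; [|exact: CL1Z|exact: CL1D].
by rewrite !JZ// -JM// hu// hv//; ring.
Qed.

Lemma within_continuous (f : R -> R) : continuous f -> {within Iset R, continuous f}.
Proof. exact: continuous_subspaceT. Qed.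

Lemma derive_continuous (f g : R -> R) : (forall x : R, is_derive x 1 f (g x)) -> continuous f.
Proof.
move=> df x; apply: differentiable_continuous; apply/derivable1_diffP.
by have [] := df x.
Qed.

Lemma is_derive_scale (f g : R -> R) (c : R) : (forall x : R, is_derive x 1 f (g x)) ->
  forall x : R, is_derive x 1 (fun t : R => f (c * t)) (c * g (c * x)).
Proof.
move=> df x.
have hc : is_derive x 1 (fun t : R => c * t) c.
  have h := @is_deriveZ _ _ _ (@id R) c x 1 1 (is_derive_id x 1).
  by apply: (is_derive_eq h); rewrite scaler1.
have := @is_derive1_comp _ f (fun t => c * t) x _ _ (df (c * x)) hc.
by move=> h; apply: (is_derive_eq h); rewrite mulrC.
Qed.

Lemma prim_cexpi (c s : R) : Iset R s ->
  cexpi (c * s) = cexpi (c * -1) + J (fun t => (0 +i* c)%C * cexpi (c * t)) s.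
Proof.
move=> Is.
have dc (x : R) : is_derive x 1 (fun t => cos (c * t)) (c * - sin (c * x)).
  by apply: (is_derive_scale (f := cos) (g := fun x => - sin x)) => y; exact: is_derive_cos.
have ds (x : R) : is_derive x 1 (fun t => sin (c * t)) (c * cos (c * x)).
  by apply: (is_derive_scale (f := sin)) => y; exact: is_derive_sin.
have cc := derive_continuous dc; have cs := derive_continuous ds.
apply: complex_ext; rewrite !ReIm /J /=.
  rewrite [LHS](@JR_FTC (fun t => cos (c * t)) (fun x => c * - sin (c * x)))//.
  - by congr (_ + _); apply: eq_JR => t _; rewrite ?ReIm /=; ring.
  - exact: within_continuous.
  - apply: within_continuous => x; apply: cvgM; first exact: cvg_cst.
    by apply: cvgN; exact: cs.
rewrite [LHS](@JR_FTC (fun t => sin (c * t)) (fun x => c * cos (c * x)))//.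
- by congr (_ + _); apply: eq_JR => t _; rewrite ?ReIm /=; ring.
- exact: within_continuous.
- apply: within_continuous => x; apply: cvgM; first exact: cvg_cst.
  exact: cc.
Qed.

Definition cexpR (c s : R) : R[i] := (expR (c * s))%:C%C.

Lemma cexpR_continuous (c : R) : continuous (fun t => expR (c * t)).
Proof.
apply: (@derive_continuous _ (fun x => c * expR (c * x))).
by apply: (is_derive_scale (f := expR)) => y; exact: is_derive_expR.
Qed.

Lemma prim_expR (c s : R) : Iset R s ->
  cexpR c s = cexpR c (-1) + J (fun t => c%:C%C * cexpR c t) s.
Proof.
move=> Is.
have dc (x : R) : is_derive x 1 (fun t => expR (c * t)) (c * expR (c * x)).
  by apply: (is_derive_scale (f := expR)) => y; exact: is_derive_expR.
have cc := @cexpR_continuous c.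
apply: complex_ext; rewrite !ReIm /J /=.
  rewrite [LHS](@JR_FTC (fun t => expR (c * t)) (fun x => c * expR (c * x)))//.
  - by congr (_ + _); apply: eq_JR => t _; rewrite ?ReIm /=; ring.
  - exact: within_continuous.
  - apply: within_continuous => x; apply: cvgM; first exact: cvg_cst.
    exact: cc.
rewrite (@eq_JR _ _ (fun=> 0)); first by rewrite JR_cst//; ring.
by move=> t _; rewrite ?ReIm /=; ring.
Qed.

Lemma CMF_cexpR c : CMF (cexpR c).
Proof.
split; last exact: measurable_cst.
by apply: L1_MF; apply: L1_continuous; apply: within_continuous; exact: cexpR_continuous.
Qed.

Lemma cexpR_bdd c t : Iset R t -> n1 (cexpR c t) <= expR `|c|.
Proof.
move=> It; rewrite n1_real ger0_norm ?expR_ge0// ler_expR.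
apply: le_trans (ler_norm _) _; rewrite normrM ler_piMr// ler_norml.
by rewrite Iset_le// Iset_ge.
Qed.

Lemma CL1_cexpR c u : CL1 u -> CL1 (fun t => cexpR c t * u t).
Proof. by apply: (CL1M (c := expR `|c|)) => [|t It]; [exact: CMF_cexpR|exact: cexpR_bdd]. Qed.

Lemma CL1_cexpRl c : CL1 (cexpR c).
Proof. by apply: CL1_bdd (CMF_cexpR c) _ => t It; exact: cexpR_bdd. Qed.

(* The damped primitive: the solution of [v' + c v = g], [v(-1) = 0]. *)
Definition damp (c : R) (g : R -> R[i]) (s : R) : R[i] :=
  cexpR (- c) s * J (fun t => cexpR c t * g t) s.

Lemma CL1_damp c g : CL1 g -> CL1 (damp c g).
Proof. by move=> hg; apply: CL1_cexpR; apply: CL1_J; exact: CL1_cexpR. Qed.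

Lemma dampE c g : CL1 g -> forall s, Iset R s ->
  damp c g s = J (fun t => g t - c%:C%C * damp c g t) s.
Proof.
move=> hg s Is; have hcg := CL1_cexpR c hg.
rewrite {1}/damp (@prim_mul (fun t => (- c)%:C%C * cexpR (- c) t) (fun t => cexpR c t * g t)
  (cexpR (- c)) (J (fun t => cexpR c t * g t)) (cexpR (- c) (-1)) 0)//.
- rewrite mulr0 add0r; apply: eq_J => t It; rewrite /damp.
  have -> : cexpR (- c) t * (cexpR c t * g t) = g t.
    by rewrite mulrA /cexpR -rmorphM /= mulNr -expRD addNr expR0 mul1r.
  by rewrite rmorphN; ring.
- by apply: CL1Z; exact: CL1_cexpRl.
- by move=> t It; exact: prim_expR.
- by move=> t It; rewrite add0r.
Qed.

(** Here v' = g - c v, and g^2 - (c v)^2 = 2 c v v' + v'^2. The integral of 2 v v' is v(1)^2 >= 0,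
    because v(-1) = 0. *)
Lemma damp_energy_real (c : R) (g v : R -> R) : 0 < c -> L1 g -> L1 (fun t => g t ^+ 2) -> L1 v ->
  (forall s, Iset R s -> v s = JR (fun t => g t - c * v t) s) ->
  intI (fun t => (c * v t) ^+ 2) <= intI (fun t => g t ^+ 2).
Proof.
move=> c0 hg hg2 hv vE.
have hw : L1 (fun t => g t - c * v t) by apply: L1B => //; exact: L1Z.
have mv := L1_MF hv.
have vb t : Iset R t -> `|v t| <= intI (fun t => `|g t - c * v t|).
  by move=> It; rewrite vE//; exact: JR_abs_le.
have hvw : L1 (fun t => v t * (g t - c * v t)) by exact: L1M mv vb hw.
have hv2 : L1 (fun t => v t ^+ 2) by exact: L1M mv vb hv.
have h0 : 0 <= intI (fun t => 2 * (v t * (g t - c * v t))).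
  rewrite -JR_1 (@eq_JR _ _ (fun t => (g t - c * v t) * JR (fun t => g t - c * v t) t
     + JR (fun t => g t - c * v t) t * (g t - c * v t))); last first.
    by move=> t It; rewrite -vE//; ring.
  by rewrite -JRM// -expr2 sqr_ge0.
rewrite -subr_ge0 -intIB//; last first.
  by apply: (eq_L1 (u := fun t => c ^+ 2 * v t ^+ 2)) => [t _|]; [ring|exact: L1Z].
apply: le_trans (mulr_ge0 (ltW c0) h0) _.
rewrite -intIZ; last exact: L1Z.
apply: intI_le => [||t _].
- by apply: L1Z; exact: L1Z.
- apply: L1B => //.
  by apply: (eq_L1 (u := fun t => c ^+ 2 * v t ^+ 2)) => [t _|]; [ring|exact: L1Z].
rewrite -subr_ge0 (_ : _ - _ = (g t - c * v t) ^+ 2) ?sqr_ge0//; ring.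
Qed.

Lemma L1_sq_le (u : R -> R) (v : R -> R[i]) : MF u -> L2I v ->
  (forall t, Iset R t -> u t ^+ 2 <= sqmod (v t)) -> L1 (fun t => u t ^+ 2).
Proof.
move=> mu_ hv uv; apply: (L1_le _ (L2I_L1 hv)); first exact: measurable_funX.
by move=> t It; rewrite ger0_norm ?sqr_ge0// uv.
Qed.

Lemma damp_energy c g : 0 < c -> L2I g ->
  L2I (fun t => c%:C%C * damp c g t) /\
  intI (fun t => sqmod (c%:C%C * damp c g t)) <= intI (fun t => sqmod (g t)).
Proof.
move=> c0 hg; have hg1 := CL1_L2I hg; have [g1 g2] := hg1.
have hv := CL1_damp c hg1; have [v1 v2] := hv.
have hw : CL1 (fun t => g t - c%:C%C * damp c g t) by apply: CL1B => //; exact: CL1Z.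
have vb t : Iset R t -> n1 (c%:C%C * damp c g t) <= n1 c%:C%C * nI (fun t => g t - c%:C%C * damp c g t).
  move=> It; apply: le_trans (n1M _ _) _; rewrite ler_wpM2l ?n1_ge0//.
  by rewrite dampE//; exact: n1_J_nI.
have hcv : L2I (fun t => c%:C%C * damp c g t).
  by apply: L2I_bdd vb; apply: CL1_CMF; exact: CL1Z.
split => //.
have hg1s : L1 (fun t => Re (g t) ^+ 2).
  by apply: (L1_sq_le (L1_MF g1) hg) => t _; rewrite lerDl sqr_ge0.
have hg2s : L1 (fun t => Im (g t) ^+ 2).
  by apply: (L1_sq_le (L1_MF g2) hg) => t _; rewrite lerDr sqr_ge0.
have hv1s : L1 (fun t => (c * Re (damp c g t)) ^+ 2).
  apply: (L1_sq_le _ hcv); first by apply: L1_MF; exact: L1Z.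
  move=> t _; rewrite (_ : c * _ = Re (c%:C%C * damp c g t)) ?lerDl ?sqr_ge0//.
  by rewrite !ReIm /=; ring.
have hv2s : L1 (fun t => (c * Im (damp c g t)) ^+ 2).
  apply: (L1_sq_le _ hcv); first by apply: L1_MF; exact: L1Z.
  move=> t _; rewrite (_ : c * _ = Im (c%:C%C * damp c g t)) ?lerDr ?sqr_ge0//.
  by rewrite !ReIm /=; ring.
rewrite [leRHS]intID// (@eq_intI _ _ (fun t => (c * Re (damp c g t)) ^+ 2 + (c * Im (damp c g t)) ^+ 2)).
  rewrite intID//; apply: lerD; apply: damp_energy_real => // s Is.
  - rewrite {1}dampE// /J /=; apply: eq_JR => t _; rewrite ?ReIm /=; ring.
  - rewrite {1}dampE// /J /=; apply: eq_JR => t _; rewrite ?ReIm /=; ring.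
by move=> t _; rewrite /sqmod !ReIm /=; ring.
Qed.

End Primitives.

(** * Bounded families in H^n and the oscillatory antiderivative *)

Section Families.
Context {R : realType} {T : Type}.
Local Notation Re := complex.Re.
Local Notation Im := complex.Im.
Implicit Types (U V W P Q : T -> R -> R[i]) (d e : T -> R[i]).

Definition bounded_family d := exists c, forall i, n1 (d i) <= c.

(** Boundedness in H^n, uniformly over the index: the values at -1 of the derivatives of order below
    n are bounded, and the n-th derivative is bounded in L^2. For n > 0 the identity holds at every
    point of I, so the continuous representative is meant; [HF_of_Hm] and [Hm_of_HF] compare this
    with [Hm_bound]. *)
Fixpoint HF n U : Prop :=
  match n with
  | 0 => exists c, forall i, L2I (U i) /\ intI (fun t => sqmod (U i t)) <= c
  | n'.+1 => exists d, bounded_family d /\ exists V, HF n' V /\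
      forall i s, Iset R s -> U i s = d i + J (V i) s
  end.

Lemma bounded_family_cst (z : R[i]) : bounded_family (fun=> z).
Proof. by exists (n1 z). Qed.

Lemma bounded_familyD d e : bounded_family d -> bounded_family e ->
  bounded_family (fun i => d i + e i).
Proof.
move=> [c hc] [c' hc']; exists (c + c') => i.
by apply: le_trans (n1D _ _) _; exact: lerD.
Qed.

Lemma bounded_familyM d e : bounded_family d -> bounded_family e ->
  bounded_family (fun i => d i * e i).
Proof.
move=> [c hc] [c' hc']; exists (c * c') => i.
by apply: le_trans (n1M _ _) _; apply: ler_pM => //; exact: n1_ge0.
Qed.

Lemma bounded_cexpi (x : T -> R) : bounded_family (fun i => cexpi (x i)).
Proof. by exists 2 => i; exact: n1_cexpi. Qed.

Lemma HF0_bdd U c : (forall i, CMF (U i)) ->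
  (forall i s, Iset R s -> n1 (U i s) <= c) -> HF 0 U.
Proof.
move=> mU Uc; exists (2 * c ^+ 2) => i; split; first exact: L2I_bdd (mU i) (Uc i).
rewrite -intI_cst; apply: intI_le => [||t It].
- by apply: L2I_L1; exact: L2I_bdd (mU i) (Uc i).
- exact: L1cst.
apply: le_trans (sqmod_n1 _) _; rewrite lerXn2r ?nnegrE ?n1_ge0 ?Uc//.
exact: le_trans (n1_ge0 _) (Uc i _ It).
Qed.

Lemma HF0_nI U : HF 0 U -> exists c, forall i, CL1 (U i) /\ nI (U i) <= c.
Proof.
move=> [c hc]; exists (2 + c) => i; have [h1 h2] := hc i.
by split; [exact: CL1_L2I|apply: le_trans (nI_sqmod h1) _; rewrite lerD2l].
Qed.

Lemma HF0_ae U V : (forall i, CMF (V i)) -> (forall i, aeI (fun t => U i t = V i t)) ->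
  HF 0 U -> HF 0 V.
Proof.
move=> mV UV [c hc]; exists c => i; have [h1 h2] := hc i.
have e : aeI (fun t => sqmod (U i t) = sqmod (V i t)).
  by apply: (aeI_mp _ (UV i)) => t It ->.
have m1 := MF_sqmod (mV i); have m2 := L1_MF (L2I_L1 h1).
split; last by rewrite -(ae_eq_intI m2 m1 e).
have [v1 v2] := mV i; split => //; split => //.
exact: (ae_eq_L1 m1 e (L2I_L1 h1)).
Qed.

Lemma HF0_J V : HF 0 V -> HF 0 (fun i => J (V i)).
Proof.
move=> /HF0_nI[c hc]; apply: (@HF0_bdd _ c) => i; have [h1 h2] := hc i.
  exact: CMF_J.
by move=> s _; exact: le_trans (n1_J_nI s h1) h2.
Qed.

Lemma HF_eq n U V : (forall i s, Iset R s -> U i s = V i s) -> HF n U -> HF n V.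
Proof.
case: n => [|n] UV; last first.
  move=> [d [hd [W [hW UE]]]]; exists d; split => //; exists W; split => // i s Is.
  by rewrite -UV// UE.
move=> hU; apply: (HF0_ae _ _ hU) => i.
  have [c hc] := hU; have [[m1 [m2 _]] _] := hc i.
  by split; [apply: eq_MF m1|apply: eq_MF m2] => t It; rewrite UV.
by apply: aeIW => t It; exact: UV.
Qed.

Lemma HF0D U V : HF 0 U -> HF 0 V -> HF 0 (fun i t => U i t + V i t).
Proof.
move=> [c hc] [c' hc']; exists (2 * c + 2 * c') => i.
have [u1 u2] := hc i; have [v1 v2] := hc' i.
have h : L1 (fun t => 2 * sqmod (U i t) + 2 * sqmod (V i t)).
  by apply: L1D; apply: L1Z; exact: L2I_L1.
have l : L2I (fun t => U i t + V i t).
  apply: (L2I_le _ h); first by apply: CMFD; exact: L2I_CMF.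
  by move=> t _; exact: sqmodD.
split => //; apply: le_trans (intI_le (L2I_L1 l) h _) _ => [t _|]; first exact: sqmodD.
rewrite intID; [|by apply: L1Z; exact: L2I_L1|by apply: L1Z; exact: L2I_L1].
by rewrite !intIZ ?lerD ?ler_wpM2l//; exact: L2I_L1.
Qed.

Lemma HF0M (a : T -> R -> R[i]) U c : (forall i, CMF (a i)) ->
  (forall i s, Iset R s -> n1 (a i s) <= c) -> HF 0 U -> HF 0 (fun i t => a i t * U i t).
Proof.
move=> ma ac [c' hc']; exists (c ^+ 2 * c') => i; have [u1 u2] := hc' i.
have h : L1 (fun t => c ^+ 2 * sqmod (U i t)) by apply: L1Z; exact: L2I_L1.
have le t : Iset R t -> sqmod (a i t * U i t) <= c ^+ 2 * sqmod (U i t).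
  move=> It; rewrite sqmodM ler_wpM2r ?sqmod_ge0//; apply: le_trans (sqmod_n1 _) _.
  rewrite lerXn2r ?nnegrE ?n1_ge0 ?ac//; exact: le_trans (n1_ge0 _) (ac i _ It).
have l : L2I (fun t => a i t * U i t).
  by apply: (L2I_le _ h) => //; apply: CMFM => //; exact: L2I_CMF.
split => //; apply: le_trans (intI_le (L2I_L1 l) h le) _.
by rewrite intIZ ?ler_wpM2l ?sqr_ge0//; exact: L2I_L1.
Qed.

Lemma HF0_cst d : bounded_family d -> HF 0 (fun i _ => d i).
Proof. by move=> [c hc]; apply: (@HF0_bdd _ c) => // i; exact: CMF_cst. Qed.

Lemma HF_0 n U : HF n U -> HF 0 U.
Proof.
elim: n U => // n IH U [d [hd [V [hV UE]]]].
apply: (@HF_eq 0 (fun i s => d i + J (V i) s)) => [i s Is|]; first by rewrite UE.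
by apply: HF0D; [exact: HF0_cst|apply: HF0_J; exact: IH].
Qed.

Lemma HF_CL1 n U i : HF n U -> CL1 (U i).
Proof. by move=> /HF_0/HF0_nI[c hc]; case: (hc i). Qed.

Lemma HF_S n U : HF n.+1 U -> HF n U.
Proof.
elim: n U => [|n IH] U; first exact: HF_0.
move=> [d [hd [V [hV UE]]]]; exists d; split => //; exists V; split => //.
exact: IH.
Qed.

Lemma HF_le n m U : (n <= m)%N -> HF m U -> HF n U.
Proof.
move=> nm; rewrite -(subnK nm); elim: (m - n)%N => // p IH; rewrite addSn => /HF_S.
exact: IH.
Qed.

Lemma HFD n U V : HF n U -> HF n V -> HF n (fun i t => U i t + V i t).
Proof.
elim: n U V => [|n IH] U V; first exact: HF0D.
move=> [d [hd [U' [hU UE]]]] [e [he [V' [hV VE]]]].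
exists (fun i => d i + e i); split; first exact: bounded_familyD.
exists (fun i t => U' i t + V' i t); split; first exact: IH.
move=> i s Is; rewrite JD; [|exact: HF_CL1 hU|exact: HF_CL1 hV].
by rewrite UE// VE// addrACA.
Qed.

Lemma HFZ n d U : bounded_family d -> HF n U -> HF n (fun i t => d i * U i t).
Proof.
move=> hd; elim: n U => [|n IH] U.
  have [c hc] := hd; apply: (@HF0M _ _ c) => // i; exact: CMF_cst.
move=> [e [he [V [hV UE]]]]; exists (fun i => d i * e i); split.
  exact: bounded_familyM.
exists (fun i t => d i * V i t); split; first exact: IH.
by move=> i s Is; rewrite JZ ?UE ?mulrDr//; exact: HF_CL1 hV.
Qed.

Lemma HFN n U : HF n U -> HF n (fun i t => - U i t).
Proof.
move=> /(HFZ (bounded_family_cst (-1))); apply: HF_eq => i s _; exact: mulN1r.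
Qed.

Lemma HFB n U V : HF n U -> HF n V -> HF n (fun i t => U i t - V i t).
Proof. by move=> hU hV; apply: HFD => //; exact: HFN. Qed.

Lemma HF_cst n d : bounded_family d -> HF n (fun i _ => d i).
Proof.
elim: n d => [|n IH] d hd; first exact: HF0_cst.
exists d; split => //; exists (fun _ _ => 0); split; first by apply: IH; exact: bounded_family_cst.
by move=> i s Is; rewrite J_cst// mul0r addr0.
Qed.

Lemma HF_J n V : HF n V -> HF n.+1 (fun i => J (V i)).
Proof.
move=> hV; exists (fun=> 0); split; first exact: bounded_family_cst.
by exists V; split => // i s _; rewrite add0r.
Qed.

(** The space W^(n,infinity) on I, whose elements multiply H^n into itself ([HFM]). It serves for
    the diagonals k(s,s), which do not depend on the frequency. *)
Fixpoint Cn n (a : R -> R[i]) : Prop :=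
  match n with
  | 0 => CMF a /\ exists c, forall s, Iset R s -> n1 (a s) <= c
  | n'.+1 => exists z b, Cn n' b /\ forall s, Iset R s -> a s = z + J b s
  end.

Lemma Cn_eq n a b : (forall s, Iset R s -> a s = b s) -> Cn n a -> Cn n b.
Proof.
case: n => [|n] ab; last first.
  move=> [d [a' [ha' aE]]]; exists d, a'; split => // s Is; by rewrite -ab// aE.
move=> [[m1 m2] [c hc]]; split; last by exists c => s Is; rewrite -ab// hc.
by split; [apply: eq_MF m1|apply: eq_MF m2] => t It; rewrite ab.
Qed.

Lemma Cn_0 n a : Cn n a -> Cn 0 a.
Proof.
elim: n a => // n IH a [d [b [/IH[mb [c hc]] aE]]].
have b1 : CL1 b by exact: CL1_bdd mb hc.
apply: (@Cn_eq 0 (fun s => d + J b s)) => [s Is|]; first by rewrite aE.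
split; first by apply: CMFD; [exact: CMF_cst|exact: CMF_J].
exists (n1 d + nI b) => s Is; apply: le_trans (n1D _ _) _.
by rewrite lerD2l n1_J_nI.
Qed.

Lemma Cn_CL1 n a : Cn n a -> CL1 a.
Proof. by move=> /Cn_0[m [c hc]]; exact: CL1_bdd m hc. Qed.

Lemma Cn_S n a : Cn n.+1 a -> Cn n a.
Proof.
elim: n a => [|n IH] a; first exact: Cn_0.
by move=> [d [b [hb aE]]]; exists d, b; split => //; exact: IH.
Qed.

Lemma Cn_add n a b : Cn n a -> Cn n b -> Cn n (fun s => a s + b s).
Proof.
elim: n a b => [|n IH] a b.
  move=> [ma [c hc]] [mb [c' hc']]; split; first exact: CMFD.
  exists (c + c') => s Is; apply: le_trans (n1D _ _) _.
  by apply: lerD; [exact: hc|exact: hc'].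
move=> [d [a' [ha' aE]]] [e [b' [hb' bE]]]; exists (d + e), (fun s => a' s + b' s).
split; first exact: IH.
move=> s Is; rewrite JD; [|exact: Cn_CL1 ha'|exact: Cn_CL1 hb'].
by rewrite aE// bE// addrACA.
Qed.

Lemma HFM n a U : Cn n a -> HF n U -> HF n (fun i t => a t * U i t).
Proof.
elim: n a U => [|n IH] a U.
  move=> [ma [c hc]]; exact: (@HF0M (fun=> a) _ c).
move=> ha hU; have ha' := Cn_S ha; have hU' := HF_S hU.
case: ha => z [b [hb aE]]; case: hU => [d [hd [V [hV UE]]]].
exists (fun i => z * d i); split; first by apply: bounded_familyM => //; exact: bounded_family_cst.
exists (fun i t => b t * U i t + a t * V i t); split; first by apply: HFD; exact: IH.
move=> i s Is.
by apply: prim_mul => //; [exact: Cn_CL1 hb|exact: HF_CL1 hV|exact: UE].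
Qed.

End Families.

(** * Integration of oscillating functions with a gain of one derivative *)

Section Antiderivative.
Context {R : realType} {T : Type}.
Local Notation Re := complex.Re.
Local Notation Im := complex.Im.
Implicit Types (U V W P Q g : T -> R -> R[i]) (d e : T -> R[i]).
Variables (w : T -> R) (sg : R).
Hypothesis w1 : forall i, 1 <= w i.

Definition wave (x : T -> R) i (t : R) : R[i] := cexpi (x i * t).

Lemma HF0_wave (x : T -> R) U : HF 0 U -> HF 0 (fun i t => wave x i t * U i t).
Proof.
by apply: (HF0M (c := 2)) => [i|i s _]; [exact: CMF_cexpi|exact: n1_cexpi].
Qed.

Lemma CL1_wave (x : T -> R) i : CL1 (wave x i).
Proof.
by apply: (CL1_bdd (c := 2)) => [|t _]; [exact: CMF_cexpi|exact: n1_cexpi].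
Qed.

Lemma prim_wave (x : T -> R) i (a v : R -> R[i]) (z : R[i]) : CL1 a ->
  (forall s, Iset R s -> v s = z + J a s) -> forall s, Iset R s ->
  wave x i s * v s = wave x i (-1) * z +
    J (fun t => (0 +i* x i)%C * (wave x i t * v t) + wave x i t * a t) s.
Proof.
move=> ha hv s Is.
rewrite (@prim_mul _ (fun t => (0 +i* x i)%C * wave x i t) a (wave x i) v (wave x i (-1)) z)//.
- by congr (_ + _); apply: eq_J => t _; rewrite mulrA.
- by apply: CL1Z; exact: CL1_wave.
- by move=> t It; exact: prim_cexpi.
Qed.

Definition dampF g i := damp (w i) (g i).
Definition damp_iter l g := iter l dampF g.

Let w0 i : 0 < w i. Proof. exact: lt_le_trans (w1 i). Qed.

Let winv : bounded_family (fun i => (w i)^-1%:C%C).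
Proof.
exists 1 => i; rewrite n1_real ger0_norm ?invr_ge0 ?(ltW (w0 i))//.
by rewrite invf_le1.
Qed.

Let wK i : (w i)^-1%:C%C * (w i)%:C%C = 1 :> R[i].
Proof. by rewrite -rmorphM /= mulVf ?gt_eqF. Qed.

Lemma HF0_scaled_damp g : HF 0 g -> HF 0 (fun i t => (w i)%:C%C * dampF g i t).
Proof.
move=> [c hc]; exists c => i; have [h1 h2] := hc i.
by have [h3 h4] := damp_energy (w0 i) h1; split => //; exact: le_trans h4 h2.
Qed.

Lemma HF0_damp g : HF 0 g -> HF 0 (dampF g).
Proof.
move=> /HF0_scaled_damp/(HFZ winv); apply: HF_eq => i s _.
by rewrite mulrA wK mul1r.
Qed.

Lemma HF0_damp_iter l g : HF 0 g -> HF 0 (damp_iter l g).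
Proof. by move=> hg; elim: l => // l IH; exact: HF0_damp. Qed.

Lemma damp_scale c (z : R[i]) (u : R -> R[i]) : CL1 u ->
  damp c (fun t => z * u t) = (fun t => z * damp c u t).
Proof.
move=> hu; apply/funext => s; rewrite /damp.
rewrite (@eq_J _ _ (fun t => z * (cexpR c t * u t))); last by move=> t _; ring.
by rewrite JZ; [ring|exact: CL1_cexpR].
Qed.

Lemma damp_iter_scale l d g : HF 0 g -> damp_iter l (fun i t => d i * g i t) = (fun i t => d i * damp_iter l g i t).
Proof.
move=> hg; elim: l => // l IH; rewrite /damp_iter !iterS -/(damp_iter l _) IH.
apply/funext => i; apply: damp_scale; exact: HF_CL1 (HF0_damp_iter l hg).
Qed.

(* Since [N^(l+1) g] solves [v' + w v = N^l g], the derivative of [e^(i s w t) v] is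
   [e^(i s w t) (N^l g + (i s - 1) N^l (w N g))], and [w N] is bounded on L^2. *)
Lemma HF_wave_damp_iter l g (sg' : R) : HF 0 g ->
  HF l (fun i t => wave (fun i => sg' * w i) i t * damp_iter l g i t).
Proof.
elim: l g => [|l IH] g hg; first exact: HF0_wave.
exists (fun=> 0); split; first exact: bounded_family_cst.
exists (fun i t => wave (fun i => sg' * w i) i t * damp_iter l g i t +
  ((-1) +i* sg')%C * (wave (fun i => sg' * w i) i t * damp_iter l (fun i t => (w i)%:C%C * dampF g i t) i t)).
split.
  by apply: HFD; [exact: IH|apply: HFZ; [exact: bounded_family_cst|apply: IH; exact: HF0_scaled_damp]].
move=> i s Is; have hl := HF_CL1 i (HF0_damp_iter l hg).
rewrite (@prim_wave _ _ (fun t => damp_iter l g i t - (w i)%:C%C * damp_iter l.+1 g i t) _ 0)//.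
- rewrite mulr0; congr (_ + _); apply: eq_J => t It.
  rewrite damp_iter_scale; last exact: HF0_damp.
  have -> : damp_iter l (dampF g) = damp_iter l.+1 g by rewrite /damp_iter iterSr.
  have -> : ((-1) +i* sg')%C = 'i%C * sg'%:C%C - 1 :> R[i].
    by apply: complex_ext; rewrite !ReIm /=; ring.
  have -> : (0 +i* (sg' * w i))%C = 'i%C * sg'%:C%C * (w i)%:C%C :> R[i].
    by apply: complex_ext; rewrite !ReIm /=; ring.
  by ring.
- by apply: CL1B => //; apply: CL1Z; exact: HF_CL1 (HF0_damp_iter l.+1 hg).
- by move=> t It; rewrite add0r; exact: dampE.
Qed.

Definition J_iter (n : nat) (u : R -> R[i]) := iter n J u.

Lemma J_iterS n u t : J_iter n (J u) t = J (J_iter n u) t.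
Proof. by rewrite /J_iter -iterSr. Qed.

Lemma CL1_J_iter n u : CL1 u -> CL1 (J_iter n u).
Proof. by move=> hu; elim: n => // n; exact: CL1_J. Qed.

Lemma eq_J_iter n u v : (forall t, Iset R t -> u t = v t) ->
  forall t, Iset R t -> J_iter n u t = J_iter n v t.
Proof. by move=> uv; elim: n => // n IH t It; apply: eq_J. Qed.

Lemma J_iterD n u v : CL1 u -> CL1 v -> forall t, Iset R t ->
  J_iter n (fun t => u t + v t) t = J_iter n u t + J_iter n v t.
Proof.
move=> hu hv; elim: n => // n IH t It; rewrite /= -/(J_iter n _).
by rewrite -JD; [apply: eq_J => // r Ir; exact: IH|exact: CL1_J_iter|exact: CL1_J_iter].
Qed.

Lemma J_iterZ n z u : CL1 u -> forall t, Iset R t ->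
  J_iter n (fun t => z * u t) t = z * J_iter n u t.
Proof.
move=> hu; elim: n => // n IH t It.
by rewrite /= -JZ; [apply: eq_J => // r Ir; exact: IH|exact: CL1_J_iter].
Qed.

Lemma HF_J_iter n l U : HF l U -> HF (n + l) (fun i => J_iter n (U i)).
Proof. by move=> hU; elim: n => // n; exact: HF_J. Qed.

Lemma HF_damp_iter l g : HF 0 g -> HF l (damp_iter l g).
Proof.
(* Frequency zero: this use is the reason for a free [sg'] in [HF_wave_damp_iter]. *)
move=> hg; have := HF_wave_damp_iter l 0 hg; apply: HF_eq => i s _.
by rewrite /wave mul0r mul0r cexpi0 mul1r.
Qed.

Hypothesis sg1 : sg ^+ 2 = 1.
Let x i := sg * w i.

Definition splits n U := exists P Q, HF n P /\ HF n Q /\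
  forall i s, Iset R s -> J (fun t => wave x i t * U i t) s = wave x i s * P i s + Q i s.

Lemma splits_eq n U V : (forall i s, Iset R s -> U i s = V i s) -> splits n U -> splits n V.
Proof.
move=> UV [P [Q [hP [hQ UE]]]]; exists P, Q; split => //; split => // i s Is.
by rewrite -UE//; apply: eq_J => t It; rewrite UV.
Qed.

Lemma CL1_waveM i (u : R -> R[i]) : CL1 u -> CL1 (fun t => wave x i t * u t).
Proof. exact: CL1_cexpi. Qed.

Lemma splitsD n U V : (forall i, CL1 (U i)) -> (forall i, CL1 (V i)) ->
  splits n U -> splits n V -> splits n (fun i t => U i t + V i t).
Proof.
move=> lU lV [P [Q [hP [hQ UE]]]] [P' [Q' [hP' [hQ' VE]]]].
exists (fun i t => P i t + P' i t), (fun i t => Q i t + Q' i t).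
split; first exact: HFD. split; first exact: HFD.
move=> i s Is; rewrite (@eq_J _ _ (fun t => wave x i t * U i t + wave x i t * V i t)); last first.
  by move=> t _; ring.
rewrite JD; [|exact: CL1_waveM|exact: CL1_waveM].
by rewrite UE// VE//; ring.
Qed.

Lemma splitsZ n d U : (forall i, CL1 (U i)) -> bounded_family d ->
  splits n U -> splits n (fun i t => d i * U i t).
Proof.
move=> lU hd [P [Q [hP [hQ UE]]]].
exists (fun i t => d i * P i t), (fun i t => d i * Q i t).
split; first exact: HFZ. split; first exact: HFZ.
move=> i s Is; rewrite (@eq_J _ _ (fun t => d i * (wave x i t * U i t))); last first.
  by move=> t _; ring.
by rewrite JZ ?UE//; [ring|exact: CL1_waveM].
Qed.

(** This is 1/(ix), since sg^2 = 1; it is bounded because w >= 1. *)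
Let ixinv i : R[i] := (0 +i* - (sg * (w i)^-1))%C.

Let ixK i : ixinv i * (0 +i* x i)%C = 1.
Proof.
have wi : w i != 0 by rewrite gt_eqF.
apply: complex_ext; rewrite !ReIm /= /x; last by ring.
rewrite (_ : _ - _ = sg ^+ 2 * (w i / w i)); last by ring.
by rewrite sg1 divff// mulr1.
Qed.

Let ixinv_bdd : bounded_family ixinv.
Proof.
have := bounded_familyM (bounded_family_cst (0 +i* - sg)%C) winv.
move=> [c hc]; exists c => i; apply: le_trans (hc i).
rewrite le_eqVlt; apply/orP; left; apply/eqP; congr n1.
by apply: complex_ext; rewrite !ReIm /=; ring.
Qed.

(** [J_iter p 1] is (s + 1)^p / p!, the Taylor monomial at -1. It is smooth and independent of the
    index, so ordinary integration by parts loses nothing and lowers p by one. *)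
Lemma splits_poly n p : splits n (fun _ => J_iter p (fun=> 1)).
Proof.
elim: p => [|p [P [Q [hP [hQ IH]]]]].
  exists (fun i _ => ixinv i), (fun i _ => - (ixinv i * wave x i (-1))).
  split; first exact: HF_cst.
  split.
    by apply: HFN; apply: HF_cst; apply: bounded_familyM => //; exact: bounded_cexpi.
  move=> i s Is.
  have e : wave x i s = wave x i (-1) + J (fun t => (0 +i* x i)%C * wave x i t) s by exact: prim_cexpi.
  rewrite e (@eq_J _ _ (fun t => ixinv i * ((0 +i* x i)%C * wave x i t))); last first.
    by move=> t _; rewrite mulrA ixK mul1r mulr1.
  by rewrite JZ; [ring|apply: CL1Z; exact: CL1_wave].
have c1 : CL1 (J_iter p (fun=> 1 : R[i])).
  by apply: CL1_J_iter; exact: CL1_bdd (CMF_cst _) (fun _ _ => lexx _).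
exists (fun i s => ixinv i * J_iter p.+1 (fun=> 1) s - ixinv i * P i s), (fun i s => - (ixinv i * Q i s)).
split.
  apply: HFB; last exact: HFZ.
  apply: HFZ => //; apply: (@HF_le _ _ n (p.+1 + n)%N); first exact: leq_addl.
  by apply: (@HF_J_iter p.+1 n (fun _ _ => 1)); apply: HF_cst; exact: bounded_family_cst.
split; first by apply: HFN; exact: HFZ.
move=> i s Is.
transitivity (ixinv i * ((0 +i* x i)%C * J (fun t => wave x i t * J_iter p.+1 (fun=> 1) t) s)).
  by rewrite mulrA ixK mul1r.
rewrite -JZ; last by apply: CL1_waveM; exact: (CL1_J c1).
have := @prim_wave x i (J_iter p (fun=> 1)) (J_iter p.+1 (fun=> 1)) 0 c1
  (fun t It => esym (add0r _)) s Is.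
rewrite mulr0 add0r JD; [|by apply: CL1Z; apply: CL1_waveM; exact: (CL1_J c1)|exact: CL1_waveM].
rewrite IH// => e.
rewrite (_ : J _ s = wave x i s * J_iter p.+1 (fun=> 1) s - (wave x i s * P i s + Q i s)); first by ring.
by rewrite e; ring.
Qed.

(* [J^(n+1) N^l g = J^n N^(l+1) g + w J^(n+1) N^(l+1) g], and [w] is a combination of
   [1] and [d/dt + i x]: one integration is traded for one application of [N]. *)
Lemma splits_J_damp_iter n l g : HF 0 g -> splits (n + l).+1 (fun i => J_iter n (damp_iter l g i)).
Proof.
elim: n l => [|n IH] l hg.
  exists (fun _ _ => 0), (fun i => J (fun t => wave x i t * damp_iter l g i t)).
  split; first by apply: HF_cst; exact: bounded_family_cst.
  split; first by apply: HF_J; exact: HF_wave_damp_iter.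
  by move=> i s _; rewrite mulr0 add0r.
pose V i := J_iter n (damp_iter l.+1 g i); pose W i := J_iter n.+1 (damp_iter l.+1 g i).
have lN k i : CL1 (damp_iter k g i) by exact: HF_CL1 (HF0_damp_iter k hg).
have lV i : CL1 (V i) by exact: CL1_J_iter.
have lW i : CL1 (W i) by exact: (CL1_J (lV i)).
(* With c = -i sg one has c (i x) = w, hence V + w W = (1 - c) V + c (V + i x W). *)
have bi : (0 +i* - sg)%C * ('i%C * sg%:C%C) = 1 :> R[i].
  apply: complex_ext; rewrite !ReIm /=; last by ring.
  by transitivity (sg ^+ 2); [ring|exact: sg1].
have JE i s : Iset R s -> J_iter n.+1 (damp_iter l g i) s =
    (1 - (0 +i* - sg)%C) * V i s + (0 +i* - sg)%C * (V i s + (0 +i* x i)%C * W i s).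
  move=> Is.
  have -> : (0 +i* x i)%C = ('i%C * sg%:C%C) * (w i)%:C%C :> R[i].
    by apply: complex_ext; rewrite !ReIm /= /x; ring.
  have Ve : V i s = J_iter n.+1 (damp_iter l g i) s - (w i)%:C%C * W i s.
    rewrite /V (@eq_J_iter _ _ (J (fun t => damp_iter l g i t + - (w i)%:C%C * damp_iter l.+1 g i t)))//; last first.
      move=> t It.
      transitivity (J (fun t => damp_iter l g i t - (w i)%:C%C * damp_iter l.+1 g i t) t).
        exact: (@dampE _ (w i) _ (lN l i) t It).
      by apply: eq_J => r _; rewrite mulNr.
    rewrite J_iterS (@eq_J _ _ (fun t => J_iter n (damp_iter l g i) t + - (w i)%:C%C * J_iter n (damp_iter l.+1 g i) t)); last first.
      by move=> t It; rewrite J_iterD ?J_iterZ//; exact: CL1Z.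
    rewrite JD; [|exact: CL1_J_iter|by apply: CL1Z; exact: CL1_J_iter].
    by rewrite JZ ?mulNr//; exact: CL1_J_iter.
  rewrite mulrDr mulrA [_ * (_ * _)]mulrA bi mul1r Ve; ring.
have h1 : splits (n.+1 + l).+1 (fun i t => (1 - (0 +i* - sg)%C) * V i t).
  apply: splitsZ => //; first exact: bounded_family_cst.
  by have := IH l.+1 hg; rewrite addnS.
have h2 : splits (n.+1 + l).+1 (fun i t => (0 +i* - sg)%C * (V i t + (0 +i* x i)%C * W i t)).
  apply: splitsZ; first by move=> i; apply: CL1D => //; exact: CL1Z.
    exact: bounded_family_cst.
  (* Since W' = V and W(-1) = 0, the function e^(ixt) W is itself the primitive of e^(ixt) (V + i x
     W), so nothing is left for Q. *)
  exists W, (fun _ _ => 0); split.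
    by have := @HF_J_iter n.+1 _ _ (HF_damp_iter l.+1 hg); rewrite addnS.
  split; first by apply: HF_cst; exact: bounded_family_cst.
  move=> i s Is; rewrite addr0.
  rewrite (@prim_wave x i (V i) (W i) 0)//; last by move=> t _; rewrite add0r.
  by rewrite mulr0 add0r; apply: eq_J => t _; ring.
have := splitsD _ _ h1 h2; move=> h.
apply: (splits_eq _ (h _ _)) => [i s Is|i|i].
- by rewrite JE.
- exact: CL1Z.
- by apply: CL1Z; apply: CL1D => //; exact: CL1Z.
Qed.

(** Taylor expansion at -1: U = d + J V gives J^p U = d J^p 1 + J^(p+1) V. The monomials go to
    [splits_poly], and what remains in the end is an iterated primitive of a family in L^2. The
    parameter p is there for this induction, which trades regularity of U for integrations. *)
Lemma splits_HF n p U : HF n U -> splits (n + p).+1 (fun i => J_iter p (U i)).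
Proof.
elim: n p U => [|n IH] p U hU.
  by have := splits_J_damp_iter p 0 hU; rewrite addn0.
case: hU => [d [hd [V [hV UE]]]].
have l1 : CL1 (fun=> 1 : R[i]) by exact: CL1_bdd (CMF_cst _) (fun _ _ => lexx _).
have lV i : CL1 (V i) by exact: HF_CL1 hV.
have h1 : splits (n.+1 + p).+1 (fun i t => d i * J_iter p (fun=> 1) t).
  by apply: splitsZ => [i||]; [exact: CL1_J_iter| |exact: splits_poly].
have h2 := IH p.+1 V hV; rewrite addnS -addSn in h2.
apply: (splits_eq _ (splitsD _ _ h1 h2)) => [i s Is|i|i].
- rewrite [RHS](@eq_J_iter _ _ (fun t => d i * 1 + J (V i) t))//; last by move=> t It; rewrite UE// mulr1.
  by rewrite J_iterD ?J_iterZ ?J_iterS//; [exact: CL1Z|exact: CL1_J].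
- by apply: CL1Z; exact: CL1_J_iter.
- exact: CL1_J_iter.
Qed.

Lemma antiderivative n U : HF n U -> splits n.+1 U.
Proof. by move=> hU; have := splits_HF 0 hU; rewrite addn0. Qed.

End Antiderivative.

(** * Oscillatory classes and the regularity bootstrap *)

Section Oscillatory.
Context {R : realType} {T : Type}.
Local Notation Re := complex.Re.
Local Notation Im := complex.Im.
Implicit Types (u v p : T -> R -> R[i]) (x y : T -> R).

(** The two phases are left free: they are w and -w for the solution itself, and -w and -2w or w and
    2w for its conjugates, on which [J] acts. The identity holds almost everywhere, as in [tHk0], so
    measurability of [u] is recorded separately. *)
Definition osc n x y u := (forall i, CMF (u i)) /\
  exists p0 p1 p2, [/\ HF n p0, HF n p1, HF n p2 &
    forall i, aeI (fun t => u i t = p0 i t + wave x i t * p1 i t + wave y i t * p2 i t)].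

Lemma osc_HF n x y u : HF n u -> osc n x y u.
Proof.
move=> hu; split; first by move=> i; apply: CL1_CMF; exact: HF_CL1 hu.
have h0 : @HF R T n (fun _ _ => 0) by apply: (@HF_cst _ _ n (fun=> 0)); exact: bounded_family_cst.
exists u, (fun _ _ => 0), (fun _ _ => 0); split => // i.
by apply: aeIW => t _; rewrite !mulr0 !addr0.
Qed.

Lemma osc_eq n x y u v : (forall i s, Iset R s -> u i s = v i s) -> osc n x y u -> osc n x y v.
Proof.
move=> uv [hu [p0 [p1 [p2 [h0 h1 h2 uE]]]]]; split.
  move=> i; have [m1 m2] := hu i.
  by split; [apply: eq_MF m1|apply: eq_MF m2] => t It; rewrite uv.
exists p0, p1, p2; split => // i; apply: (aeI_mp _ (uE i)) => t It <-; exact/esym/uv.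
Qed.

Lemma oscD n x y u v : osc n x y u -> osc n x y v -> osc n x y (fun i t => u i t + v i t).
Proof.
move=> [hu [p0 [p1 [p2 [h0 h1 h2 uE]]]]] [hv [q0 [q1 [q2 [g0 g1 g2 vE]]]]]; split.
  by move=> i; exact: CMFD.
exists (fun i t => p0 i t + q0 i t), (fun i t => p1 i t + q1 i t), (fun i t => p2 i t + q2 i t).
split; [exact: HFD..|] => i; apply: (aeI_mp _ (aeI_and (uE i) (vE i))) => t It [-> ->].
by ring.
Qed.

Lemma osc_le n n' x y u : (n <= n')%N -> osc n' x y u -> osc n x y u.
Proof.
move=> nn' [hu [p0 [p1 [p2 [h0 h1 h2 uE]]]]]; split => //.
by exists p0, p1, p2; split => //; exact: HF_le nn' _.
Qed.

Lemma oscM n x y (a : R -> R[i]) u : Cn n a -> osc n x y u -> osc n x y (fun i t => a t * u i t).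
Proof.
move=> ha [hu [p0 [p1 [p2 [h0 h1 h2 uE]]]]]; split.
  by move=> i; apply: CMFM => //; apply: CL1_CMF; exact: Cn_CL1 ha.
exists (fun i t => a t * p0 i t), (fun i t => a t * p1 i t), (fun i t => a t * p2 i t).
split; [exact: HFM..|] => i; apply: (aeI_mp _ (uE i)) => t It ->; ring.
Qed.

Lemma oscN n x y u : osc n x y u -> osc n x y (fun i t => - u i t).
Proof.
have h : Cn n (fun=> -1 : R[i]).
  elim: n => [|n IH]; first by split; [exact: CMF_cst|exists (n1 (-1 : R[i]))].
  exists (-1), (fun=> 0); split; last by move=> s Is; rewrite J_cst// mul0r addr0.
  elim: {IH} n => [|n IH]; first by split; [exact: CMF_cst|exists (n1 (0 : R[i]))].
  exists 0, (fun=> 0); split => // s Is; by rewrite J_cst// mul0r addr0.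
by move=> /(oscM h); apply: osc_eq => i s _; rewrite mulN1r.
Qed.

Lemma osc_HF0 x y u : osc 0 x y u -> HF 0 u.
Proof.
move=> [hu [p0 [p1 [p2 [h0 h1 h2 uE]]]]].
apply: (@HF0_ae _ _ (fun i t => p0 i t + wave x i t * p1 i t + wave y i t * p2 i t)) => //.
  by move=> i; apply: (aeI_mp _ (uE i)) => t _ ->.
by apply: HF0D; [apply: HF0D => //|]; exact: HF0_wave.
Qed.

Lemma osc_CL1 n x y u i : osc n x y u -> CL1 (u i).
Proof. by move=> hu; apply: (HF_CL1 i) (osc_HF0 (osc_le (leq0n n) hu)). Qed.

Section Volterra.
Variables (w : T -> R) (sg : R).
Hypotheses (w1 : forall i, 1 <= w i) (sg1 : sg ^+ 2 = 1).
Let x i := sg * w i.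
Let y i := sg * (2 * w i).

(** [antiderivative] is used with w for the phase x and with 2w for the phase y. The parts without
    phase join the zero-frequency coefficient, so the set of three phases is preserved. *)
Lemma oscJ n u : osc n x y u -> osc n.+1 x y (fun i => J (u i)).
Proof.
move=> hu; have lu i := osc_CL1 i hu.
case: hu => [mu_ [p0 [p1 [p2 [h0 h1 h2 uE]]]]]; split; first by move=> i; exact: CMF_J.
have w2 i : 1 <= 2 * w i by have := w1 i; lra.
have [P1 [Q1 [hP1 [hQ1 E1]]]] := antiderivative w1 sg1 h1.
have [P2 [Q2 [hP2 [hQ2 E2]]]] := antiderivative w2 sg1 h2.
exists (fun i t => J (p0 i) t + (Q1 i t + Q2 i t)), P1, P2; split => //.
  by apply: HFD; [exact: HF_J|exact: HFD].
move=> i; apply: aeIW => s Is.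
have l0 := HF_CL1 i h0; have l1 := CL1_cexpi (x i) (HF_CL1 i h1).
have l2 := CL1_cexpi (y i) (HF_CL1 i h2).
rewrite (ae_eq_J s (mu_ i) _ (uE i)); last first.
  by apply: CL1_CMF; apply: CL1D => //; exact: CL1D.
rewrite JD//; last exact: CL1D.
by rewrite JD// E1// E2//; ring.
Qed.

Variables (k : nat -> R -> R -> R[i]) (M : R) (m : nat).
Hypothesis mk : forall a, (a <= m)%N -> CMF2 (k a).
Hypothesis kM : forall a, (a <= m)%N -> forall r t, n1 (k a r t) <= M.
Hypothesis kk : forall a, (a < m)%N -> forall s t, Iset R s -> Iset R t ->
  k a s t = k a (-1) t + J (fun r => k a.+1 r t) s.
Hypothesis kd : forall a n, (a + n < m)%N -> Cn n (fun s => k a s s).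

Lemma HF0_volt a u : (a <= m)%N -> HF 0 u -> HF 0 (fun i => volt (k a) (u i)).
Proof.
move=> am /HF0_nI[c hc]; have M0 : 0 <= M by exact: le_trans (n1_ge0 _) (kM am 0 0).
apply: (@HF0_bdd _ _ _ (M * c)) => i; have [h1 h2] := hc i.
  exact: CMF_volt (mk am) (kM am) h1.
move=> s _; apply: le_trans (n1_volt (mk am) (kM am) s h1) _.
by rewrite ler_wpM2l.
Qed.

Lemma HF0_fred a u : (a <= m)%N -> HF 0 u -> HF 0 (fun i => fred (k a) (u i)).
Proof.
move=> am /HF0_nI[c hc]; have M0 : 0 <= M by exact: le_trans (n1_ge0 _) (kM am 0 0).
apply: (@HF0_bdd _ _ _ (M * c)) => i; have [h1 h2] := hc i.
  exact (CMF_fred (mk am) (kM am) h1).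
move=> s _; apply: le_trans (n1_fred (mk am) (kM am) s h1) _.
by rewrite ler_wpM2l.
Qed.

(** Over the fixed interval all derivatives fall on the kernel, so a bound in L^2 for [u] yields as
    many derivatives as [k a] has left. *)
Lemma HF_fred n a u : (a + n <= m)%N -> HF 0 u -> HF n (fun i => fred (k a) (u i)).
Proof.
elim: n a => [|n IH] a; first by rewrite addn0; exact: HF0_fred.
rewrite addnS => anm hu; have am : (a < m)%N by apply: leq_trans anm; rewrite ltnS leq_addr.
exists (fun i => fred (k a) (u i) (-1)); split.
  have [c hc] := HF0_nI hu; have M0 : 0 <= M by exact: le_trans (n1_ge0 _) (kM am 0 0).
  exists (M * c) => i; have [h1 h2] := hc i.
  apply: le_trans (n1_fred (mk (ltnW am)) (kM (ltnW am)) _ h1) _; by rewrite ler_wpM2l.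
exists (fun i => fred (k a.+1) (u i)); split; first by apply: IH.
move=> i s Is.
apply: (fred_primitive (mk (ltnW am)) (mk am) (kM (ltnW am)) (kM am)) => //.
  exact: kk.
exact: HF_CL1 hu.
Qed.

(** The derivative is k_a(r,r) u + [volt (k a.+1) u]. The first term inherits the regularity of u;
    the second is of the original kind with one derivative of the kernel used up and one order of u
    less required, hence the induction on n with [a] free and a + n kept below m. *)
Lemma osc_volt n a u : (a + n < m)%N -> osc n x y u -> osc n.+1 x y (fun i => volt (k a) (u i)).
Proof.
elim: n a u => [|n IH] a u anm hu; have hu0 := osc_HF0 (osc_le (leq0n _) hu);
  have am : (a < m)%N by apply: leq_ltn_trans anm; exact: leq_addr.
all: have vE i s : Iset R s -> J (fun r => k a r r * u i r + volt (k a.+1) (u i) r) s = volt (k a) (u i) s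
  by move=> Is; rewrite -(volt_primitive (mk (ltnW am)) (mk am) (kM (ltnW am)) (kM am))//;
    [exact: kk|exact: HF_CL1 hu0].
all: apply: (osc_eq vE); apply: oscJ; apply: oscD; first by apply: oscM => //; exact: kd.
  by apply: osc_HF; exact: HF0_volt.
apply: IH; first by rewrite addSnnS.
exact: osc_le hu.
Qed.

(** The integral over t > s, written as a difference so that the rules for [fred] and [volt] give
    its derivative. *)
Definition wolt (h : R -> R -> R[i]) (v : R -> R[i]) (s : R) : R[i] :=
  fred h v s - volt h v s.

Lemma osc_wolt n a u : (a + n < m)%N -> osc n x y u -> osc n.+1 x y (fun i => wolt (k a) (u i)).
Proof.
move=> anm hu; apply: oscD; last by apply: oscN; exact: osc_volt.
by apply: osc_HF; apply: HF_fred; [rewrite addnS|exact: (osc_HF0 (osc_le (leq0n _) hu))].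
Qed.

End Volterra.

(** * Conjugation by the phases and the induction on the order *)

Section Bootstrap.
Variable w : T -> R.
Hypothesis w1 : forall i, 1 <= w i.

Definition nw i := - w i.

Lemma waveN i t : wave w i t * wave nw i t = 1.
Proof. by rewrite /wave /nw mulNr cexpiN. Qed.

(** Multiplication by e^(i sg w t) carries the frequencies 0, w, -w to sg w, 2 sg w, 0 in some
    order, so the coefficients are only permuted. [osc_unshift] permutes them back. *)
Lemma osc_shift n (sg : R) u : (sg = 1 \/ sg = -1) -> osc n w nw u ->
  osc n (fun i => sg * w i) (fun i => sg * (2 * w i)) (fun i t => wave (fun i => sg * w i) i t * u i t).
Proof.
move=> hsg [hu [p0 [p1 [p2 [h0 h1 h2 uE]]]]]; split.
  by move=> i; apply: CMFM => //; exact: CMF_cexpi.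
have dbl i t : wave (fun i => sg * (2 * w i)) i t = wave (fun i => sg * w i) i t ^+ 2.
  by rewrite /wave expr2 -cexpiD; congr cexpi; ring.
case: hsg => sgE; [exists p2, p0, p1|exists p1, p0, p2]; split => // i;
  apply: (aeI_mp _ (uE i)) => t It ->; rewrite dbl {}sgE;
  have := waveN i t.
- rewrite (_ : wave (fun i => 1 * w i) i t = wave w i t); last by rewrite /wave mul1r.
  move=> e; rewrite !mulrDr [wave w i t * (wave nw i t * _)]mulrA e; ring.
- rewrite (_ : wave (fun i => -1 * w i) i t = wave nw i t); last by rewrite /wave mulN1r.
  move=> e; rewrite !mulrDr [wave nw i t * (wave w i t * _)]mulrA [wave nw i t * wave w i t]mulrC e; ring.
Qed.

Lemma osc_unshift n (sg : R) u : (sg = 1 \/ sg = -1) ->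
  osc n (fun i => sg * w i) (fun i => sg * (2 * w i)) u ->
  osc n w nw (fun i t => wave (fun i => - sg * w i) i t * u i t).
Proof.
move=> hsg [hu [p0 [p1 [p2 [h0 h1 h2 uE]]]]]; split.
  by move=> i; apply: CMFM => //; exact: CMF_cexpi.
have dbl i t : wave (fun i => sg * (2 * w i)) i t = wave (fun i => sg * w i) i t ^+ 2.
  by rewrite /wave expr2 -cexpiD; congr cexpi; ring.
case: hsg => sgE; [exists p1, p2, p0|exists p1, p0, p2]; split => // i;
  apply: (aeI_mp _ (uE i)) => t It ->; rewrite dbl {}sgE;
  have := waveN i t.
- rewrite (_ : wave (fun i => 1 * w i) i t = wave w i t); last by rewrite /wave mul1r.
  rewrite (_ : wave (fun i => -1 * w i) i t = wave nw i t); last by rewrite /wave mulN1r.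
  move=> e; rewrite !mulrDr mulrA [wave nw i t * wave w i t]mulrC e expr2.
  by rewrite -[wave w i t * wave w i t * _]mulrA [wave nw i t * (wave w i t * _)]mulrA [wave nw i t * wave w i t]mulrC e; ring.
- rewrite (_ : wave (fun i => - -1 * w i) i t = wave w i t); last by rewrite /wave opprK mul1r.
  rewrite (_ : wave (fun i => -1 * w i) i t = wave nw i t); last by rewrite /wave mulN1r.
  move=> e; rewrite !mulrDr mulrA e expr2.
  by rewrite -[wave nw i t * wave nw i t * _]mulrA [wave w i t * (wave nw i t * _)]mulrA e; ring.
Qed.

Variables (k : nat -> R -> R -> R[i]) (M : R) (m : nat).
Hypothesis mk : forall a, (a <= m)%N -> CMF2 (k a).
Hypothesis kM : forall a, (a <= m)%N -> forall r t, n1 (k a r t) <= M.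
Hypothesis kk : forall a, (a < m)%N -> forall s t, Iset R s -> Iset R t ->
  k a s t = k a (-1) t + J (fun r => k a.+1 r t) s.
Hypothesis kd : forall a n, (a + n < m)%N -> Cn n (fun s => k a s s).

(** Each pass through the equation gains one derivative: V is conjugated by -w, W by w, and in
    between the operators have the fixed kernel [k 0]. The order stops at m, where both [f] and the
    derivatives of the kernel are exhausted. *)
Lemma osc_bootstrap (f y : T -> R -> R[i]) : osc m w nw f -> HF 0 y ->
  (forall i s, Iset R s -> y i s = f i s +
     (wave w i s * volt (k 0%N) (fun t => wave nw i t * y i t) s +
      wave nw i s * wolt (k 0%N) (fun t => wave w i t * y i t) s)) ->
  osc m w nw y.
Proof.
move=> hf hy yE; suff : forall n, (n <= m)%N -> osc n w nw y by apply.
elim=> [|n IH] nm; first exact: osc_HF.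
have hn := IH (ltnW nm).
apply: (@osc_eq _ _ _ (fun i s => f i s +
     (wave w i s * volt (k 0%N) (fun t => wave nw i t * y i t) s +
      wave nw i s * wolt (k 0%N) (fun t => wave w i t * y i t) s))).
  by move=> i s Is; rewrite -yE.
have s1 : (-1 : R) ^+ 2 = 1 by ring.
have s2 : (1 : R) ^+ 2 = 1 by ring.
apply: oscD; first exact: osc_le hf.
have eN : (fun i => -1 * w i) = nw by apply/funext => i; rewrite mulN1r.
have eP : (fun i => 1 * w i) = w by apply/funext => i; rewrite mul1r.
have eNN : (fun i => - -1 * w i) = w by apply/funext => i; rewrite opprK mul1r.
apply: oscD.
  have := osc_volt w1 s1 mk kM kk kd (a := 0%N) (n := n) nm (osc_shift (or_intror erefl) hn).
  by move=> /(osc_unshift (or_intror erefl)); rewrite eN eNN.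
have := osc_wolt w1 s2 mk kM kk kd (a := 0%N) (n := n) nm (osc_shift (or_introl erefl) hn).
by move=> /(osc_unshift (or_introl erefl)); rewrite eN eP.
Qed.
End Bootstrap.
End Oscillatory.

(** * Kernels of class C^[m] *)

Section JointMeasurability.
Context {R : realType}.

(** An open set is the union of the rational boxes it contains, and these are countably many. This
    connects the topology of the plane with the product sigma-algebra used by Fubini. *)
Lemma open_measurable2 (O : set (R * R)) : open O ->
  @measurable _ (measurableTypeR R * measurableTypeR R)%type O.
Proof.
move=> oO.
pose box (q : (rat * rat) * (rat * rat)) : set (R * R) :=
  `]ratr q.1.1, ratr q.1.2[ `*` `]ratr q.2.1, ratr q.2.2[.
rewrite (_ : O = \bigcup_(q in [set: (rat * rat) * (rat * rat)])
    (if `[< box q `<=` O >] then box q else set0)).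
  apply: countable_bigcupT_measurable => [|q]; first exact: countableP.
  by case: ifP => _; [apply: measurableX; exact: measurable_itv|exact: measurable0].
apply/seteqP; split => [p Op|p [q _]]; last by case: ifPn => // /asboolP; exact.
have /nbhs_ballP[e /= e0 eO] : nbhs p O by exact: open_nbhs_nbhs.
have rb (z : R) : exists a b : rat, [/\ z - e < ratr a, ratr a < z, z < ratr b & ratr b < z + e].
  have /rat_in_itvoo[a /itvP ha] : z - e < z by rewrite ltrBlDr ltrDl.
  have /rat_in_itvoo[b /itvP hb] : z < z + e by rewrite ltrDl.
  by exists a, b; rewrite !ha !hb.
have [a [b [a1 a2 b1 b2]]] := rb p.1.
have [c [d [c1 c2 d1 d2]]] := rb p.2.
exists ((a, b), (c, d)) => //.
have bO : box ((a, b), (c, d)) `<=` O.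
  move=> r [/=]; rewrite !in_itv /= => /andP[r1 r2] /andP[r3 r4]; apply: eO.
  by split; rewrite /ball /= /ball_ /= ltr_norml; apply/andP; split; lra.
rewrite (asboolT bO); split; rewrite /= in_itv /=; exact/andP.
Qed.

Lemma continuous_MF2 (h : R -> R -> R) :
  continuous (fun p : (R * R)%type => h p.1 p.2) -> MF2 h.
Proof.
move=> /continuousP ch; apply: (measurability _ (RGenOpens.measurableE R)).
move=> _ [_ [a [b ->] <-]]; rewrite setTI; apply: open_measurable2.
by apply: ch; exact: interval_open.
Qed.


(** The projection of the line onto I. Composition with it in both variables turns a kernel
    continuous on I x I into a bounded continuous kernel on the plane. *)
Definition clamp (x : R) : R := Num.max (-1) (Num.min 1 x).

Lemma clampI x : Iset R (clamp x).
Proof.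
by apply/IsetE; rewrite /clamp le_max lexx /= ge_max ge_min lexx /= andbT; lra.
Qed.

Lemma clampE x : Iset R x -> clamp x = x.
Proof.
by move=> Ix; rewrite /clamp min_r ?Iset_ge// max_r ?Iset_le.
Qed.

Lemma clamp_continuous : continuous clamp.
Proof.
move=> x; apply: (@continuous_max R R (cst (-1)) (fun x => Num.min 1 x)).
  exact: cst_continuous.
apply: (@continuous_min R R (cst 1) id); first exact: cst_continuous.
exact: cvg_id.
Qed.

Definition clamp2 (h : R -> R -> R) s t := h (clamp s) (clamp t).

Section Clamp.
Variable h : R -> R -> R.
Hypothesis ch : {within Iset R `*` Iset R, continuous (fun p : (R * R)%type => h p.1 p.2)}.

Lemma clamp2_continuous : continuous (fun p : (R * R)%type => clamp2 h p.1 p.2).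
Proof.
move=> p; have := ch; rewrite subspace_continuousP => /(_ (clamp p.1, clamp p.2)).
move=> /(_ (conj (clampI _) (clampI _))) hc.
have cc : (fun q : R * R => (clamp q.1, clamp q.2)) @ p --> within (Iset R `*` Iset R) (nbhs (clamp p.1, clamp p.2)).
  have c2 : (fun q : R * R => (clamp q.1, clamp q.2)) @ p --> (clamp p.1, clamp p.2).
    have h1 : (fun q : R * R => clamp q.1) @ p --> clamp p.1.
      by apply: cvg_comp; [exact: cvg_fst|exact: clamp_continuous].
    have h2 : (fun q : R * R => clamp q.2) @ p --> clamp p.2.
      by apply: cvg_comp; [exact: cvg_snd|exact: clamp_continuous].
    exact: (cvg_pair h1 h2).
  move=> A wA; rewrite -[nbhs _ _]/(nbhs p (fun q : R * R => A (clamp q.1, clamp q.2))).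
  have hA : nbhs p (fun q : R * R => (Iset R `*` Iset R) (clamp q.1, clamp q.2) -> A (clamp q.1, clamp q.2)).
    exact: c2 _ wA.
  by apply: filterS hA => q; apply; split => /=; exact: clampI.
exact: cvg_comp cc hc.
Qed.

Lemma clamp2_MF2 : MF2 (clamp2 h).
Proof. exact: continuous_MF2 clamp2_continuous. Qed.

Lemma clamp2_bdd : exists M, forall s t, `|clamp2 h s t| <= M.
Proof.
have cI : compact (Iset R) by exact: segment_compact.
have /compact_bounded[M [_ hM]] := continuous_compact ch (compact_setX cI cI).
exists (M + 1) => s t; apply: (hM (M + 1)); first by rewrite ltrDl.
by exists (clamp s, clamp t) => //; split; exact: clampI.
Qed.

Lemma clamp2_slice1 t : {within Iset R, continuous (fun s => clamp2 h s t)}.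
Proof.
apply: within_continuous => s.
apply: (@continuous_comp _ _ _ (fun s => (s, t)) (fun p : R * R => clamp2 h p.1 p.2)).
  have h1 : (fun x : R => x) @ s --> s by exact: cvg_id.
  have h2 : (fun x : R => t) @ s --> t by exact: cvg_cst.
  exact: (cvg_pair h1 h2).
exact: clamp2_continuous.
Qed.

Lemma clamp2_slice2 s : {within Iset R, continuous (fun t => clamp2 h s t)}.
Proof.
apply: within_continuous => t.
apply: (@continuous_comp _ _ _ (fun t => (s, t)) (fun p : R * R => clamp2 h p.1 p.2)).
  have h1 : (fun x : R => x) @ t --> t by exact: cvg_id.
  have h2 : (fun x : R => s) @ t --> s by exact: cvg_cst.
  exact: (cvg_pair h2 h1).
exact: clamp2_continuous.
Qed.
End Clamp.

(** The derivative is known for the original function [F], at interior points; the continuity is at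
    hand for the clamped functions [G] and [g], which agree with [F] and [f] on I only. *)
Lemma slice_FTC (F f : R -> R) (G g : R -> R) :
  (forall s, Iset R s -> G s = F s) -> (forall s, Iset R s -> g s = f s) ->
  {within Iset R, continuous G} -> {within Iset R, continuous g} ->
  (forall x, Ioset R x -> is_derive x 1 F (f x)) ->
  forall s, Iset R s -> G s = G (-1) + JR g s.
Proof.
move=> GF gf cG cg dF s Is.
have cF : {within Iset R, continuous F}.
  by apply: subspace_eq_continuous cG => x /[!inE]; exact: GF.
have cf : {within Iset R, continuous f}.
  by apply: subspace_eq_continuous cg => x /[!inE]; exact: gf.
rewrite !GF//; last exact: IsetN1.
by rewrite (JR_FTC cF cf dF Is); congr (_ + _); apply: eq_JR => t It; rewrite gf.
Qed.
End JointMeasurability.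

Section VanishingPrimitive.
Context {R : realType}.
Local Notation Re := complex.Re.
Local Notation Im := complex.Im.

(* Since [d * J d = 0], the product rule gives [J (d^2) = 0]; hence [d = 0] a.e., and
   then [d^2], whose derivative is [2 d d'], is constant. *)
Lemma primitive_eq0_real (d d' : R -> R) z : L1 d' ->
  (forall s, Iset R s -> d s = z + JR d' s) ->
  (forall s, Iset R s -> JR d s = 0) -> forall s, Iset R s -> d s = 0.
Proof.
move=> hd' dE Jd0 s Is.
have hd : L1 d.
  by apply: (eq_L1 (u := fun s => z + JR d' s)) => [t It|]; [rewrite dE|apply: L1D; [exact: L1cst|exact: L1_JR]].
have db t : Iset R t -> `|d t| <= `|z| + intI (fun t => `|d' t|).
  by move=> It; rewrite dE//; apply: le_trans (ler_normD _ _) _; rewrite lerD2l JR_abs_le.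
have hd2 : L1 (fun t => d t * d t) by exact: (L1M (L1_MF hd) db hd).
have hdd' : L1 (fun t => d t * d' t) by exact: (L1M (L1_MF hd) db hd').
have i0 : intI (fun t => d t * d t) = 0.
  rewrite -JR_1; have := JRM 1 hd' hd; rewrite (Jd0 _ Iset1) mulr0.
  have -> : JR (fun t => d' t * JR d t + JR d' t * d t) 1 = JR (fun t => d t * d t - z * d t) 1.
    by apply: eq_JR => t It; rewrite Jd0// {2}dE//; ring.
  by rewrite JRB//; [rewrite JRZ// (Jd0 _ Iset1) mulr0 subr0|exact: L1Z].
have d0 : aeI (fun t => d t = 0).
  have h := intI0_ae hd2 _ i0.
  by apply: (aeI_mp _ (h _)) => t It; [move/eqP; rewrite mulf_eq0 orbb => /eqP|rewrite -expr2 sqr_ge0].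
have h1 : L1 (fun t => d' t * JR d' t).
  apply: (eq_L1 (u := fun t => JR d' t * d' t)) => [t _|]; first exact: mulrC.
  exact: (L1M (MF_JR hd') (fun t _ => JR_abs_le t hd') hd').
have sq t : Iset R t -> d t ^+ 2 = z ^+ 2.
  move=> It; rewrite dE//.
  have e := JRM t hd' hd'.
  have e2 : JR (fun t => 2 * (d t * d' t)) t = 0.
    rewrite (@ae_eq_JR _ _ (fun=> 0)); first by rewrite JR_cst// mul0r.
    - by apply: L1_MF; exact: L1Z.
    - exact: measurable_cst.
    - by apply: (aeI_mp _ d0) => r _ ->; rewrite mul0r mulr0.
  have e3 : JR (fun t => 2 * (d t * d' t)) t = 2 * z * JR d' t + JR (fun t => d' t * JR d' t + JR d' t * d' t) t.
    rewrite -JRZ// -JRD; [|exact: L1Z|].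
      by apply: eq_JR => r Ir; rewrite dE//; ring.
    apply: L1D => //; apply: (eq_L1 (u := fun t => d' t * JR d' t)) => // r _; exact: mulrC.
  by move: e2; rewrite e3 -e => e2; rewrite sqrrD -[RHS]addr0 -e2; ring.
have z0 : z ^+ 2 = 0.
  have : intI (fun t => d t * d t) = 2 * z ^+ 2.
    by rewrite -intI_cst; apply: eq_intI => t It; rewrite -expr2 sq.
  by rewrite i0 => h; lra.
by have /eqP := sq _ Is; rewrite z0 sqrf_eq0 => /eqP.
Qed.

Lemma primitive_eq0 (d d' : R -> R[i]) z : CL1 d' ->
  (forall s, Iset R s -> d s = z + J d' s) ->
  (forall s, Iset R s -> J d s = 0) -> forall s, Iset R s -> d s = 0.
Proof.
move=> [h1 h2] dE Jd0 s Is; apply: complex_ext.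
  apply: (primitive_eq0_real (d := fun t => Re (d t)) (z := Re z) h1) => // t It; first by rewrite dE// !ReIm.
  by have := congr1 (@complex.Re R) (Jd0 t It).
apply: (primitive_eq0_real (d := fun t => Im (d t)) (z := Im z) h2) => // t It; first by rewrite dE// !ReIm.
by have := congr1 (@complex.Im R) (Jd0 t It).
Qed.
End VanishingPrimitive.

(** * Mixed derivatives of the kernel and regularity of its diagonal *)

Section KernelJets.
Context {R : realType}.
Local Notation Re := complex.Re.
Local Notation Im := complex.Im.
Variables (m : nat) (k : nat -> nat -> R -> R -> R[i]) (M : R).
Hypothesis mk : forall a b, (a <= m)%N -> (b <= m)%N -> CMF2 (k a b).
Hypothesis kM : forall a b, (a <= m)%N -> (b <= m)%N -> forall r t, n1 (k a b r t) <= M.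
Hypothesis ks : forall a b, (a < m)%N -> (b <= m)%N -> forall s t, Iset R s -> Iset R t ->
  k a b s t = k a b (-1) t + J (fun r => k a.+1 b r t) s.
Hypothesis kt0 : forall b, (b < m)%N -> forall s t, Iset R s -> Iset R t ->
  k 0%N b s t = k 0%N b s (-1) + J (k 0%N b.+1 s) t.

Let CL1k a b t : (a <= m)%N -> (b <= m)%N -> CL1 (fun s => k a b s t).
Proof.
move=> am bm; apply: CL1_bdd; first exact: CMF2_section' (mk am bm) t.
by move=> s _; exact: kM.
Qed.

Let CL1ind t : CL1 (fun r => (ind t r)%:C%C : R[i]).
Proof. by split; [exact: L1_bdd (MF_ind t) (fun r _ => ind_le1 t r)|exact: L1cst]. Qed.

Let JfredE a b s t : J (k a b s) t = fred (k a b) (fun r => (ind t r)%:C%C) s.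
Proof. by rewrite J_CintI; apply: eq_CintI => r _; rewrite mulrC. Qed.

(** Derivatives in t are given for a = 0 only, so the order of differentiation must be exchanged.
    Let D_a(s) be the defect of the formula. Then D_a = D_a(-1) + J D_(a+1), and D_a = 0 forces J
    D_(a+1) = 0, whence D_(a+1) = 0 by [primitive_eq0]. That lemma wants D_(a+1) to be a primitive,
    namely of D_(a+2), which explains the strict bound a < m. *)
Lemma kernel_dt a b : (a < m)%N -> (b < m)%N -> forall s t, Iset R s -> Iset R t ->
  k a b s t = k a b s (-1) + J (k a b.+1 s) t.
Proof.
elim: a b => [|a IH] b am bm s t Is It; first exact: kt0.
have aM := ltnW am.
pose D a s := k a b s t - k a b s (-1) - fred (k a b.+1) (fun r => (ind t r)%:C%C) s.
have CD c : (c <= m)%N -> CL1 (D c).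
  move=> cm; apply: CL1B; first by apply: CL1B; exact: CL1k _ (ltnW bm).
  apply: CL1_bdd; first exact: (CMF_fred (mk cm bm) (kM cm bm) (CL1ind t)).
  by move=> r _; exact: (n1_fred (mk cm bm) (kM cm bm) r (CL1ind t)).
have DE c r : (c < m)%N -> Iset R r -> D c r = D c (-1) + J (D c.+1) r.
  move=> cm Ir; have cm' := ltnW cm.
  have cf : CL1 (fred (k c.+1 b.+1) (fun r => (ind t r)%:C%C)).
    apply: CL1_bdd; first exact: (CMF_fred (mk cm bm) (kM cm bm) (CL1ind t)).
    by move=> q _; exact: (n1_fred (mk cm bm) (kM cm bm) q (CL1ind t)).
  rewrite {1}/D (ks cm (ltnW bm) Ir It) (ks cm (ltnW bm) Ir (IsetN1)).
  rewrite (fred_primitive (mk cm' bm) (mk cm bm) (kM cm' bm) (kM cm bm) (ks cm bm) (CL1ind t) Ir).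
  rewrite /D JB//; last by apply: CL1B; exact: CL1k _ (ltnW bm).
  rewrite JB; [|exact: CL1k _ (ltnW bm)|exact: CL1k _ (ltnW bm)].
  by ring.
have Da0 r : Iset R r -> D a r = 0.
  by move=> Ir; rewrite /D -JfredE (IH b (ltnW am) bm r t Ir It); ring.
have := @primitive_eq0 _ (D a.+1) (D a.+2) (D a.+1 (-1)) (CD _ am) (fun r Ir => DE a.+1 r am Ir).
move=> /(_ _ s Is); rewrite /D -JfredE => h; apply/eqP; rewrite -subr_eq0; apply/eqP.
rewrite opprD addrA; apply: h => r Ir.
by have := DE a r aM Ir; rewrite !Da0 ?add0r//; exact: IsetN1.
Qed.

Lemma Cn_trace a b n : (a + n <= m)%N -> (b <= m)%N -> Cn n (fun s => k a b s (-1)).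
Proof.
elim: n a => [|n IH] a an bm.
  have am : (a <= m)%N by apply: leq_trans an; exact: leq_addr.
  by split; [exact: CMF2_section' (mk am bm) _|exists M => s _; exact: kM].
rewrite addnS in an; have am : (a < m)%N by apply: leq_trans an; rewrite ltnS leq_addr.
exists (k a b (-1) (-1)), (fun r => k a.+1 b r (-1)); split; first exact: IH.
by move=> s Is; apply: ks => //; exact: IsetN1.
Qed.

Let CL1one : CL1 (fun=> 1 : R[i]).
Proof. by split; exact: L1cst. Qed.

(** The chain rule on the diagonal, by a joint induction. By [kernel_dt] the diagonal of [k a b] is
    its trace at t = -1 plus [volt (k a b.+1) 1]; and [volt (k a b) 1] is a primitive of the
    diagonal of [k a b] plus [volt (k a.+1 b) 1]. The second statement allows one order more because
    integrating in t compensates one derivative in t. *)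
Lemma Cn_diag_volt n :
  (forall a b, (a + b + n <= m)%N -> Cn n (fun s => k a b s s)) /\
  (forall a b, (0 < b)%N -> (b <= m)%N -> (a <= m)%N -> (a + b + n <= m.+1)%N ->
     Cn n (volt (k a b) (fun=> 1))).
Proof.
have diag0 a b : (a <= m)%N -> (b <= m)%N -> Cn 0 (fun s => k a b s s).
  move=> am bm; split; first exact: CMF_diag (mk am bm).
  by exists M => s _; exact: kM.
have volt0 a b : (a <= m)%N -> (b <= m)%N -> Cn 0 (volt (k a b) (fun=> 1)).
  move=> am bm; split; first exact: (CMF_volt (mk am bm) (kM am bm) CL1one).
  by exists (M * nI (fun=> 1 : R[i])) => s _; exact: (n1_volt (mk am bm) (kM am bm) s CL1one).
elim: n => [|n [IH1 IH2]].
  split=> [a b|a b _ bm am _]; last exact: volt0.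
  by rewrite addn0 => abm; apply: diag0; apply: leq_trans abm; rewrite ?leq_addr ?leq_addl.
have V a b : (0 < b)%N -> (b <= m)%N -> (a + b + n.+1 <= m.+1)%N ->
     Cn n.+1 (volt (k a b) (fun=> 1)).
  move=> b0 bm; rewrite addnS ltnS => abn.
  have am : (a < m)%N.
    apply: leq_trans abn; rewrite -addnA -[X in (X < _)%N]addn0 ltn_add2l.
    by rewrite addn_gt0 b0.
  exists 0, (fun s => k a b s s + volt (k a.+1 b) (fun=> 1) s); split.
    by apply: Cn_add; [exact: IH1|apply: IH2 => //; rewrite !addSn ltnS].
  move=> s Is; rewrite add0r.
  rewrite (volt_primitive (mk (ltnW am) bm) (mk am bm) (kM (ltnW am) bm) (kM am bm) (ks am bm) CL1one Is).
  by apply: eq_J => r _; rewrite mulr1.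
split=> [a b|a b b0 bm _]; last exact: V.
rewrite addnS => abn.
have am : (a < m)%N by apply: leq_trans abn; rewrite ltnS -addnA leq_addr.
have bm : (b < m)%N by apply: leq_trans abn; rewrite ltnS addnAC leq_addl.
apply: (@Cn_eq _ _ (fun s => k a b s (-1) + volt (k a b.+1) (fun=> 1) s)).
  move=> s Is; rewrite [RHS](kernel_dt am bm Is Is); congr (_ + _).
  by rewrite J_CintI; apply: eq_CintI => r _; rewrite mulr1.
apply: Cn_add; last by apply: V => //; rewrite !addnS !addSn ltnS.
apply: Cn_trace; last exact: ltnW.
by apply: leq_trans abn; rewrite addnS ltnS leq_add2r leq_addr.
Qed.
End KernelJets.

(** * Bounded kernels on the plane from a kernel of class C^[m] *)

Section KernelOfCmSq.
Context {R : realType}.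
Local Notation Re := complex.Re.
Local Notation Im := complex.Im.

(** [k a] is the clamped d_s^a K: the regularity argument differentiates in s only, once the
    diagonals are known to be regular. The derivative [kt] in t serves the integration by parts in V
    W. *)
Lemma Cm_sq_kernel m (K : R -> R -> R[i]) : Cm_sq m K ->
  exists (k : nat -> R -> R -> R[i]) (M : R),
  [/\ forall s t, Iset R s -> Iset R t -> k 0%N s t = K s t,
      forall a, (a <= m)%N -> CMF2 (k a),
      forall a, (a <= m)%N -> forall r t, n1 (k a r t) <= M,
      forall a, (a < m)%N -> forall s t, Iset R s -> Iset R t ->
        k a s t = k a (-1) t + J (fun r => k a.+1 r t) s &
      forall a n, (a + n < m)%N -> Cn n (fun s => k a s s)] /\
  ((0 < m)%N -> exists kt : R -> R -> R[i],
     [/\ CMF2 kt, forall r t, n1 (kt r t) <= M &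
         forall s t, Iset R s -> Iset R t -> k 0%N s t = k 0%N s (-1) + J (kt s) t]).
Proof.
move=> [Kd [KE [Kc [Kt Ks]]]].
pose k a b s t := Kd a b (clamp s) (clamp t).
have mk a b : (a <= m)%N -> (b <= m)%N -> CMF2 (k a b).
  move=> am bm; have [c1 c2] := Kc a b am bm.
  split; first exact: (clamp2_MF2 (h := fun s t => Re (Kd a b s t))).
  exact: (clamp2_MF2 (h := fun s t => Im (Kd a b s t))).
(* The bound is conditional, with default 0 beyond order m, so that choice yields a total function
   [B]. *)
have bd1 a b : exists M, (a <= m)%N -> (b <= m)%N -> forall r t, n1 (k a b r t) <= M.
  case: (leqP a m) => am; last by exists 0.
  case: (leqP b m) => bm; last by exists 0.
  have [c1 c2] := Kc a b am bm.
  have [M1 h1] := clamp2_bdd (h := fun s t => Re (Kd a b s t)) c1.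
  have [M2 h2] := clamp2_bdd (h := fun s t => Im (Kd a b s t)) c2.
  by exists (M1 + M2) => _ _ r t; apply: lerD; [exact: h1|exact: h2].
have [B hB] : exists B : nat -> nat -> R, forall a b, (a <= m)%N -> (b <= m)%N ->
    forall r t, n1 (k a b r t) <= B a b.
  have [B hB] := choice (fun p : nat * nat => bd1 p.1 p.2).
  by exists (fun a b => B (a, b)) => a b; exact: (hB (a, b)).
(* The sum of all the bounds, which are nonnegative, is one constant valid for every derivative. *)
pose M := \sum_(a < m.+1) \sum_(b < m.+1) B a b.
have B0 (a b : 'I_m.+1) : 0 <= B a b.
  by apply: le_trans (n1_ge0 _) (hB a b _ _ 0 0); rewrite -ltnS.
have kM a b : (a <= m)%N -> (b <= m)%N -> forall r t, n1 (k a b r t) <= M.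
  move=> am bm r t; apply: le_trans (hB a b am bm r t) _.
  rewrite /M (bigD1 (Ordinal (am : (a < m.+1)%N)))//= (bigD1 (Ordinal (bm : (b < m.+1)%N)))//=.
  rewrite -addrA lerDl; apply: addr_ge0; apply: sumr_ge0 => i _.
    exact: (B0 (Ordinal (am : (a < m.+1)%N)) i).
  by apply: sumr_ge0 => j _; exact: B0.
have ks a b : (a < m)%N -> (b <= m)%N -> forall s t, Iset R s -> Iset R t ->
    k a b s t = k a b (-1) t + J (fun r => k a.+1 b r t) s.
  move=> am bm s t Is It; have [c1 c2] := Kc a b (ltnW am) bm.
  have [c1' c2'] := Kc a.+1 b am bm.
  apply: complex_ext; rewrite !ReIm /=.
    apply: (@slice_FTC _ (fun s => Re (Kd a b s t)) (fun s => Re (Kd a.+1 b s t))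
      (fun s => Re (k a b s t)) (fun s => Re (k a.+1 b s t))) => //.
    - by move=> r Ir; rewrite /k !clampE.
    - by move=> r Ir; rewrite /k !clampE.
    - exact: (@clamp2_slice1 _ (fun s t => Re (Kd a b s t))).
    - exact: (@clamp2_slice1 _ (fun s t => Re (Kd a.+1 b s t))).
    - by move=> r Ir; have [] := Ks a b am bm r t Ir It.
  apply: (@slice_FTC _ (fun s => Im (Kd a b s t)) (fun s => Im (Kd a.+1 b s t))
      (fun s => Im (k a b s t)) (fun s => Im (k a.+1 b s t))) => //.
  - by move=> r Ir; rewrite /k !clampE.
  - by move=> r Ir; rewrite /k !clampE.
  - exact: (@clamp2_slice1 _ (fun s t => Im (Kd a b s t))).
  - exact: (@clamp2_slice1 _ (fun s t => Im (Kd a.+1 b s t))).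
  - by move=> r Ir; have [] := Ks a b am bm r t Ir It.
have kt b : (b < m)%N -> forall s t, Iset R s -> Iset R t ->
    k 0%N b s t = k 0%N b s (-1) + J (k 0%N b.+1 s) t.
  move=> bm s t Is It; have [c1 c2] := Kc 0%N b (leq0n _) (ltnW bm).
  have [c1' c2'] := Kc 0%N b.+1 (leq0n _) bm.
  apply: complex_ext; rewrite !ReIm /=.
    apply: (@slice_FTC _ (fun t => Re (Kd 0%N b s t)) (fun t => Re (Kd 0%N b.+1 s t))
      (fun t => Re (k 0%N b s t)) (fun t => Re (k 0%N b.+1 s t))) => //.
    - by move=> r Ir; rewrite /k !clampE.
    - by move=> r Ir; rewrite /k !clampE.
    - exact: (@clamp2_slice2 _ (fun s t => Re (Kd 0%N b s t))).
    - exact: (@clamp2_slice2 _ (fun s t => Re (Kd 0%N b.+1 s t))).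
    - by move=> r Ir; have [] := Kt b bm s r Is Ir.
  apply: (@slice_FTC _ (fun t => Im (Kd 0%N b s t)) (fun t => Im (Kd 0%N b.+1 s t))
      (fun t => Im (k 0%N b s t)) (fun t => Im (k 0%N b.+1 s t))) => //.
  - by move=> r Ir; rewrite /k !clampE.
  - by move=> r Ir; rewrite /k !clampE.
  - exact: (@clamp2_slice2 _ (fun s t => Im (Kd 0%N b s t))).
  - exact: (@clamp2_slice2 _ (fun s t => Im (Kd 0%N b.+1 s t))).
  - by move=> r Ir; have [] := Kt b bm s r Is Ir.
exists (fun a => k a 0%N), M; split; last first.
  move=> m0; exists (k 0%N 1%N); split; [exact: mk|exact: kM|exact: kt].
split.
- by move=> s t Is It; rewrite /k !clampE// KE.
- by move=> a am; exact: mk.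
- by move=> a am; exact: kM.
- by move=> a am; exact: ks.
- move=> a n an; have [h _] := Cn_diag_volt mk kM ks kt n; apply: h.
  by rewrite addn0 ltnW.
Qed.
End KernelOfCmSq.

(** * Smooth bumps *)

Section Smooth.
Context {R : realType}.
Implicit Types (f g : R -> R).

Fixpoint smooth n f : Prop :=
  if n is n'.+1 then exists f', (forall x : R, is_derive x 1 f (f' x)) /\ smooth n' f'
  else True.

Lemma smooth_S n f : smooth n.+1 f -> smooth n f.
Proof. by elim: n f => // n IH f [f' [df /IH h]]; exists f'. Qed.

Lemma smoothD n f g : smooth n f -> smooth n g -> smooth n (fun x => f x + g x).
Proof.
elim: n f g => // n IH f g [f' [df sf]] [g' [dg sg]].
exists (fun x => f' x + g' x); split; last exact: IH.
by move=> x; exact: is_deriveD (df x) (dg x).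
Qed.

Lemma smoothM n f g : smooth n f -> smooth n g -> smooth n (fun x => f x * g x).
Proof.
elim: n f g => // n IH f g hf hg; have sf0 := smooth_S hf; have sg0 := smooth_S hg.
case: hf => f' [df sf]; case: hg => g' [dg sg].
exists (fun x => f' x * g x + f x * g' x); split; last by apply: smoothD; exact: IH.
move=> x; have h := is_deriveM (df x) (dg x).
apply: (is_derive_eq h); rewrite /GRing.scale /=; ring.
Qed.

Lemma smooth_cst n (c : R) : smooth n (fun=> c).
Proof.
elim: n c => // n IH c; exists (fun=> 0); split; last exact: IH.
by move=> x; exact: is_derive_cst.
Qed.

Lemma smooth_affine n f (c d : R) : smooth n f -> smooth n (fun x => f (c * x + d)).
Proof.
elim: n f => // n IH f [f' [df sf]]; exists (fun x => c * f' (c * x + d)); split.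
  move=> x.
  have hc : is_derive x 1 (fun t : R => c * t + d) c.
    have h := @is_deriveZ _ _ _ (@id R) c x 1 1 (is_derive_id x 1).
    have h2 := is_deriveD h (is_derive_cst d x 1).
    by apply: (is_derive_eq h2); rewrite scaler1 addr0.
  have h := @is_derive1_comp _ f (fun t => c * t + d) x _ _ (df _) hc.
  by apply: (is_derive_eq h); rewrite mulrC.
by apply: smoothM; [exact: smooth_cst|exact: IH].
Qed.

Lemma smooth_derive1n n f : smooth n.+1 f ->
  forall x : R, derivable (derive1n n f) x 1.
Proof.
elim: n f => [|n IH] f [f' [df sf]] x; first by have [] := df x.
rewrite derive1Sn (_ : derive1 f = f'); first exact: IH.
by apply/funext => y; rewrite derive1E; have [_ ->] := df y.
Qed.

(** The factor x^(-k) closes the classical flat functions under differentiation: the derivative of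
    [flat k] is [flat k.+2 - k flat k.+1], so smoothness of all of them follows by one induction. *)
Definition flat k (x : R) : R := if 0 < x then x^-1 ^+ k * expR (- x^-1) else 0.

(** Since e^y >= y^(k+1) / (k+1)! with y = 1/x. The linear decay gives continuity at 0. *)
Lemma flat_bdd k (x : R) : `|flat k x| <= (k.+1)`!%:R * `|x|.
Proof.
rewrite /flat; case: ifPn => [x0|_]; last by rewrite normr0 mulr_ge0.
have y0 : 0 < x^-1 by rewrite invr_gt0.
rewrite !ger0_norm ?mulr_ge0 ?exprn_ge0 ?expR_ge0 ?(ltW y0) ?(ltW x0)//.
have h := expR_ge1Dxn k (ltW y0).
have fact0 : 0 < (k.+1)`!%:R :> R by rewrite ltr0n fact_gt0.
have h2 : x^-1 ^+ k.+1 <= (k.+1)`!%:R * expR x^-1.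
  rewrite mulrC -ler_pdivrMr//; apply: le_trans h; lra.
rewrite expRN ler_pdivrMr ?expR_gt0//.
rewrite -mulrA [x * _]mulrC mulrA -ler_pdivrMr//.
by rewrite -exprSr.
Qed.

Lemma flat_continuous0 k : {for 0, continuous (flat k)}.
Proof.
have f0 : flat k 0 = 0 by rewrite /flat ltxx.
suff h : flat k @ (0 : R) --> flat k 0 by exact: h.
rewrite f0; apply/cvgrPdist_le => e e0.
have c0 : 0 < (k.+1)`!%:R :> R by rewrite ltr0n fact_gt0.
near=> x; rewrite sub0r normrN; apply: le_trans (flat_bdd k x) _.
rewrite -ler_pdivlMl//; near: x.
have d0 : 0 < (k.+1)`!%:R^-1 * e by rewrite mulr_gt0 ?invr_gt0.
apply/nbhs_ballP; exists ((k.+1)`!%:R^-1 * e) => //= x.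
by rewrite /ball /= sub0r normrN => /ltW.
Unshelve. all: by end_near. Qed.

Lemma is_derive_flat k (x : R) : is_derive x 1 (flat k) (flat k.+2 x - k%:R * flat k.+1 x).
Proof.
case: (ltrgtP x 0) => [x0|x0|->].
- have -> : flat k.+2 x - k%:R * flat k.+1 x = 0.
    by rewrite /flat ltNge (ltW x0) /= mulr0 subr0.
  apply: (@near_eq_is_derive _ _ _ (fun=> 0)).
  near=> y; rewrite /flat ltNge ifF//; apply/negbTE; rewrite negbK; apply: ltW.
  by near: y; exact: lt_nbhsl.
- have xn0 : x != 0 by rewrite gt_eqF.
  have dV : is_derive x 1 (fun y : R => y^-1) (- x ^- 2).
    have h := @is_deriveV _ id x 1 1 xn0 (is_derive_id x 1).
    by apply: (is_derive_eq h); rewrite scaler1.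
  have dNV : is_derive x 1 (fun y : R => - y^-1) (x ^- 2).
    by apply: (is_derive_eq (is_deriveN dV)); rewrite opprK.
  have dX : is_derive x 1 (fun y : R => y^-1 ^+ k) (- (k%:R * x^-1 ^+ k.+1)).
    elim: {+}k => [|j IH].
      by rewrite mul0r oppr0; exact: is_derive_cst.
    rewrite (_ : (fun y : R => y^-1 ^+ j.+1) = (fun y => y^-1 * y^-1 ^+ j)).
      have h := is_deriveM dV IH.
      by apply: (is_derive_eq h); rewrite /GRing.scale /= -natr1 !exprS; field.
    by apply/funext => y; rewrite exprS.
  have dE := @is_derive1_comp _ expR (fun y => - y^-1) x _ _ (is_derive_expR _) dNV.
  have h := is_deriveM dX dE.
  have h0 : is_derive x 1 (fun y : R => y^-1 ^+ k * expR (- y^-1))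
      (flat k.+2 x - k%:R * flat k.+1 x).
    apply: (is_derive_eq h); rewrite /flat x0 /GRing.scale /=.
    by rewrite !exprS; field.
  apply: (near_eq_is_derive _ h0).
  near=> y; rewrite /flat ifT//.
  by near: y; exact: lt_nbhsr.
(* At 0 the difference quotient of [flat k] is [flat k.+1], which is continuous there with value
   0. *)
- rewrite /flat ltxx mulr0 subr0; apply/is_derive1_caratheodory.
  exists (flat k.+1); split; last by rewrite /flat ltxx.
    move=> z; rewrite /flat ltxx subr0; case: ifPn => [z0|_]; last by rewrite mul0r ?subrr.
    by rewrite ?subr0 exprS; field; rewrite gt_eqF.
  exact: flat_continuous0.
Unshelve. all: by end_near. Qed.

Lemma smooth_flat n k : smooth n (flat k).
Proof.
elim: n k => // n IH k; exists (fun x => flat k.+2 x - k%:R * flat k.+1 x); split.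
  exact: is_derive_flat.
rewrite (_ : (fun x => _) = (fun x => flat k.+2 x + (- k%:R) * flat k.+1 x)).
  by apply: smoothD => //; apply: smoothM => //; exact: smooth_cst.
by apply/funext => x; rewrite mulNr.
Qed.

Lemma flat0_le1 (x : R) : 0 <= flat 0 x <= 1.
Proof.
rewrite /flat; case: ifPn => x0; last by rewrite lexx ler01.
by rewrite expr0 mul1r expR_ge0 -expR0 ler_expR oppr_le0 invr_ge0 ltW.
Qed.

(* A smooth bump supported in [-1 + 1/(n+1), b], tending to the indicator of ]-1, b[. *)
Definition plateau (b : R) (n : nat) (x : R) : R :=
  flat 0 (n.+1%:R * x + (n.+1%:R - 1)) * flat 0 (- n.+1%:R * x + n.+1%:R * b).

Lemma smooth_plateau b n p : smooth p (plateau b n).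
Proof. by apply: smoothM; apply: smooth_affine; exact: smooth_flat. Qed.

Lemma plateau_le1 b n (x : R) : 0 <= plateau b n x <= 1.
Proof.
have /andP[h1 h2] := flat0_le1 (n.+1%:R * x + (n.+1%:R - 1)).
have /andP[h3 h4] := flat0_le1 (- n.+1%:R * x + n.+1%:R * b).
by rewrite /plateau mulr_ge0//= -[leRHS](mulr1 1) ler_pM.
Qed.

Lemma plateau_out b n (x : R) : x < -1 + n.+1%:R^-1 \/ b < x -> plateau b n x = 0.
Proof.
have n0 : 0 < n.+1%:R :> R by rewrite ltr0n.
case=> h; rewrite /plateau /flat.
  rewrite [X in X * _]ifF ?mul0r//; apply/negbTE; rewrite -leNgt.
  have := h; rewrite -(ltr_pM2l n0) mulrDr divff ?gt_eqF// mulrN1; lra.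
rewrite [X in _ * X]ifF ?mulr0//; apply/negbTE; rewrite -leNgt.
by rewrite mulNr addrC subr_le0 ler_pM2l// ltW.
Qed.

Lemma flat0_cvg (h : nat -> R) : h @ \oo --> +oo%R -> (fun n => flat 0 (h n)) @ \oo --> (1 : R).
Proof.
move=> hoo; have h0 : \forall n \near \oo, 0 < h n by exact: cvgry_gt.
have hV : (fun n => (h n)^-1) @ \oo --> (0 : R) by apply/gtr0_cvgV0.
have hN : (fun n => - (h n)^-1) @ \oo --> (- 0 : R) by exact: cvgN hV.
have c1 : (fun n => expR (- (h n)^-1)) @ \oo --> expR (- 0 : R).
  by apply: cvg_comp hN _; exact: continuous_expR.
rewrite oppr0 expR0 in c1; apply: cvg_trans c1; apply: near_eq_cvg.
near=> n; rewrite /flat expr0 mul1r ifT//.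
by near: n; exact: cvgry_gt.
Unshelve. all: by end_near. Qed.

Lemma plateau_cvg b (x : R) : -1 < x -> x != b ->
  (fun n => plateau b n x) @ \oo --> (if x < b then 1 else 0 : R).
Proof.
move=> x1 xb; have lin (d e : R) : 0 < d -> (fun n : nat => n.+1%:R * d + e) @ \oo --> +oo%R.
  move=> d0; apply/cvgryPge => A; near=> n.
  rewrite -lerBlDr -ler_pdivrMr//; apply: (@le_trans _ _ n%:R); last by rewrite ler_nat.
  by near: n; exact: nbhs_infty_ger.
case: ifPn => xltb; last first.
  have bx : b < x by rewrite lt_neqAle eq_sym xb leNgt.
  have -> : (fun n => plateau b n x) = (fun=> 0) by apply/funext => n; apply: plateau_out; right.
  exact: cvg_cst.
have h1 : (fun n : nat => n.+1%:R * x + (n.+1%:R - 1)) @ \oo --> +oo%R.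
  have -> : (fun n : nat => n.+1%:R * x + (n.+1%:R - 1)) = (fun n : nat => n.+1%:R * (x + 1) + (-1)).
    by apply/funext => n; ring.
  by apply: lin; lra.
have h2 : (fun n : nat => - n.+1%:R * x + n.+1%:R * b) @ \oo --> +oo%R.
  have -> : (fun n : nat => - n.+1%:R * x + n.+1%:R * b) = (fun n : nat => n.+1%:R * (b - x) + 0).
    by apply/funext => n; ring.
  by apply: lin; lra.
have := cvgM (flat0_cvg h1) (flat0_cvg h2); rewrite mulr1; exact.
Unshelve. all: by end_near. Qed.

End Smooth.

(** * Weak and strong derivatives *)

Section DuBoisReymond.
Context {R : realType}.
Notation mu := (@lebesgue_measure R).
Implicit Types (u v w f g : R -> R).

Lemma smooth_continuous f : smooth 1 f -> continuous f.
Proof. by move=> [f' [df _]]; exact: derive_continuous df. Qed.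

Section PrimitiveTest.
Variables (xi : R -> R) (a b : R).
Hypotheses (sxi : forall p, smooth p xi) (a1 : -1 < a) (b1 : b < 1).
Hypothesis xi0 : forall x, x < a \/ b < x -> xi x = 0.
Hypothesis ixi : intI xi = 0.

Let cxi : continuous xi. Proof. exact: (smooth_continuous (sxi 1)). Qed.

(** As [xi] vanishes off [a, b], the integral may start at -2 and lose its cut-off at 1; in this
    form the fundamental theorem applies at every x >= a. *)
Let JR_from2 : JR xi = fun y => Rintegral mu `[-2, y] xi.
Proof.
apply/funext => y; rewrite /JR /intI [LHS]Rintegral_mkcond [RHS]Rintegral_mkcond.
congr Rintegral; apply/funext => t; rewrite !patchE /ind /Iset !mem_setE !in_itv /=.
case: (lerP (-1) t) => t1; last by rewrite (xi0 (or_introl (lt_trans t1 a1))) /=; case: ifP.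
case: (lerP t 1) => t2 /=; last by rewrite (xi0 (or_intror (lt_trans b1 t2))) /=; case: ifP.
rewrite (_ : -2 <= t) /=; last by lra.
by case: (t <= y); rewrite ?mul1r ?mul0r.
Qed.

Lemma is_derive_JR (x : R) : is_derive x 1 (JR xi) (xi x).
Proof.
case: (ltrP x a) => xa.
  rewrite (xi0 (or_introl xa)).
  apply: (@near_eq_is_derive _ _ _ (fun=> 0)).
  near=> y; have ya : y < a by near: y; exact: lt_nbhsl.
  rewrite /JR (@eq_intI _ _ (fun=> 0)) ?intI_cst ?mulr0// => t _; rewrite /ind.
  case: (lerP t y) => ty; rewrite ?mul0r//.
  by rewrite (xi0 (or_introl (le_lt_trans ty ya))) mulr0.
have x2 : -2 < x by apply: lt_le_trans xa; apply: lt_trans a1; rewrite ltrN2 ltr1n.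
have xu : x < x + 1 by lra.
have ixi2 : mu.-integrable `[-2, x + 1] (EFin \o xi).
  apply: continuous_compact_integrable; first exact: segment_compact.
  by apply: continuous_subspaceT.
have [d1 d2] := continuous_FTC1_closed xu ixi2 x2 (@cxi x).
have h := derivableP d1; rewrite -derive1E d2 in h.
by rewrite JR_from2; exact: h.
Unshelve. all: by end_near. Qed.

Lemma derive1_JR : derive1 (JR xi) = xi.
Proof. by apply/funext => x; rewrite derive1E; have [_ ->] := is_derive_JR x. Qed.

(** The vanishing mean makes the primitive return to 0 to the right of b. Hence every smooth bump of
    mean zero is the derivative of a test function. *)
Lemma test_fun_JR : test_fun (JR xi).
Proof.
split.
  move=> n x; apply: smooth_derive1n; exists xi; split; first exact: is_derive_JR.
  exact: sxi.
exists a, b; split => //; split => // x xab.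
case: xab => h; last first.
  rewrite -ixi; apply: eq_intI => t _; rewrite /ind; case: (lerP t x) => tx; first by rewrite mul1r.
  by rewrite mul0r xi0//; right; exact: lt_trans h tx.
rewrite /JR (@eq_intI _ _ (fun=> 0)) ?intI_cst ?mulr0// => t _; rewrite /ind.
case: (lerP t x) => tx; rewrite ?mul0r//.
by rewrite (xi0 (or_introl (le_lt_trans tx h))) mulr0.
Qed.
End PrimitiveTest.

Lemma MF_smooth f : smooth 1 f -> MF f.
Proof.
by move=> sf; apply: L1_MF; apply: L1_continuous; apply: within_continuous; exact: smooth_continuous.
Qed.

Lemma L1_plateau b n v : L1 v -> L1 (fun t => v t * plateau b n t).
Proof.
move=> hv; apply: (eq_L1 (u := fun t => plateau b n t * v t)) => [t _|]; first exact: mulrC.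
apply: (L1M (c := 1)) => //; first by apply: MF_smooth; exact: smooth_plateau.
by move=> t _; have /andP[h1 h2] := plateau_le1 b n t; rewrite ger0_norm.
Qed.

Lemma EFin_int_Iset u : L1 u -> (\int[mu]_(x in Iset R) (u x)%:E)%E = (intI u)%:E.
Proof. by move=> hu; rewrite -(fineK (integrable_fin_num mI hu)). Qed.

Lemma plateau_lim b v : L1 v -> (fun n => intI (fun t => v t * plateau b n t)) @ \oo --> JR v b.
Proof.
move=> hv.
have hn := L1_plateau b _ hv.
have hl := L1_ind b hv.
have mf_ n : @measurable_fun _ _ (measurableTypeR R) _ (Iset R) (fun t => (v t * plateau b n t)%:E).
  by apply/measurable_EFinP; exact: L1_MF (hn n).
have mf : @measurable_fun _ _ (measurableTypeR R) _ (Iset R) (fun t => (ind b t * v t)%:E).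
  by apply/measurable_EFinP; exact: L1_MF hl.
have ff : {ae mu, forall x, Iset R x -> (fun n => (v x * plateau b n x)%:E) @ \oo --> (ind b x * v x)%:E}.
  apply: (aeI_mp _ (aeI_and (ae_pt (-1)) (ae_pt b))) => t It [t1 tb].
  apply: cvg_EFin; first by apply: nearW.
  have tt : -1 < t by rewrite lt_neqAle eq_sym t1 Iset_le.
  have cv : (fun _ : nat => v t) @ \oo --> v t by exact: cvg_cst.
  have := cvgM cv (plateau_cvg tt tb).
  rewrite (_ : v t * _ = ind b t * v t); first by exact.
  by rewrite /ind le_eqVlt (negbTE tb) /= mulrC; case: (t < b).
have ig : mu.-integrable (Iset R) (fun t => (`|v t|)%:E) by exact: L1abs.
have fg : {ae mu, forall x n, Iset R x -> (`|(v x * plateau b n x)%:E| <= `|v x|%:E)%E}.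
  apply: (@filterE _ _ (ae_filter_ringOfSetsType mu)) => t n It; rewrite lee_fin normrM ler_piMr//.
  by have /andP[h1 h2] := plateau_le1 b n t; rewrite ger0_norm.
have [_ _ h] := dominated_convergence mI mf_ mf ff ig fg.
rewrite (EFin_int_Iset hl) in h.
exact: (fine_cvg h).
Qed.

(** Lebesgue differentiation: almost every v(t) is the derivative at t of the primitive, which is 0
    near t. *)
Lemma JR0_ae v : L1 v -> (forall b, -1 < b -> b < 1 -> JR v b = 0) -> aeI (fun t => v t = 0).
Proof.
move=> hv v0; pose f := v \_ (Iset R).
have hf : mu.-integrable setT (EFin \o f).
  have := (integrable_mkcond _ mI).1 hv; apply: (eq_integrable measurableT).
  by move=> x _; rewrite /f /= !patchE; case: ifP.
have hfy y : mu.-integrable `]-oo, y] (EFin \o f).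
  by apply: integrableS hf => //; exact: measurable_itv.
have lf : locally_integrable setT f by apply: open_integrable_locally => //; exact: openT.
have FE x : Rintegral mu `]-oo, x] f = JR v x.
  rewrite /JR /intI [LHS]Rintegral_mkcond [RHS]Rintegral_mkcond.
  congr Rintegral; apply/funext => t; rewrite /f !patchE /ind mem_setE !in_itv /=.
  by case: (t <= x); rewrite ?mul1r ?mul0r//; case: ifP.
have := FTC1Ny hfy lf; rewrite /= => h.
have h' : aeI (fun x => (derive1 (fun x => Rintegral mu `]-oo, x] f) x = f x)).
  by apply: (@filterS _ _ (ae_filter_ringOfSetsType mu) _ _ _ h) => x [].
apply: (aeI_mp _ (aeI_and h' (aeI_and (ae_pt (-1)) (ae_pt 1)))) => t It [e [t1 t2]].
have tl : -1 < t by rewrite lt_neqAle eq_sym t1 Iset_le.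
have tr : t < 1 by rewrite lt_neqAle t2 Iset_ge.
have -> : v t = f t by rewrite /f patchE mem_set.
rewrite -e derive1E (@near_eq_derive _ _ _ _ (fun=> 0)) ?derive_cst//.
near=> y; rewrite FE v0//.
  by near: y; exact: lt_nbhsr.
by near: y; exact: lt_nbhsl.
Unshelve. all: by end_near. Qed.

(** The lemma of du Bois-Reymond. A plateau minus the multiple of a fixed bump [rho] with the same
    mean has mean zero, so it is the derivative of a test function and w is orthogonal to it. Hence
    w - c is orthogonal to every plateau with b < 1; in the limit its primitive vanishes. *)
Lemma weak_const w : L1 w ->
  (forall phi, test_fun phi -> intI (fun t => w t * derive1 phi t) = 0) ->
  exists c, aeI (fun t => w t = c).
Proof.
move=> hw w0.
(* The means of [plateau 0 n] tend to 1, the length of [-1, 0], so they cannot all vanish. *)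
have [n0 r0] : exists n0, intI (plateau 0 n0) != 0 :> R.
  apply: contrapT => /forallNP h.
  have h1 : (fun n => intI (fun t => 1 * plateau 0 n t)) @ \oo --> JR (fun=> 1 : R) 0.
    exact: (@plateau_lim 0 (fun=> 1) (L1cst 1)).
  have h2 : (fun n => intI (fun t => 1 * plateau 0 n t)) = fun=> (0 : R).
    apply/funext => n; have /negP/negPn/eqP hn := h n.
    by rewrite -[RHS]hn; apply: eq_intI => t _; rewrite mul1r.
  have e : JR (fun=> 1 : R) 0 = 0.
    rewrite h2 in h1; apply: (@cvg_unique _ (@Rhausdorff R) _ _ _ _ h1).
    exact: cvg_cst.
  move: e; rewrite JR_cst; last by apply/IsetE; lra.
  by rewrite add0r mulr1 => /eqP; rewrite oner_eq0.
pose rho := plateau (0 : R) n0; pose r := intI rho.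
(* The constant for which w - c is orthogonal to [rho]. *)
pose c := intI (fun t => w t * rho t) / r.
have b1 b n : L1 (plateau b n : R -> R).
  by apply: (eq_L1 (u := fun t => 1 * plateau b n t)) => [t _|]; [exact: mul1r|exact: L1_plateau (L1cst 1)].
have ortho b n : b < 1 -> intI (fun t => (w t - c) * plateau b n t) = 0.
  move=> bl1; pose d := intI (plateau b n) / r.
  pose xi t := plateau b n t + (- d) * rho t.
  have sxi p : smooth p xi.
    apply: smoothD; first exact: smooth_plateau.
    by apply: smoothM; [exact: smooth_cst|exact: smooth_plateau].
  (* This point lies to the left of the supports of both bumps, as n + n0 is at least n and n0. *)
  pose al : R := -1 + (n + n0).+1%:R^-1.
  have al1 : -1 < al by rewrite /al ltrDl invr_gt0 ltr0n.
  have xi0 x : x < al \/ Num.max b 0 < x -> xi x = 0.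
    have inv_le k : (k <= n + n0)%N -> (n + n0).+1%:R^-1 <= k.+1%:R^-1 :> R.
      by move=> kn; rewrite lef_pV2 ?posrE ?ltr0n// ler_nat ltnS.
    case=> h; rewrite /xi /rho !plateau_out ?mulr0 ?addr0//.
    - by left; apply: lt_le_trans h _; rewrite lerD2l inv_le// leq_addl.
    - by left; apply: lt_le_trans h _; rewrite lerD2l inv_le// leq_addr.
    - by right; move: h; rewrite gt_max => /andP[].
    - by right; move: h; rewrite gt_max => /andP[].
  have m1 : Num.max b 0 < 1 by rewrite gt_max bl1 ltr01.
  have ixi : intI xi = 0.
    have br : L1 rho by exact: b1.
    rewrite intID//; last exact: L1Z.
    by rewrite intIZ// -/r /d mulNr divfK ?subrr.
  have := w0 _ (test_fun_JR sxi al1 m1 xi0 ixi).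
  rewrite (derive1_JR sxi al1 m1 xi0).
  have hwb : L1 (fun t => w t * plateau b n t) by exact: L1_plateau.
  have hwr : L1 (fun t => w t * rho t) by exact: L1_plateau.
  rewrite (@eq_intI _ _ (fun t => w t * plateau b n t + (- d) * (w t * rho t))); last first.
    by move=> t _; rewrite /xi; ring.
  rewrite intID//; last exact: L1Z.
  rewrite intIZ// => e.
  rewrite (@eq_intI _ _ (fun t => w t * plateau b n t + (- c) * plateau b n t)); last first.
    by move=> t _; ring.
  have bb := b1 b n.
  rewrite intID//; last exact: L1Z.
  rewrite intIZ// -e /c /d; congr (_ + _); field.
  exact: r0.
exists c.
have hwc : L1 (fun t => w t - c) by apply: L1B => //; exact: L1cst.
have := @JR0_ae (fun t => w t - c) hwc.
have z (b : R) : -1 < b -> b < 1 -> JR (fun t => w t - c) b = 0.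
  move=> b2 bl1; have h1 := @plateau_lim b _ hwc.
  have h2 : (fun n => intI (fun t => (w t - c) * plateau b n t)) = fun=> (0 : R).
    by apply/funext => n; exact: ortho.
  rewrite h2 in h1; apply: (@cvg_unique _ (@Rhausdorff R) _ _ _ _ h1).
  exact: cvg_cst.
move=> /(_ z); apply: aeI_mp => t _ /eqP; rewrite subr_eq0 => /eqP; exact.
Qed.

Lemma test_fun_prim phi : test_fun phi ->
  [/\ L1 (derive1 phi), forall s, Iset R s -> phi s = JR (derive1 phi) s & phi 1 = 0].
Proof.
move=> [dphi [a [b [a1 [b1 phi0]]]]].
have d0 (x : R) : is_derive x 1 phi (derive1 phi x).
  by rewrite derive1E; apply/derivableP; exact: (dphi 0%N x).
have d1 (x : R) : is_derive x 1 (derive1 phi) (derive1 (derive1 phi) x).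
  by rewrite [X in is_derive _ _ _ X]derive1E; apply/derivableP; exact: (dphi 1%N x).
have c0 := derive_continuous d0; have c1 := derive_continuous d1.
split; first by apply: L1_continuous; exact: within_continuous.
  move=> s Is; rewrite (JR_FTC (within_continuous c0) (within_continuous c1) (fun x _ => d0 x) Is).
  by rewrite phi0 ?add0r//; left.
by apply: phi0; right.
Qed.

(* Against a test function, [c + JR v] and [v] are linked by the product rule at [s = 1]. *)
Lemma strong_weak u v c : L1 v -> (forall s, Iset R s -> u s = c + JR v s) ->
  forall phi, test_fun phi ->
  intI (fun t => u t * derive1 phi t) = - intI (fun t => v t * phi t).
Proof.
move=> hv uE phi /test_fun_prim[hd pE p1].
have Mp t : Iset R t -> phi t = JR (derive1 phi) t := pE t.
have h1 : L1 (fun t => v t * JR (derive1 phi) t).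
  apply: (eq_L1 (u := fun t => JR (derive1 phi) t * v t)) => [t _|]; first exact: mulrC.
  exact: (L1M (MF_JR hd) (fun t _ => JR_abs_le t hd) hv).
have h2 : L1 (fun t => JR v t * derive1 phi t).
  exact: (L1M (MF_JR hv) (fun t _ => JR_abs_le t hv) hd).
have J1 : JR (derive1 phi) 1 = 0 by rewrite -pE ?p1//; exact: Iset1.
have e := JRM 1 hv hd; rewrite J1 mulr0 JR_1 intID// in e.
have d1 : intI (derive1 phi) = 0 by rewrite -JR_1.
rewrite (@eq_intI _ _ (fun t => c * derive1 phi t + JR v t * derive1 phi t)); last first.
  by move=> t It; rewrite uE// mulrDl.
rewrite intID//; last exact: L1Z.
rewrite intIZ// d1 mulr0 add0r (@eq_intI _ (fun t => v t * phi t) (fun t => v t * JR (derive1 phi) t)).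
  by apply/eqP; rewrite -addr_eq0 addrC -e.
by move=> t It; rewrite pE.
Qed.

(** By [strong_weak] the primitive of v also has weak derivative v, so u - [JR v] has weak
    derivative zero and is constant by [weak_const]. *)
Lemma weak_strong u v : L1 u -> L1 v ->
  (forall phi, test_fun phi ->
    intI (fun t => u t * derive1 phi t) = - intI (fun t => v t * phi t)) ->
  exists c, aeI (fun t => u t = c + JR v t).
Proof.
move=> hu hv uv.
have [] := @weak_const (fun t => u t - JR v t).
- by apply: L1B => //; exact: L1_JR.
- move=> phi tphi; have [hd pE p1] := test_fun_prim tphi.
  have [d1 d2] : L1 (fun t => u t * derive1 phi t) /\ L1 (fun t => JR v t * derive1 phi t).
    have cd : exists M, forall t, Iset R t -> `|derive1 phi t| <= M.
      have dd (x : R) : is_derive x 1 (derive1 phi) (derive1 (derive1 phi) x).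
        by case: tphi => dphi _; rewrite [X in is_derive _ _ _ X]derive1E; apply/derivableP; exact: (dphi 1%N x).
      have cI : compact (Iset R) by exact: segment_compact.
      have /compact_bounded[M [_ hM]] := continuous_compact (within_continuous (derive_continuous dd)) cI.
      by exists (M + 1) => t It; apply: (hM (M + 1)); [rewrite ltrDl|exists t].
    case: cd => M hM; split.
      apply: (eq_L1 (u := fun t => derive1 phi t * u t)) => [t _|]; first exact: mulrC.
      exact: (L1M (L1_MF hd) hM hu).
    exact: (L1M (MF_JR hv) (fun t _ => JR_abs_le t hv) hd).
  rewrite (@eq_intI _ _ (fun t => u t * derive1 phi t - JR v t * derive1 phi t)); last first.
    by move=> t _; rewrite mulrBl.
  rewrite intIB// uv// (@strong_weak (JR v) v 0)//; first by rewrite subrr.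
  by move=> s _; rewrite add0r.
- move=> c hc; exists c; apply: (aeI_mp _ hc) => t _ <-; ring.
Qed.
End DuBoisReymond.

(** * Bounded families and Sobolev norms *)

Section SobolevFamilies.
Context {R : realType} {T : Type}.
Local Notation Re := complex.Re.
Local Notation Im := complex.Im.

Lemma strong_weak_deriv (u v : R -> R[i]) z : CL1 v ->
  (forall s, Iset R s -> u s = z + J v s) -> weak_deriv u v.
Proof.
move=> [v1 v2] uE phi tphi; split.
  by apply: (strong_weak (c := Re z) v1) => // s Is; rewrite uE// !ReIm.
by apply: (strong_weak (c := Im z) v2) => // s Is; rewrite uE// !ReIm.
Qed.

Lemma weak_deriv_strong (u v : R -> R[i]) : CL1 u -> CL1 v -> weak_deriv u v ->
  exists z, aeI (fun s => u s = z + J v s).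
Proof.
move=> [u1 u2] [v1 v2] uv.
have [c hc] := weak_strong u1 v1 (fun phi tphi => (uv phi tphi).1).
have [d hd] := weak_strong u2 v2 (fun phi tphi => (uv phi tphi).2).
exists (c +i* d)%C; apply: (aeI_mp _ (aeI_and hc hd)) => t _ [h1 h2].
by apply: complex_ext; rewrite !ReIm.
Qed.

(** The a.e. identity g_0 = z + J g_1 comes from du Bois-Reymond for each index separately, so a
    uniform bound on z has to be recovered: z is constant, hence controlled by the L^1 norms of g_0
    and J g_1. *)
Lemma HF_of_jet n (g : T -> nat -> R -> R[i]) c :
  (forall i j, (j <= n)%N -> L2I (g i j) /\ intI (fun t => sqmod (g i j t)) <= c) ->
  (forall i j, (j < n)%N -> weak_deriv (g i j) (g i j.+1)) ->
  exists V, HF n V /\ forall i, aeI (fun t => g i 0%N t = V i t).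
Proof.
elim: n g => [|n IH] g gc gw.
  exists (fun i => g i 0%N); split; first by exists c => i; exact: gc.
  by move=> i; exact: aeIW.
have [|V [hV gV]] := IH (fun i j => g i j.+1) (fun i j jn => gc i j.+1 jn).
  by move=> i j jn; exact: gw.
have hg0 : HF 0 (fun i => g i 0%N) by exists c => i; exact: gc.
have hg1 : HF 0 (fun i => g i 1%N) by exists c => i; exact: gc.
have l0 i := HF_CL1 i hg0; have l1 i := HF_CL1 i hg1.
have [z hz] : {z : T -> R[i] & forall i, aeI (fun s => g i 0%N s = z i + J (g i 1%N) s)}.
  apply: (@choice _ _ (fun i z => aeI (fun s => g i 0%N s = z + J (g i 1%N) s))) => i.
  exact: weak_deriv_strong (l0 i) (l1 i) (gw i 0%N isT).
have JE i s : J (g i 1%N) s = J (V i) s.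
  by apply: ae_eq_J (gV i); apply: CL1_CMF => //; exact: HF_CL1 hV.
exists (fun i s => z i + J (V i) s); split; last first.
  by move=> i; apply: (aeI_mp _ (hz i)) => t _ ->; rewrite JE.
exists z; split; last by exists V.
have [c0 h0] := HF0_nI hg0; have [c1 h1] := HF0_nI hg1.
(* In fact 2 n1(z) obeys this bound; the factors 2 are the length of I. *)
exists ((c0 + 2 * c1)) => i; have [_ b0] := h0 i; have [_ b1] := h1 i.
have e : 2 * n1 (z i) = intI (fun t => n1 (g i 0%N t - J (g i 1%N) t)).
  rewrite -intI_cst; apply: ae_eq_intI; first exact: measurable_cst.
    by apply: MF_n1; apply: CL1_CMF; apply: CL1B => //; exact: CL1_J.
  by apply: (aeI_mp _ (hz i)) => t _ ->; rewrite addrK.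
have b : intI (fun t => n1 (g i 0%N t - J (g i 1%N) t)) <= nI (g i 0%N) + 2 * nI (g i 1%N).
  rewrite -intI_cst /nI -intID; [|exact: L1_n1|exact: L1cst].
  apply: intI_le => [||t It].
  - by apply: L1_n1; apply: CL1B => //; exact: CL1_J.
  - by apply: L1D; [exact: L1_n1|exact: L1cst].
  - by apply: le_trans (n1B _ _) _; rewrite lerD2l; exact: n1_J_nI.
have z0 := n1_ge0 (z i); lra.
Qed.

Lemma HF_of_Hm m (U : T -> R -> R[i]) c : (forall i, Hm_bound m (U i) c) ->
  exists V, HF m V /\ forall i, aeI (fun t => U i t = V i t).
Proof.
move=> /choice [g hg].
have [||V [hV gV]] := @HF_of_jet m g (c ^+ 2).
- move=> i j jm; have [g0 [gL [gw gc]]] := hg i; split; first exact: gL.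
  have S0 : 0 <= \sum_(0 <= l < m.+1) intI (fun t => sqmod (g i l t)).
    by apply: sumr_ge0 => l _; apply: intI_ge0 => t _; exact: sqmod_ge0.
  have c0 : 0 <= c by apply: le_trans gc; exact: sqrtr_ge0.
  have : \sum_(0 <= l < m.+1) intI (fun t => sqmod (g i l t)) <= c ^+ 2.
    by rewrite -[leLHS]sqr_sqrtr// lerXn2r ?nnegrE ?sqrtr_ge0.
  apply: le_trans; rewrite big_mkord (bigD1 (Ordinal (jm : (j < m.+1)%N)))//= lerDl.
  by apply: sumr_ge0 => l _; apply: intI_ge0 => t _; exact: sqmod_ge0.
- by move=> i j jm; have [_ [_ [gw _]]] := hg i; exact: gw.
exists V; split => // i; have [<- _] := hg i; exact: gV.
Qed.

Lemma jet_of_HF n (U : T -> R -> R[i]) : HF n U ->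
  exists (g : T -> nat -> R -> R[i]) (c : R), forall i,
    [/\ g i 0%N = U i,
        forall j, (j <= n)%N -> L2I (g i j) /\ intI (fun t => sqmod (g i j t)) <= c &
        forall j, (j < n)%N -> weak_deriv (g i j) (g i j.+1)].
Proof.
elim: n U => [|n IH] U hU.
  have [c hc] := hU; exists (fun i _ => U i), c => i; split => // j _; exact: hc.
have [c hc] := HF_0 hU; case: hU => z [hz [V [hV UE]]].
have [g [d hg]] := IH V hV.
exists (fun i j => if j is j'.+1 then g i j' else U i), (Num.max c d) => i.
have [g0 gL gw] := hg i; split => //.
  case=> [|j] jn.
    by have [h1 h2] := hc i; split => //; rewrite le_max h2.
  by have [h1 h2] := gL j jn; split => //; rewrite le_max h2 orbT.
case=> [|j] jn; last exact: gw.
rewrite g0; apply: (strong_weak_deriv (z := z i)) => //; first exact: HF_CL1 hV.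
exact: UE.
Qed.

Lemma Hm_of_HF m (U : T -> R -> R[i]) : HF m U ->
  exists c, 0 < c /\ forall i, Hm_bound m (U i) c.
Proof.
move=> /jet_of_HF[g [c hg]].
(* The summand 1 makes the constant positive, as [Hk0] requires. *)
exists (Num.sqrt (\sum_(0 <= j < m.+1) c) + 1); split.
  by rewrite ltr_pwDr// sqrtr_ge0.
move=> i; have [g0 gL gw] := hg i; exists (g i); split => //; split.
  by move=> j jm; have [] := gL j jm.
split => //; apply: (@le_trans _ _ (Num.sqrt (\sum_(0 <= j < m.+1) c))); last by rewrite lerDl.
rewrite ler_wsqrtr// !big_mkord; apply: ler_sum => j _.
by have [] := gL j _; first by rewrite -ltnS.
Qed.

Lemma Hm_bound_le m (u : R -> R[i]) c d : c <= d -> Hm_bound m u c -> Hm_bound m u d.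
Proof.
move=> cd [g [g0 [gL [gw gc]]]]; exists g; split => //; split => //; split => //.
exact: le_trans gc cd.
Qed.

End SobolevFamilies.

(** * The uniform bound for large frequencies *)

Section Gronwall.
Context {R : realType}.

Lemma prim_mul_real (a b u v : R -> R) (d e : R) : L1 a -> L1 b ->
  (forall s, Iset R s -> u s = d + JR a s) -> (forall s, Iset R s -> v s = e + JR b s) ->
  forall s, Iset R s -> u s * v s = d * e + JR (fun t => a t * v t + u t * b t) s.
Proof.
move=> ha hb hu hv s Is.
rewrite (@eq_JR _ _ (fun t => e * a t + (d * b t + (a t * JR b t + JR a t * b t)))); last first.
  by move=> t It; rewrite hu// hv//; ring.
have h1 : L1 (fun t => a t * JR b t).
  apply: (eq_L1 (u := fun t => JR b t * a t)) => [t _|]; first exact: mulrC.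
  exact: (L1M (MF_JR hb) (fun t _ => JR_abs_le t hb) ha).
have h2 : L1 (fun t => JR a t * b t).
  exact: (L1M (MF_JR ha) (fun t _ => JR_abs_le t ha) hb).
rewrite JRD; [|exact: L1Z|by apply: L1D; [exact: L1Z|exact: L1D]].
rewrite JRD; [|exact: L1Z|exact: L1D].
by rewrite !JRZ// -JRM// hu// hv//; ring.
Qed.

Lemma prim_expR_real (c s : R) : Iset R s ->
  expR (c * s) = expR (c * -1) + JR (fun t => c * expR (c * t)) s.
Proof.
move=> Is; have h := congr1 (@complex.Re R) (prim_expR c Is).
rewrite ReD /= in h; rewrite [LHS]h; congr (_ + _); apply: eq_JR => t _.
by rewrite ?ReM /=; ring.
Qed.

Lemma L1_expR (c : R) (u : R -> R) : L1 u -> L1 (fun t => expR (c * t) * u t).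
Proof.
apply: (L1M (c := expR `|c|)) => [|t It].
  by apply: L1_MF; apply: L1_continuous; apply: within_continuous; exact: cexpR_continuous.
by have := cexpR_bdd c It; rewrite n1_real.
Qed.

Lemma expR_le_bound (c t : R) : Iset R t -> expR (c * t) <= expR `|c|.
Proof. by move=> It; have := cexpR_bdd c It; rewrite n1_real; apply: le_trans; exact: ler_norm. Qed.

Lemma L1_expRl (c : R) : L1 (fun t => c * expR (c * t)).
Proof.
apply: (eq_L1 (u := fun t => expR (c * t) * c)) => [t _|]; first exact: mulrC.
exact: L1_expR (L1cst c).
Qed.

Section Gronwall.
Variables (a h : R -> R) (L : R).
Hypotheses (ha : L1 a) (hh : L1 h) (L0 : 0 <= L) (h0 : forall s, Iset R s -> 0 <= h s).

Let weighted_le (c : R) (v : R -> R) : `|c| = L -> L1 v ->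
  (forall s, Iset R s -> a s <= h s + L * v s) ->
  JR (fun t => expR (c * t) * (a t - L * v t)) 1 <= expR L * intI h.
Proof.
move=> cL hv av; rewrite -intIZ// -JR_1; apply: JR_le => [||t It].
- by apply: L1_expR; apply: L1B => //; exact: L1Z.
- exact: L1Z.
- apply: (@le_trans _ _ (expR (c * t) * h t)); last by rewrite ler_wpM2r ?h0// -cL expR_le_bound.
  by rewrite ler_wpM2l ?expR_ge0//; have := av t It; lra.
Qed.

(** With A = [JR a] the derivative of e^(-Ls) A is e^(-Ls) (a - L A) <= e^L h. Integrating up to s =
    1 gives e^(-L) A(1) <= e^L int h. *)
Lemma gronwall_forward : (forall s, Iset R s -> a s <= h s + L * JR a s) ->
  intI a <= expR L * (expR L * intI h).
Proof.
move=> aE; have nL : `|- L| = L by rewrite normrN ger0_norm.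
have := weighted_le nL (L1_JR ha) aE.
have := @prim_mul_real _ _ (fun t => expR (- L * t)) (JR a) _ 0 (L1_expRl (- L)) ha
  (fun s Is => prim_expR_real (- L) Is) (fun s Is => esym (add0r _)) 1 (Iset1).
rewrite mulr0 add0r mulr1 JR_1 => e.
rewrite (@eq_JR _ _ (fun t => - L * expR (- L * t) * JR a t + expR (- L * t) * a t)); last first.
  by move=> t _; ring.
rewrite -e => l.
have LL : expR L * expR (- L) = 1 by rewrite -expRD subrr expR0.
by rewrite -[intI a]mul1r -LL -mulrA ler_wpM2l ?expR_ge0.
Qed.

(** The mirror image, with the tail of the integral in place of [JR a] and the weight e^(Ls); the
    tail vanishes at 1, and its weighted value is read off at -1. *)
Lemma gronwall_backward : (forall s, Iset R s -> a s <= h s + L * (intI a - JR a s)) ->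
  intI a <= expR L * (expR L * intI h).
Proof.
move=> aE; have nL : `|L| = L by rewrite ger0_norm.
have hv : L1 (fun s => intI a - JR a s) by apply: L1B; [exact: L1cst|exact: L1_JR].
have := weighted_le nL hv aE.
have hna := L1N ha.
have vE s : Iset R s -> intI a - JR a s = intI a + JR (fun t => - a t) s.
  by move=> Is; rewrite JRN.
have := @prim_mul_real _ _ (fun t => expR (L * t)) (fun s => intI a - JR a s) _ (intI a)
  (L1_expRl L) hna (fun s Is => prim_expR_real L Is) vE 1 (Iset1).
rewrite JR_1 subrr mulr0 => e.
rewrite (@eq_JR _ _ (fun t => - (L * expR (L * t) * (intI a - JR a t) + expR (L * t) * - a t))); last first.
  by move=> t _; ring.
rewrite JRN; last first.
  apply: L1D; last exact: L1_expR.
  apply: (eq_L1 (u := fun t => expR (L * t) * (L * (intI a - JR a t)))) => [t _|]; first by ring.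
  by apply: L1_expR; exact: L1Z.
have -> : - JR (fun t => L * expR (L * t) * (intI a - JR a t) + expR (L * t) * - a t) 1
    = expR (L * -1) * intI a by apply/eqP; rewrite -subr_eq0; apply/eqP; rewrite -[RHS]oppr0 e; ring.
rewrite mulrN1 => l.
have LL : expR L * expR (- L) = 1 by rewrite -expRD subrr expR0.
by rewrite -[intI a]mul1r -LL -mulrA ler_wpM2l ?expR_ge0.
Qed.
End Gronwall.
End Gronwall.

(** * Resolvent estimate in L^1 for the split operator *)

Section LargeFrequency.
Context {R : realType}.
Local Notation Re := complex.Re.
Local Notation Im := complex.Im.
Variables (k k1 kt : R -> R -> R[i]) (M w : R).
Hypotheses (mk : CMF2 k) (mk1 : CMF2 k1) (mkt : CMF2 kt).
Hypotheses (kM : forall r t, n1 (k r t) <= M) (k1M : forall r t, n1 (k1 r t) <= M)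
  (ktM : forall r t, n1 (kt r t) <= M).
Hypothesis kk1 : forall s t, Iset R s -> Iset R t ->
  k s t = k (-1) t + J (fun r => k1 r t) s.
Hypothesis kkt : forall s t, Iset R s -> Iset R t ->
  k s t = k s (-1) + J (kt s) t.
Hypothesis w1 : 1 <= w.

Let M0 : 0 <= M. Proof. exact: le_trans (n1_ge0 _) (kM 0 0). Qed.
Let w0 : 0 < w. Proof. exact: lt_le_trans w1. Qed.

Definition ep t : R[i] := cexpi (w * t).
Definition em t : R[i] := cexpi (- w * t).
Definition VV (y : R -> R[i]) s := ep s * volt k (fun t => em t * y t) s.
Definition WW (y : R -> R[i]) s := em s * wolt k (fun t => ep t * y t) s.

Lemma CL1_ep y : CL1 y -> CL1 (fun t => ep t * y t). Proof. exact: CL1_cexpi. Qed.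
Lemma CL1_em y : CL1 y -> CL1 (fun t => em t * y t). Proof. exact: CL1_cexpi. Qed.

Lemma nI_cexpi c (y : R -> R[i]) : CL1 y -> nI (fun t => cexpi (c * t) * y t) <= 2 * nI y.
Proof.
move=> hy; apply: nI_le => //; first exact: CL1_cexpi.
by move=> t _; apply: le_trans (n1M _ _) _; rewrite ler_wpM2r ?n1_ge0// n1_cexpi.
Qed.

Lemma n1_cexpiM c t (z : R[i]) : n1 (cexpi (c * t) * z) <= 2 * n1 z.
Proof. by apply: le_trans (n1M _ _) _; rewrite ler_wpM2r ?n1_ge0// n1_cexpi. Qed.

Lemma CL1_kvolt h y : CMF2 h -> (forall r t, n1 (h r t) <= M) -> CL1 y -> CL1 (volt h y).
Proof.
move=> mh hM hy; apply: CL1_bdd; first exact: (CMF_volt mh hM hy).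
by move=> s _; exact: (n1_volt mh hM s hy).
Qed.

Lemma CL1_kfred h y : CMF2 h -> (forall r t, n1 (h r t) <= M) -> CL1 y -> CL1 (fred h y).
Proof.
move=> mh hM hy; apply: CL1_bdd; first exact (CMF_fred mh hM hy).
by move=> s _; exact: (n1_fred mh hM s hy).
Qed.

Lemma CL1_kwolt h y : CMF2 h -> (forall r t, n1 (h r t) <= M) -> CL1 y -> CL1 (wolt h y).
Proof. by move=> mh hM hy; apply: CL1B; [exact: CL1_kfred|exact: CL1_kvolt]. Qed.

Lemma CL1_VV y : CL1 y -> CL1 (VV y).
Proof. by move=> hy; apply: CL1_ep; apply: CL1_kvolt => //; exact: CL1_em. Qed.

Lemma CL1_WW y : CL1 y -> CL1 (WW y).
Proof. by move=> hy; apply: CL1_em; apply: CL1_kwolt => //; exact: CL1_ep. Qed.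

(** The inner and the outer phase each cost a factor 2 in [n1], whence 4. *)
Lemma n1_VV y s : CL1 y -> n1 (VV y s) <= 4 * M * JR (fun t => n1 (y t)) s.
Proof.
move=> hy; apply: le_trans (n1_cexpiM _ _ _) _.
have h := n1_volt_J mk kM s (CL1_em hy).
have h2 : JR (fun t => n1 (em t * y t)) s <= 2 * JR (fun t => n1 (y t)) s.
  rewrite -JRZ; last exact: L1_n1.
  apply: JR_le => [||t _]; [by apply: L1_n1; exact: CL1_em|by apply: L1Z; exact: L1_n1|].
  exact: n1_cexpiM.
have h3 := ler_wpM2l M0 h2; lra.
Qed.

Lemma woltE (y : R -> R[i]) s : CL1 y ->
  wolt k y s = CintI (fun t => (1 - ind s t)%:C%C * k s t * y t).
Proof.
move=> hy; rewrite /wolt /fred /volt -mulN1r -CintIZ; last exact: (CL1_volt mk kM s hy).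
rewrite -CintID; last by apply: CL1Z; exact: (CL1_volt mk kM s hy).
  by apply: eq_CintI => t _; rewrite rmorphB rmorph1; ring.
exact: (CL1_fred mk kM s hy).
Qed.

Lemma n1_WW y s : CL1 y -> n1 (WW y s) <= 4 * M * (nI y - JR (fun t => n1 (y t)) s).
Proof.
move=> hy; apply: le_trans (n1_cexpiM _ _ _) _.
have hy2 := CL1_ep hy; rewrite (woltE s hy2).
have ind01 t : 0 <= 1 - ind s t by rewrite /ind subr_ge0; case: (t <= s).
have hL : CL1 (fun t => (1 - ind s t)%:C%C * k s t * (ep t * y t)).
  under eq_fun do rewrite -mulrA.
  apply: (CL1M (c := 1)) (CL1_fred mk kM s hy2) => [|t _].
    split; last exact: measurable_cst.
    by apply: measurable_funB; [exact: measurable_cst|exact: MF_ind].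
  by rewrite n1_real ger0_norm// gerBl /ind ler0n.
have hn := L1_n1 hy.
have -> : nI y - JR (fun t => n1 (y t)) s = intI (fun t => (1 - ind s t) * n1 (y t)).
  rewrite /nI /JR -intIB//; last exact: L1_ind.
  by apply: eq_intI => t _; ring.
have hi : L1 (fun t => (1 - ind s t) * n1 (y t)).
  apply: (eq_L1 (u := fun t => n1 (y t) - ind s t * n1 (y t))) => [t _|]; first by ring.
  by apply: L1B => //; exact: L1_ind.
rewrite (_ : 4 * M = 2 * (2 * M)); last by ring.
rewrite -[leRHS]mulrA ler_wpM2l//; apply: le_trans (n1_CintI hL) _.
rewrite -intIZ//; apply: intI_le => [||t It]; [exact: L1_n1|exact: L1Z|].
rewrite -[X in n1 X]mulrA; apply: le_trans (n1M _ _) _; rewrite n1_real ger0_norm//.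
rewrite [leRHS]mulrCA; apply: ler_wpM2l => //; apply: le_trans (n1M _ _) _.
have h1 := n1_cexpiM w t (y t); rewrite -/(ep t) in h1.
apply: le_trans (ler_pM (n1_ge0 _) (n1_ge0 _) (kM s t) h1) _; lra.
Qed.

(* The phases of [V] and [W] do not cancel in [V W]: its kernel carries the factor
   [e^(-2iwu)] in the intermediate variable [u], and one integration by parts gains [1/w]. *)
Lemma n1_VVWW y s : CL1 y -> Iset R s -> n1 (VV (WW y) s) <= 52 * M ^+ 2 / w * nI y.
Proof.
move=> hy Is; pose Y := nI y; have Y0 : 0 <= Y by exact: nI_ge0.
have hey := CL1_ep hy; pose B := wolt k (fun t => ep t * y t).
have eY : nI (fun t => ep t * y t) <= 2 * Y by exact: nI_cexpi.
have MeY : M * nI (fun t => ep t * y t) <= M * (2 * Y) by rewrite ler_wpM2l.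
have hB : CL1 B by exact: CL1_kwolt.
(* [b] is the derivative of [B]: the lower end of the integral over t > u moves, which gives the
   diagonal term a minus sign. *)
pose b u := fred k1 (fun t => ep t * y t) u - (k u u * (ep u * y u) + volt k1 (fun t => ep t * y t) u).
have hd : CL1 (fun u => k u u * (ep u * y u)).
  by apply: (CL1M (c := M)) => //; exact: CMF_diag mk.
have hf1 := CL1_kfred mk1 k1M hey; have hv1 := CL1_kvolt mk1 k1M hey.
have hb : CL1 b by apply: CL1B => //; exact: CL1D.
have BE u : Iset R u -> B u = B (-1) + J b u.
  move=> Iu; have z1 : volt k (fun t => ep t * y t) (-1) = 0.
    by rewrite (volt_primitive mk mk1 kM k1M kk1 hey IsetN1) J_N1//; exact: CL1D.
  rewrite /B /wolt z1 subr0 (volt_primitive mk mk1 kM k1M kk1 hey Iu).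
  rewrite (fred_primitive mk mk1 kM k1M kk1 hey Iu) JB//; last exact: CL1D.
  by rewrite addrA.
have Bb u : n1 (B u) <= 4 * M * Y.
  apply: le_trans (n1B _ _) _.
  have h1 := n1_fred mk kM u hey; have h2 := n1_volt mk kM u hey; lra.
(* 10 = 4 + 2 + 4, for [fred k1], the diagonal term and [volt k1]: a factor 2 for the phase, and
   another for the length of I in the two pointwise bounds. *)
have bb : nI b <= 10 * M * Y.
  have h1 : nI (fun t => k t t * (ep t * y t)) <= M * nI (fun t => ep t * y t).
    apply: nI_le => // t _; apply: le_trans (n1M _ _) _.
    by rewrite ler_wpM2r ?n1_ge0.
  have h2 : nI (fun t => k t t * (ep t * y t) + volt k1 (fun t => ep t * y t) t) <=
     nI (fun t => k t t * (ep t * y t)) + nI (volt k1 (fun t => ep t * y t)) by exact: nID.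
  have cst_le (h : R -> R[i]) c : CL1 h -> (forall t, n1 (h t) <= c) -> nI h <= 2 * c.
    move=> hh hc; rewrite -intI_cst; apply: intI_le => [||t _] //; [exact: L1_n1|exact: L1cst].
  have h3 := cst_le _ _ hf1 (fun t => n1_fred mk1 k1M t hey).
  have h4 := cst_le _ _ hv1 (fun t => n1_volt mk1 k1M t hey).
  have h5 : nI b <= nI (fred k1 (fun t => ep t * y t)) +
      nI (fun t => k t t * (ep t * y t) + volt k1 (fun t => ep t * y t) t).
    rewrite /nI -intID; [|exact: L1_n1|by apply: L1_n1; exact: CL1D].
    apply: intI_le => [||t _]; [exact: L1_n1| |exact: n1B].
    by apply: L1D; apply: L1_n1 => //; exact: CL1D.
  lra.
pose G u := k s u * B u.
have hkt : CL1 (kt s) by apply: CL1_bdd (CMF2_section mkt s) _ => t _; exact: ktM.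
pose g u := kt s u * B u + k s u * b u.
have hg1 : CL1 (fun u => kt s u * B u) by apply: (CL1M (c := M)) => //; exact: CMF2_section.
have hg2 : CL1 (fun u => k s u * b u) by exact: (CL1_fred mk kM s hb).
have hg : CL1 g by exact: CL1D.
have GE u : Iset R u -> G u = G (-1) + J g u.
  move=> Iu; rewrite /G (prim_mul (u := k s) (v := B) hkt hb (fun u Iu => kkt Is Iu) BE Iu).
  by rewrite -!/(G _).
have Gb u : n1 (G u) <= 4 * M ^+ 2 * Y.
  apply: le_trans (n1M _ _) _.
  apply: le_trans (ler_pM (n1_ge0 _) (n1_ge0 _) (kM s u) (Bb u)) _; lra.
(* 18 = 8 + 10, from [Bb] integrated over I and from [bb]. *)
have gb : nI g <= 18 * M ^+ 2 * Y.
  have h1 : nI (fun u => kt s u * B u) <= 2 * (M * (4 * M * Y)).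
    rewrite -intI_cst; apply: intI_le => [||t _]; [exact: L1_n1|exact: L1cst|].
    apply: le_trans (n1M _ _) _.
    exact: ler_pM (n1_ge0 _) (n1_ge0 _) (ktM s t) (Bb t).
  have h2 : nI (fun u => k s u * b u) <= M * nI b.
    by apply: nI_le => // t _; apply: le_trans (n1M _ _) _; rewrite ler_wpM2r ?n1_ge0.
  have h3 := nID hg1 hg2; have h4 := ler_wpM2l M0 bb.
  rewrite -/g in h3; apply: le_trans h3 _; lra.
have VE : VV (WW y) s = ep s * J (fun u => cexpi (- (2 * w) * u) * G u) s.
  rewrite /VV; congr (_ * _); rewrite J_CintI; apply: eq_CintI => u _.
  have -> : cexpi (- (2 * w) * u) = em u * em u :> R[i].
    by rewrite /em -cexpiD; congr cexpi; ring.
  by rewrite /WW -/B /G; ring.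
pose th : R := - (2 * w); pose thi : R[i] := (0 +i* (2 * w)^-1)%C.
have thK : thi * (0 +i* th)%C = 1.
  apply: complex_ext; rewrite !ReIm /= /th; last by ring.
  by field; rewrite gt_eqF.
have thb : n1 thi = (2 * w)^-1.
  by rewrite /n1 /= normr0 add0r ger0_norm// invr_ge0 mulr_ge0// ltW.
have hJG : CL1 (fun t => cexpi (th * t) * G t) by apply: CL1_cexpi; exact: (CL1_fred mk kM s hB).
have hJg : CL1 (fun t => cexpi (th * t) * g t) by exact: CL1_cexpi.
have ibp : J (fun u => cexpi (th * u) * G u) s =
   thi * (cexpi (th * s) * G s - cexpi (th * -1) * G (-1) - J (fun t => cexpi (th * t) * g t) s).
  have h := @prim_mul _ (fun t => (0 +i* th)%C * cexpi (th * t)) g (fun t => cexpi (th * t)) G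
    (cexpi (th * -1)) (G (-1)) _ hg (fun t It => prim_cexpi th It) GE s Is.
  rewrite h; last first.
    by apply: CL1Z; apply: (CL1_bdd (c := 2)) => [|t _]; [exact: CMF_cexpi|exact: n1_cexpi].
  rewrite (@eq_J _ (fun t => (0 +i* th)%C * cexpi (th * t) * G t + cexpi (th * t) * g t)
    (fun t => (0 +i* th)%C * (cexpi (th * t) * G t) + cexpi (th * t) * g t)); last first.
    by move=> t _; rewrite mulrA.
  rewrite JD//; last exact: CL1Z.
  rewrite JZ// -{1}[J _ s]mul1r -thK; ring.
rewrite VE; apply: le_trans (n1_cexpiM _ _ _) _; rewrite -/th ibp.
have h1 := n1_cexpiM th s (G s); have h2 := n1_cexpiM th (-1) (G (-1)).
have h3 := n1_J_nI s hJg; have h4 := nI_cexpi th hg.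
have h5 := Gb s; have h6 := Gb (-1).
pose z : R[i] := cexpi (th * s) * G s - cexpi (th * -1) * G (-1) - J (fun t => cexpi (th * t) * g t) s.
(* 52 = 8 + 8 + 36: two boundary terms bounded by [Gb] and the integral bounded by [gb], each
   doubled by its phase. The doubling by the outer phase is offset by 1/(2w). *)
have h7 : n1 z <= 52 * M ^+ 2 * Y.
  apply: le_trans (n1B _ _) _; have h8 := n1B (cexpi (th * s) * G s) (cexpi (th * -1) * G (-1)).
  lra.
rewrite -/z; apply: (@le_trans _ _ (2 * ((2 * w)^-1 * n1 z))).
  by rewrite ler_wpM2l// -thb n1M.
rewrite (_ : 2 * _ = w^-1 * n1 z); last by field; rewrite gt_eqF.
rewrite (_ : _ / w * _ = w^-1 * (52 * M ^+ 2 * Y)); last by rewrite /Y; ring.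
by rewrite ler_wpM2l// invr_ge0 ltW.
Qed.

(** Gronwall forward bounds z = y - W y, which solves z = F + V z, and Gronwall backward bounds y =
    z + W y. Each contributes e^(4M) twice, whence the fourth power. *)
Lemma nI_resolvent (f y : R -> R[i]) : CL1 f -> CL1 y ->
  (forall s, Iset R s -> y s = f s + (VV y s + WW y s)) ->
  nI y <= expR (4 * M) ^+ 4 * (nI f + 104 * M ^+ 2 / w * nI y).
Proof.
move=> hf hy yE; have hW := CL1_WW hy.
pose z s := y s - WW y s; have hz : CL1 z by exact: CL1B.
pose F s := f s + VV (WW y) s.
have hVW := CL1_VV hW; have hF : CL1 F by exact: CL1D.
have L0 : 0 <= 4 * M by rewrite mulr_ge0.
have VB s : VV z s = VV y s - VV (WW y) s.
  rewrite /VV -mulrBr; congr (_ * _).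
  have e1 := CL1_em hy; have e2 := CL1_em hW.
  have c1 := CL1_volt mk kM s e1; have c2 := CL1_volt mk kM s e2.
  rewrite /volt -[X in _ = _ + X]mulN1r -CintIZ// -CintID//; last exact: CL1Z.
  by apply: eq_CintI => t _; rewrite /z; ring.
have b1 : nI z <= expR (4 * M) * (expR (4 * M) * nI F).
  apply: (gronwall_forward (L1_n1 hz) (L1_n1 hF) L0) => [s _|s Is]; first exact: n1_ge0.
  have -> : n1 (z s) = n1 (F s + VV z s).
    by congr n1; rewrite /z /F VB yE//; ring.
  by apply: le_trans (n1D _ _) _; rewrite lerD2l; exact: n1_VV.
have b2 : nI y <= expR (4 * M) * (expR (4 * M) * nI z).
  apply: (gronwall_backward (L1_n1 hy) (L1_n1 hz) L0) => [s _|s Is]; first exact: n1_ge0.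
  have {1}-> : y s = z s + WW y s by rewrite /z subrK.
  by apply: le_trans (n1D _ _) _; rewrite lerD2l; exact: n1_WW.
(* 104 = 2 * 52: the pointwise bound on V W y is integrated over an interval of length 2. *)
have b3 : nI F <= nI f + 104 * M ^+ 2 / w * nI y.
  apply: le_trans (nID hf hVW) _; rewrite lerD2l.
  rewrite (_ : 104 * _ / w * _ = 2 * (52 * M ^+ 2 / w * nI y)); last by ring.
  rewrite -intI_cst; apply: intI_le => [||t It]; [exact: L1_n1|exact: L1cst|exact: n1_VVWW].
have e0 := expR_ge0 (4 * M).
rewrite (_ : expR (4 * M) ^+ 4 * _ = expR (4 * M) * (expR (4 * M) * (expR (4 * M) * (expR (4 * M) *
  (nI f + 104 * M ^+ 2 / w * nI y))))); last by ring.
apply: le_trans b2 _; rewrite ler_wpM2l// ler_wpM2l//.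
by apply: le_trans b1 _; rewrite ler_wpM2l// ler_wpM2l.
Qed.

(** 208 = 2 * 104: from this frequency on, the term with y on the right is at most half of the
    finite quantity [nI y] and is absorbed. *)
Lemma nI_resolvent_large (f y : R -> R[i]) : CL1 f -> CL1 y ->
  (forall s, Iset R s -> y s = f s + (VV y s + WW y s)) ->
  208 * M ^+ 2 * expR (4 * M) ^+ 4 <= w -> nI y <= 2 * (expR (4 * M) ^+ 4 * nI f).
Proof.
move=> hf hy yE wl; have := nI_resolvent hf hy yE.
set e := expR (4 * M) ^+ 4; have Y0 := nI_ge0 y.
have h : e * (104 * M ^+ 2 / w) <= 2^-1.
  rewrite mulrA ler_pdivrMr//; rewrite -/e in wl; lra.
have h2 := ler_wpM2r Y0 h.
rewrite mulrDr mulrA; lra.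
Qed.
End LargeFrequency.

(** * The theorem *)

Section Assembly.
Context {R : realType}.
Local Notation Re := complex.Re.
Local Notation Im := complex.Im.

Lemma CL1_contI (y : R -> R[i]) : contI y -> CL1 y.
Proof. by move=> [c1 c2]; split; exact: L1_continuous. Qed.

Lemma solves_split (K k : R -> R -> R[i]) (M w : R) (f y : R -> R[i]) :
  CMF2 k -> (forall r t, n1 (k r t) <= M) ->
  (forall s t, Iset R s -> Iset R t -> k s t = K s t) -> CL1 y -> solves K w f y ->
  forall s, Iset R s -> y s = f s + (VV k w y s + WW k w y s).
Proof.
move=> mk kM kK hy sol s Is; rewrite -(sol s Is).
suff <- : CintI (fun t => K s t * cexpi (w * `|s - t|) * y t) = VV k w y s + WW k w y s.
  by rewrite subrK.
have h1 := CL1_em w hy; have h2 := CL1_ep w hy.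
rewrite /VV /WW (woltE mk kM s h2) /volt.
have c1 := CL1_volt mk kM s h1.
have c2 : CL1 (fun t => (1 - ind s t)%:C%C * k s t * (ep w t * y t)).
  under eq_fun do rewrite -mulrA.
  apply: (CL1M (c := 1)) (CL1_fred mk kM s h2) => [|t _].
    split; last exact: measurable_cst.
    by apply: measurable_funB; [exact: measurable_cst|exact: MF_ind].
  by rewrite n1_real ger0_norm ?subr_ge0 ?gerBl /ind ?ler0n//; case: (t <= s).
rewrite -CintIZ// -CintIZ// -CintID; [|exact: CL1Z|exact: CL1Z].
apply: eq_CintI => t It; rewrite -kK//.
rewrite /ind; case: (lerP t s) => ts.
  rewrite subrr rmorph0 rmorph1.
  have -> : cexpi (w * (s - t)) = ep w s * em w t :> R[i].
    by rewrite /ep /em -cexpiD; congr cexpi; ring.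
  by ring.
rewrite subr0 rmorph0 rmorph1.
have -> : cexpi (w * (t - s)) = em w s * ep w t :> R[i].
  by rewrite /ep /em -cexpiD; congr cexpi; ring.
by ring.
Qed.

Section Family.
Variables (T : Type) (m : nat) (K : R -> R -> R[i]) (w : T -> R).
Variables (f y f0 f1 f2 : T -> R -> R[i]).
Hypotheses (w1 : forall i, 1 <= w i) (hK : Cm_sq m K) (m0 : (0 < m)%N).
Hypotheses (yc : forall i, contI (y i)) (sol : forall i, solves K (w i) (f i) (y i)).
Variable c : R.
Hypotheses (h0 : forall i, Hm_bound m (f0 i) c) (h1 : forall i, Hm_bound m (f1 i) c)
  (h2 : forall i, Hm_bound m (f2 i) c).
Hypothesis fE : forall i, aeI (fun t => f i t =
  f0 i t + f1 i t * cexpi (w i * t) + f2 i t * cexpi (- (w i * t))).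

Let osc_f : osc m w (nw w) f.
Proof.
have [k [M [[kK mk kM kk kd] _]]] := Cm_sq_kernel hK.
split.
  (* The decomposition of [f i] holds only almost everywhere, so measurability of [f i] itself is
     read off from the equation. *)
  move=> i; have hy := CL1_contI (yc i).
  have e := solves_split (mk 0%N isT) (kM 0%N isT) kK hy (sol i).
  have : CMF (fun s => y i s - (VV (k 0%N) (w i) (y i) s + WW (k 0%N) (w i) (y i) s)).
    apply: CL1_CMF; apply: CL1B => //.
    by apply: CL1D; [apply: (@CL1_VV _ _ M) => //|apply: (@CL1_WW _ _ M) => //]; [exact: mk|exact: kM|exact: mk|exact: kM].
  case=> m1 m2; split; [apply: eq_MF m1|apply: eq_MF m2] => t It; by rewrite {1}e// addrK.
have [p0 [hp0 e0]] := HF_of_Hm h0.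
have [p1 [hp1 e1]] := HF_of_Hm h1.
have [p2 [hp2 e2]] := HF_of_Hm h2.
exists p0, p1, p2; split => // i.
apply: (aeI_mp _ (aeI_and (fE i) (aeI_and (e0 i) (aeI_and (e1 i) (e2 i))))).
by move=> t _ [-> [-> [-> ->]]]; rewrite /wave /nw mulNr; ring.
Qed.

Lemma nI_f_bdd : exists c, forall i, CL1 (f i) /\ nI (f i) <= c.
Proof. exact: HF0_nI (osc_HF0 (osc_le (leq0n _) osc_f)). Qed.

(** The L^1 bound is a hypothesis so that the lemma serves twice: for one frequency, where any bound
    will do, and for all large frequencies together. *)
Lemma osc_solution : (exists B, forall i, nI (y i) <= B) ->
  exists (p0 p1 p2 : T -> R -> R[i]) (C : R), 0 < C /\ forall i,
    [/\ Hm_bound m (p0 i) C, Hm_bound m (p1 i) C, Hm_bound m (p2 i) C &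
      aeI (fun t => y i t = p0 i t + p1 i t * cexpi (w i * t) + p2 i t * cexpi (- (w i * t)))].
Proof.
move=> [B yB].
have [k [M [[kK mk kM kk kd] _]]] := Cm_sq_kernel hK.
have hy i := CL1_contI (yc i).
have yE i := solves_split (mk 0%N isT) (kM 0%N isT) kK (hy i) (sol i).
have M0 : 0 <= M by exact: le_trans (n1_ge0 _) (kM 0%N isT 0 0).
have HFy : HF 0 y.
  apply: (@HF_eq _ _ 0 (fun i s => f i s + (VV (k 0%N) (w i) (y i) s + WW (k 0%N) (w i) (y i) s))).
    by move=> i s Is; rewrite -yE.
  apply: HF0D; first exact: osc_HF0 (osc_le (leq0n _) osc_f).
  (* V and W map L^1 into bounded functions, with constant 4M. This turns the L^1 bound on y into
     the L^2 bound that starts the bootstrap. *)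
  apply: (@HF0_bdd _ _ _ (4 * M * B + 4 * M * B)) => [i|i s Is].
    apply: CL1_CMF; apply: CL1D.
      by apply: (@CL1_VV _ _ M) => //; [exact: mk|exact: kM].
    by apply: (@CL1_WW _ _ M) => //; [exact: mk|exact: kM].
  apply: le_trans (n1D _ _) _; apply: lerD.
    apply: le_trans (n1_VV (w i) (mk 0%N isT) (kM 0%N isT) s (hy i)) _.
    rewrite ler_wpM2l ?mulr_ge0//; apply: le_trans (yB i).
    by apply: JR_le_intI => [|t _]; [exact: L1_n1|exact: n1_ge0].
  apply: le_trans (n1_WW (w i) (mk 0%N isT) (kM 0%N isT) s (hy i)) _.
  rewrite ler_wpM2l ?mulr_ge0//; apply: le_trans (yB i).
  by rewrite gerBl; apply: JR_ge0 => t _; exact: n1_ge0.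
have [_ [p0 [p1 [p2 [g0 g1 g2 e]]]]] := osc_bootstrap w1 mk kM kk kd osc_f HFy yE.
have [C0 [C0p b0]] := Hm_of_HF g0.
have [C1 [C1p b1]] := Hm_of_HF g1.
have [C2 [C2p b2]] := Hm_of_HF g2.
exists p0, p1, p2, (C0 + C1 + C2); split; first by rewrite !addr_gt0.
move=> i; split.
- apply: Hm_bound_le (b0 i); lra.
- apply: Hm_bound_le (b1 i); lra.
- apply: Hm_bound_le (b2 i); lra.
- by apply: (aeI_mp _ (e i)) => t _ ->; rewrite /wave /nw mulNr; ring.
Qed.

(** The integration by parts in V W takes one derivative of the kernel in each variable, hence 0 <
    m. The threshold depends on the kernel only. *)
Lemma nI_solution : exists w0 C : R, forall i, w0 <= w i -> nI (y i) <= C.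
Proof.
have [k [M [[kK mk kM kk kd] /(_ m0)[kt [mkt ktM kkt]]]]] := Cm_sq_kernel hK.
have [B fB] := nI_f_bdd.
exists (208 * M ^+ 2 * expR (4 * M) ^+ 4), (2 * (expR (4 * M) ^+ 4 * B)) => i wl.
have hy := CL1_contI (yc i); have [lf bf] := fB i.
have yE := solves_split (mk 0%N isT) (kM 0%N isT) kK hy (sol i).
apply: le_trans (nI_resolvent_large (mk 0%N isT) (mk 1%N m0) mkt (kM 0%N isT)
  (kM 1%N m0) ktM (kk 0%N m0) kkt (w1 i) lf hy yE wl) _.
by rewrite ler_wpM2l// ler_wpM2l// exprn_ge0// expR_ge0.
Qed.
End Family.
End Assembly.

Theorem theorem5p8 (R : realType) (m : nat) (K : R -> R -> R[i])
    (f y : R -> R -> R[i]) :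
  (0 < m)%N ->
  Cm_sq m K ->
  tHk0 m f ->
  (forall k : R, 1 < k ->
     contI (y k) /\ solves K k (f k) (y k) /\
     (forall z : R -> R[i], contI z -> solves K k (f k) z ->
        forall s : R, Iset R s -> z s = y k s)) ->
  tHk0 m y.
Proof.
move=> m0 hK [f0 [f1 [f2 [[a0 [c0 [k0 [c0p [k0p b0]]]]] [[a1 [c1 [k1 [c1p [k1p b1]]]]]
  [[a2 [c2 [k2 [c2p [k2p b2]]]]] fE]]]]]] hy.
pose ok (p : (R -> R[i]) * (R -> R[i]) * (R -> R[i])) C :=
  [/\ Hm_bound m p.1.1 C, Hm_bound m p.1.2 C & Hm_bound m p.2 C].
pose dec (p : (R -> R[i]) * (R -> R[i]) * (R -> R[i])) k :=
  aeI (fun t => y k t = p.1.1 t + p.1.2 t * cexpi (k * t) + p.2 t * cexpi (- (k * t))).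
(* Below the threshold only membership in H^m is asked, without uniformity; each k is a family over
   [unit]. *)
have single k : 1 < k -> exists p, dec p k /\ exists C, ok p C.
  move=> k1'; have [d0 e0] := a0 k k1'; have [d1 e1] := a1 k k1'; have [d2 e2] := a2 k k1'.
  pose d := Num.max d0 (Num.max d1 d2).
  have [yc [sol _]] := hy k k1'.
  have [|||||p0 [p1 [p2 [C [_ h]]]]] := @osc_solution R unit m K (fun=> k) (fun=> f k) (fun=> y k)
    (fun=> f0 k) (fun=> f1 k) (fun=> f2 k) (fun=> ltW k1') hK (fun=> yc) (fun=> sol) d.
  - by move=> _; apply: Hm_bound_le e0; rewrite /d le_max lexx.
  - by move=> _; apply: Hm_bound_le e1; rewrite /d !le_max lexx orbT.
  - by move=> _; apply: Hm_bound_le e2; rewrite /d !le_max lexx !orbT.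
  - by move=> _; exact: fE.
  - by exists (nI (y k)).
  have [h0 h1 h2 h3] := h tt; exists (p0 tt, p1 tt, p2 tt); split; first exact: h3.
  by exists C.
(* All frequencies beyond the thresholds of f0, f1, f2 form one index type, so one constant results
   for all of them. *)
have [C [kL [Cp [kLp large]]]] : exists C kL, 0 < C /\ 0 < kL /\
    forall k, 1 < k -> kL <= k -> exists p, dec p k /\ ok p C.
  pose km := Num.max k0 (Num.max k1 k2); pose d := Num.max c0 (Num.max c1 c2).
  have kmE k : km <= k -> [/\ k0 <= k, k1 <= k & k2 <= k].
    by rewrite /km !ge_max => /andP[-> /andP[-> ->]].
  pose T := {k : R | 1 < k /\ km <= k}.
  pose w (i : T) := sval i.
  have w1 i : 1 < w i by have [] := svalP i.
  have wm i : km <= w i by have [] := svalP i.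
  have g0 i : Hm_bound m (f0 (w i)) d.
    have [q0 _ _] := kmE _ (wm i); apply: Hm_bound_le (b0 _ (w1 i) q0).
    by rewrite /d le_max lexx.
  have g1 i : Hm_bound m (f1 (w i)) d.
    have [_ q1 _] := kmE _ (wm i); apply: Hm_bound_le (b1 _ (w1 i) q1).
    by rewrite /d !le_max lexx orbT.
  have g2 i : Hm_bound m (f2 (w i)) d.
    have [_ _ q2] := kmE _ (wm i); apply: Hm_bound_le (b2 _ (w1 i) q2).
    by rewrite /d !le_max lexx !orbT.
  have yc i : contI (y (w i)) by have [] := hy _ (w1 i).
  have sol i : solves K (w i) (f (w i)) (y (w i)) by have [_ []] := hy _ (w1 i).
  have fE' i := fE (w i) (w1 i).
  have [wL [B hB]] := nI_solution (fun i => ltW (w1 i)) hK m0 yc sol g0 g1 g2 fE'.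
  (* A second restriction, to the frequencies at which the L^1 bound on y is available. *)
  pose T' := {i : T | wL <= w i}; pose w' (i : T') := w (sval i).
  have [||p0 [p1 [p2 [C [Cp h]]]]] := @osc_solution R T' m K w' (fun i => f (w' i)) (fun i => y (w' i))
    (fun i => f0 (w' i)) (fun i => f1 (w' i)) (fun i => f2 (w' i)) (fun i => ltW (w1 (sval i))) hK
    (fun i => yc (sval i)) (fun i => sol (sval i)) d (fun i => g0 (sval i)) (fun i => g1 (sval i))
    (fun i => g2 (sval i)).
  - by move=> i; exact: fE'.
  - by exists B => i; apply: hB; exact: svalP i.
  exists C, (Num.max km (Num.max 1 wL)); split => //; split.
    by rewrite lt_max; apply/orP; right; rewrite lt_max ltr01.
  move=> k k1'; rewrite ge_max => /andP[kmk]; rewrite ge_max => /andP[_ wLk].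
  pose iT : T := exist (fun k : R => 1 < k /\ km <= k) k (conj k1' kmk).
  pose i : T' := exist (fun i : T => is_true (wL <= w i)) iT wLk.
  by have [q0 q1 q2 q3] := h i; exists (p0 i, p1 i, p2 i).
have [u hu] : {u : R -> (R -> R[i]) * (R -> R[i]) * (R -> R[i]) &
    forall k, 1 < k -> dec (u k) k /\ (exists C', ok (u k) C') /\ (kL <= k -> ok (u k) C)}.
  apply: (@choice _ _ (fun k p => 1 < k -> dec p k /\ (exists C', ok p C') /\ (kL <= k -> ok p C))) => k.
  (* For k <= 1 any value serves. Beyond [kL] the uniform decomposition is chosen, otherwise the one
     for k alone. *)
  case: (lerP k 1) => k1'; first by exists (f0 k, f1 k, f2 k).
  case: (lerP kL k) => kLk.
    have [p [dp op]] := large k k1' kLk; exists p => _; split => //; split => //.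
    by exists C.
  by have [p [dp op]] := single k k1'; exists p => _; split => //; split => //.
exists (fun k => (u k).1.1), (fun k => (u k).1.2), (fun k => (u k).2).
split.
  split; first by move=> k k1'; have [_ [[C' [q0 q1 q2]] _]] := hu k k1'; exists C'.
  by exists C, kL; split => //; split => // k k1' kLk; have [_ [_ /(_ kLk)[]]] := hu k k1'.
split.
  split; first by move=> k k1'; have [_ [[C' [q0 q1 q2]] _]] := hu k k1'; exists C'.
  by exists C, kL; split => //; split => // k k1' kLk; have [_ [_ /(_ kLk)[]]] := hu k k1'.
split.
  split; first by move=> k k1'; have [_ [[C' [q0 q1 q2]] _]] := hu k k1'; exists C'.
  by exists C, kL; split => //; split => // k k1' kLk; have [_ [_ /(_ kLk)[]]] := hu k k1'.
by move=> k k1'; have [h _] := hu k k1'.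
Qed.
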